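(* Let $\Delta\geq 5$ be an integer. Then, for all sufficiently large real $q$ and every real $\beta$ with $0<\beta\leq\beta_c$, w.h.p. over $G\sim \mathcal{G}_{n,\Delta}$, the RC dynamics $(X_t)_{t\geq 0}$ on $G$ starting from the all-out configuration satisfies $\mathrm{dist}_{\mathrm{TV}}(X_T,\pi_G^{\mathrm{dis}})\leq 1/5$ for some $T=O(n\log n)$.
   Context: For an integer $n$ with $\Delta n$ even, $\mathcal{G}_{n,\Delta}$ is the set of all $\Delta$-regular graphs with $n$ vertices, and $G\sim\mathcal{G}_{n,\Delta}$ denotes a uniformly random element. W.h.p. means with probability $1-o_n(1)$ as $n\to\infty$. Constants hidden in $O(\cdot)$ may depend on $q,\beta,\Delta$ but not on $n$. Random cluster (RC) model: for a graph $G=(V,E)$ and reals $q,\beta>0$, configurations are maps $\mathcal{F}:E\to\{0,1\}$; $\Omega$ is the set of all configurations; $\mathrm{In}(\mathcal{F})$ is the set of edges mapped to $1$; $c(\mathcal{F})$ is the number of connected components of $(V,\mathrm{In}(\mathcal{F}))$. The weight of $\mathcal{F}$ is $w_G(\mathcal{F})=q^{c(\mathcal{F})}(\mathrm{e}^\beta-1)^{|\mathrm{In}(\mathcal{F})|}$ and $\pi_G(\mathcal{F})=w_G(\mathcal{F})/\sum_{\mathcal{F}'\in\Omega}w_G(\mathcal{F}')$. The all-out configuration maps every edge to $0$. RC dynamics: let $p=1-\mathrm{e}^{-\beta}$ and $\hat p=\frac{p}{(1-p)q+p}$. Given $X_t\in\Omega$, choose an edge $e\in E$ uniformly at random. If $e$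 is a cut-edge of the graph $(V,\mathrm{In}(X_t)\cup\{e\})$, set $X_{t+1}(e)=1$ with probability $\hat p$ and $X_{t+1}(e)=0$ otherwise; else set $X_{t+1}(e)=1$ with probability $p$ and $X_{t+1}(e)=0$ otherwise. Set $X_{t+1}(f)=X_t(f)$ for all $f\neq e$. $\mathrm{dist}_{\mathrm{TV}}(X_t,\mu)$ denotes total variation distance between the law of $X_t$ and $\mu$. The threshold $\beta_c=\beta_c(q,\Delta)$ is the ordered/disordered threshold on random $\Delta$-regular graphs, given (for $q>2$) by $\beta_c=\log\frac{q-2}{(q-1)^{1-2/\Delta}-1}$; it satisfies $\beta_c=(1+o_q(1))\frac{2\log q}{\Delta}$. Disordered phase: for an $n$-vertex $\Delta$-regular graph $G=(V,E)$ and $\epsilon>0$ let $\phi_G(\epsilon)=\min_{S\subseteq V;\,0<|S|\leq \epsilon n}\frac{|E(S,V\setminus S)|}{\Delta|S|}$. Fix $\delta=\delta(\Delta)\in(0,1/2)$ such that w.h.p. $G\sim\mathcal{G}_{n,\Delta}$ satisfies $\phi_G(1/2)\geq 1/10$ and $\phi_G(\delta)\geq 5/9$ (such $\delta$ is known to exist for $\Delta\ge5$), and let $\eta=\min(\delta/5,1/100)$. Then $\Omega^{\mathrm{dis}}=\{\mathcal{F}\in\Omega:|\mathrm{In}(\mathcal{F})|\leq\eta|E|\}$ and $\pi_G^{\mathrm{dis}}$ is $\pi_G$ conditioned on $\Omega^{\mathrm{dis}}$. *)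

(* Defs.v *)
From HB Require Import structures.
From mathcomp Require Import all_boot all_order all_algebra.
From mathcomp Require Import all_classical all_reals all_analysis.
Set Implicit Arguments.
Unset Strict Implicit.
Unset Printing Implicit Defensive.
Import Order.TTheory GRing.Theory Num.Theory.
Import numFieldNormedType.Exports.
Local Open Scope ring_scope.

(** A graph on the vertex type [V] is given by its edge set
    [G : {set {set V}}]; it is simple when every edge is a 2-element set. *)

Definition simple_graph (V : finType) (G : {set {set V}}) : bool :=
  [forall e in G, #|e| == 2].

Definition degree (V : finType) (G : {set {set V}}) (v : V) : nat :=
  #|[set e in G | v \in e]|.

Definition regular_graphs (n Delta : nat) : {set {set {set 'I_n}}} :=
  [set G : {set {set 'I_n}} |
     simple_graph G && [forall v, degree G v == Delta]].

Definition prob_regular (R : realType) (n Delta : nat)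
    (A : {set {set 'I_n}} -> Prop) : R :=
  #|[set G in regular_graphs n Delta | `[< A G >]]|%:R
    / #|regular_graphs n Delta|%:R.

(** The limit runs over the [n] for which [Delta * n] is even. *)
Definition whp (R : realType) (Delta : nat)
    (A : forall n : nat, {set {set 'I_n}} -> Prop) : Prop :=
  (prob_regular R Delta (@A n)
     @[n --> within (fun n => ~~ odd (Delta * n)) \oo] --> (1 : R))%classic.

Definition edge_boundary (V : finType) (G : {set {set V}}) (S : {set V}) :
    {set {set V}} :=
  [set e in G | (e :&: S != finset.set0) && (e :&: ~: S != finset.set0)].

(** Extended-real valued: the minimum over an empty family is [+oo]. *)
Definition phi (R : realType) (V : finType) (Delta : nat) (G : {set {set V}})
    (eps : R) : \bar R :=
  \big[Order.min/+oo%E]_(S : {set V} |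
      (0 < #|S|)%N && (#|S|%:R <= eps * #|V|%:R))
    (#|edge_boundary G S|%:R / (Delta%:R * #|S|%:R))%:E.

Definition expansion_constant (R : realType) (Delta : nat) (delta : R) : Prop :=
  0 < delta < 1 / 2 /\
  whp R Delta (fun n (G : {set {set 'I_n}}) =>
    ((1 / 10)%:E <= phi Delta G (1 / 2 : R) /\ (5 / 9)%:E <= phi Delta G delta)%E).

Definition graph_adj (V : finType) (G : {set {set V}}) : rel V :=
  fun u v => [set u; v]%SET \in G.

Definition components (V : finType) (G : {set {set V}}) : nat :=
  n_comp (graph_adj G) predT.

Definition cut_edge (V : finType) (G : {set {set V}}) (e : {set V}) : bool :=
  (e \in G) && (components G < components (G :\ e)%SET)%N.

Definition config (V : finType) (G : {set {set V}}) : finType :=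
  {ffun {e : {set V} | e \in G} -> bool}.

Definition In_edges (V : finType) (G : {set {set V}}) (F : config G) :
    {set {set V}} :=
  [set val e | e : {e : {set V} | e \in G} & F e].

Definition all_out (V : finType) (G : {set {set V}}) : config G :=
  [ffun => false].

Definition set_edge (V : finType) (G : {set {set V}}) (F : config G)
    (e : {e : {set V} | e \in G}) (b : bool) : config G :=
  [ffun f => if f == e then b else F f].

Definition weight (R : realType) (V : finType) (G : {set {set V}}) (q beta : R)
    (F : config G) : R :=
  q ^+ components (In_edges F) * (expR beta - 1) ^+ #|In_edges F|.

Definition gibbs (R : realType) (V : finType) (G : {set {set V}}) (q beta : R)
    (F : config G) : R :=
  weight q beta F / \sum_(F' : config G) weight q beta F'.

Definition eta (R : realType) (delta : R) : R := Num.min (delta / 5) (1 / 100).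

Definition disordered (R : realType) (V : finType) (G : {set {set V}})
    (delta : R) : {set config G} :=
  [set F : config G | #|In_edges F|%:R <= eta delta * #|G|%:R].

Definition gibbs_dis (R : realType) (V : finType) (G : {set {set V}})
    (q beta delta : R) (F : config G) : R :=
  if F \in disordered G delta
  then gibbs q beta F / \sum_(F' in disordered G delta) gibbs q beta F'
  else 0.

Definition p_edge (R : realType) (beta : R) : R := 1 - expR (- beta).

Definition p_hat (R : realType) (q beta : R) : R :=
  p_edge beta / ((1 - p_edge beta) * q + p_edge beta).

(** Probability of setting the chosen edge [e] to 1. *)
Definition p_update (R : realType) (V : finType) (G : {set {set V}})
    (q beta : R) (F : config G) (e : {e : {set V} | e \in G}) : R :=
  if cut_edge (val e |: In_edges F)%SET (val e) then p_hat q beta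
  else p_edge beta.

Definition rc_step (R : realType) (V : finType) (G : {set {set V}})
    (q beta : R) (F F' : config G) : R :=
  #|G|%:R^-1 * \sum_(e : {e : {set V} | e \in G})
    (p_update q beta F e * (F' == set_edge F e true)%:R
     + (1 - p_update q beta F e) * (F' == set_edge F e false)%:R).

(** Law of [X_t] for the chain started at [F0]. *)
Fixpoint rc_law (R : realType) (V : finType) (G : {set {set V}})
    (q beta : R) (F0 : config G) (t : nat) (F : config G) : R :=
  if t is t'.+1
  then \sum_(F' : config G) rc_law q beta F0 t' F' * rc_step q beta F' F
  else (F == F0)%:R.

Definition dist_TV (R : realType) (T : finType) (mu nu : T -> R) : R :=
  2^-1 * \sum_(x : T) `|mu x - nu x|.

Definition beta_c (R : realType) (q : R) (Delta : nat) : R :=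
  ln ((q - 2) / ((q - 1) `^ (1 - 2 / Delta%:R) - 1)).

(* Main.v *)
Require Import Defs.
From mathcomp Require Import all_boot all_order all_algebra.
From mathcomp Require Import all_classical all_reals all_analysis.
From mathcomp Require Import fintype finset.
From mathcomp Require Import ring lra zify.
Set Implicit Arguments.
Unset Strict Implicit.
Unset Printing Implicit Defensive.
Import Order.TTheory GRing.Theory Num.Theory.

(** The proof is deterministic: it applies to every [D]-regular graph whose sets of
    at most [delta * n] vertices have expansion at least [5 / 9], once [q] is large.
    Such a set [S] spans at most [2 D / 9 * #|S|] edges. Write [E] for [expR beta] and
    [w] for [E - 1]; below the threshold [E] is at most [2 q ^ (2 / D)], so a connected
    piece of the configuration with [k] vertices has weight at most [q ^ (1 - 5 k / 9)],
    up to a constant to the power [k]. Counting the possible pieces by means of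
    percolation with parameter [1 / 2] turns this into the Peierls bounds
    [mean_cluster] and [cluster_tail]: components have bounded mean size in the free
    measure on any small ball, and exponential tails in the disordered phase.

    Dynamics. Let [X] start from the empty configuration. By monotonicity [X]
    dominates the dynamics run on the edges inside a ball [B] around a given edge,
    with all other edges kept out. On [B] the empty start is compared with the
    stationary start [Y] through a contagion that contains all disagreements: a set of
    marked vertices spreads over the components of [Y] that it meets, and a vertex is
    healed when it becomes isolated in [Y]. The key point ([contagion_contracts]) is
    that the unmarked part can always be taken to be a fresh sample from the
    stationary measure. Updates away from the marks preserve it; when a component
    joins the marked set, the rest is again stationary by the domain Markov property;
    when vertices are healed, FKG allows the environment to be raised to the
    stationary measure on a larger graph, which only helps the contagion. So the
    contagion grows by a bounded amount in expectation, at rate [ph], per marked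
    vertex. On the other side, the density bound shows that at least one ninth of the
    marked vertices have degree less than [D / 2] in [Y], and a potential which is an
    increasing function of the degrees ([drift_bound]) shows that this wins: a vertex of
    degree [d < D / 2] becomes isolated at a rate of order [q ^ (- 2 (d - 1) / D)], while
    the growth rate [ph] is of the smaller order [q ^ (2 / D - 1)]. Hence the expected
    number of disagreements decays like [exp (- c t / n)].

    Conclusion. By FKG, and because clusters of logarithmic size are improbable, the
    probability of an edge in the disordered phase exceeds its probability under the
    stationary measure on [B] by at most a multiple of [n ^ (- 3)]
    ([weak_spatial_mixing]). A chain started from the disordered phase leaves it in
    polynomial time only with exponentially small probability ([exit_bound],
    [boundary_weight]), as its law stays below the Gibbs measure divided by the mass of
    the phase. Since [X] can be coupled below this chain, the total variation distance
    is bounded by the sum over the edges of the differences of their marginals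
    ([tv_bound]), and these have just been bounded. *)

(** * Connectivity, rank and exploration *)

Section Connectivity.
Variable V : finType.
Implicit Types (F K G A : {set {set V}}) (S Z C D e : {set V}).

Definition conn F : rel V := connect (graph_adj F).

Lemma graph_adjC F : symmetric (graph_adj F).
Proof. by move=> u v; rewrite /graph_adj setUC. Qed.

Lemma connC F : connect_sym (graph_adj F).
Proof. exact/sym_connect_sym/graph_adjC. Qed.

Lemma conn_sym F a b : conn F a b = conn F b a.
Proof. exact: connC. Qed.

Lemma conn_sub F F' a b : F \subset F' -> conn F a b -> conn F' a b.
Proof.
move=> /subsetP sFF'; apply: connect_sub a b => a b ab.
by apply/connect1/sFF'.
Qed.

Lemma conn_closed F D a b :
  (forall x y, x \in D -> [set x; y] \in F -> y \in D) ->
  a \in D -> conn F a b -> b \in D.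
Proof.
move=> clD aD /connectP[p]; elim: p a aD => [|c p IH] a aD /= => [_ -> //|].
by case/andP=> ac; apply: IH; apply: clD ac.
Qed.

Definition reach F Z : {set V} := [set x | [exists z in Z, conn F z x]].

Lemma reachP F Z x : reflect (exists2 z, z \in Z & conn F z x) (x \in reach F Z).
Proof. by rewrite inE; apply: exists_inP. Qed.

Lemma sub_reach F Z : Z \subset reach F Z.
Proof. by apply/subsetP=> z zZ; apply/reachP; exists z => //; apply: connect0. Qed.

Lemma reach_closed F Z x y : x \in reach F Z -> [set x; y] \in F -> y \in reach F Z.
Proof.
move=> /reachP[z zZ zx] xy; apply/reachP; exists z => //.
by apply: connect_trans zx _; apply: connect1.
Qed.

Lemma reach_min F Z D : Z \subset D ->
  (forall x y, x \in D -> [set x; y] \in F -> y \in D) -> reach F Z \subset D.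
Proof.
move=> /subsetP ZD clD; apply/subsetP=> x /reachP[z zZ]; apply: conn_closed => //.
exact: ZD.
Qed.

Lemma reach_mono F F' Z Z' : F \subset F' -> Z \subset Z' -> reach F Z \subset reach F' Z'.
Proof.
move=> sF /subsetP sZ; apply/subsetP=> x /reachP[z zZ zx]; apply/reachP; exists z.
  exact: sZ.
exact: conn_sub zx.
Qed.

Lemma simpleP F e : simple_graph F -> e \in F -> #|e| = 2.
Proof. by move=> /forall_inP sF /sF /eqP. Qed.

Lemma simple_sub F F' : F \subset F' -> simple_graph F' -> simple_graph F.
Proof.
by move=> /subsetP sF /forall_inP s; apply/forall_inP=> e /sF /s.
Qed.

Lemma edge_closed F D e : simple_graph F ->
  (forall x y, x \in D -> [set x; y] \in F -> y \in D) ->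
  e \in F -> ~~ [disjoint e & D] -> e \subset D.
Proof.
move=> sF clD eF /pred0Pn[x /andP[/= xe xD]].
have /eqP/cards2P[a [b [ab Ee]]] := simpleP sF eF.
move: xe; rewrite Ee in eF *; rewrite !inE => /orP[]/eqP E; subst x.
- by rewrite subUset !sub1set xD (clD _ _ xD eF).
- by rewrite setUC in eF; rewrite subUset !sub1set xD (clD _ _ xD eF).
Qed.

Definition joined F e : bool := [forall a in e, forall b in e, conn F a b].

Lemma joined2 F a b : joined F [set a; b] = conn F a b.
Proof.
apply/forall_inP/idP => [j|ab x].
  by have /forall_inP/(_ b) := j a (set21 _ _); rewrite set22 => ->.
have ba : conn F b a by rewrite conn_sym.
rewrite !inE => /orP[]/eqP->; apply/forall_inP=> y; rewrite !inE => /orP[]/eqP-> //;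
  exact: connect0.
Qed.

Lemma joinedS F F' e : F \subset F' -> joined F e -> joined F' e.
Proof.
move=> sF /forall_inP j; apply/forall_inP=> a ae; apply/forall_inP=> b be.
by move/forall_inP/(_ b be): (j a ae); apply: conn_sub.
Qed.

Lemma conn_setU1 F e : joined F e -> conn (e |: F) =2 conn F.
Proof.
move=> j a b; apply/idP/idP; last by apply: conn_sub; apply: subsetUr.
apply: connect_sub a b => a b; rewrite /graph_adj !inE => /orP[/eqP Ee|ab].
  by rewrite -Ee joined2 in j.
exact: connect1.
Qed.

Lemma components_joined F e : joined F e -> components (e |: F) = components F.
Proof. by move=> /conn_setU1 /eq_n_comp E; apply: E. Qed.

(** Counting roots only sees the connectivity relation, so adding an edge changes the
    number of components only among the vertices that it connects. *)
Lemma n_comp_root (r r' : rel V) (P : {pred V}) :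
  (forall x, x \in P -> connect r x =1 connect r' x) ->
  n_comp r P = n_comp r' P.
Proof.
move=> E; apply: eq_card => x; rewrite !inE.
case xP: (x \in P); rewrite ?andbF // !andbT.
by rewrite /fingraph.roots /fingraph.root (eq_pick (E _ xP)).
Qed.

(** A path that uses the new edge [{a, b}] must first reach one of its ends. *)
Lemma conn_new F a b x y : conn ([set a; b] |: F) x y ->
  ~~ conn F x a -> ~~ conn F x b -> conn F x y.
Proof.
move=> xy xa xb.
pose D := [set y | conn F x y].
suff: y \in D by rewrite inE.
apply: conn_closed xy; last by rewrite inE; apply: connect0.
move=> u v; rewrite !inE => xu /orP[/eqP E|uv]; last first.
  by apply: connect_trans xu _; apply: connect1.
have : u \in [set a; b] by rewrite -E set21.
by rewrite !inE => /orP[]/eqP U; subst u; rewrite xu in xa xb.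
Qed.

Lemma components_cut F a b : a != b -> ~~ conn F a b ->
  components F = (components ([set a; b] |: F)).+1.
Proof.
move=> ab nab; set F' := _ |: F.
have sF : F \subset F' by apply: subsetUr.
have abF' : conn F' a b by apply: connect1; rewrite /graph_adj !inE eqxx.
pose P : {pred V} := connect (graph_adj F') a.
pose P1 : {pred V} := connect (graph_adj F) a.
pose P2 : {pred V} := connect (graph_adj F) b.
rewrite /components (n_compC P) [in RHS](n_compC P).
have -> : n_comp (graph_adj F') P = 1%N by apply: n_comp_connect; apply: connC.
have -> : n_comp (graph_adj F') [predC P] = n_comp (graph_adj F) [predC P].
  apply: n_comp_root => x xP y; apply/idP/idP; last exact: conn_sub.
  have nax : ~~ conn F' a x by rewrite inE in xP.
  move=> xy; apply: conn_new xy _ _; apply: contra nax => h; rewrite conn_sym.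
    exact: conn_sub h.
  by apply: connect_trans (conn_sub sF h) _; rewrite -/(conn F' b a) conn_sym.
suff -> : n_comp (graph_adj F) P = 2%N by [].
have PE x : (x \in P) = (x \in P1) || (x \in P2).
  rewrite !inE; apply/idP/idP => [ax|/orP[]h]; last 2 first.
  - exact: conn_sub h.
  - by apply: connect_trans abF' _; apply: conn_sub h.
  apply: contraT; rewrite negb_or => /andP[na nb].
  have {}na : ~~ conn F x a by rewrite conn_sym.
  have {}nb : ~~ conn F x b by rewrite conn_sym.
  have xa : conn F' x a by rewrite conn_sym.
  by case/negP: (na); apply: conn_new xa na nb.
have d x : x \in P1 -> x \in P2 -> False.
  rewrite !inE => ax bx; case/negP: nab; apply: connect_trans ax _.
  by rewrite -/(conn F x b) conn_sym.
have n1 : n_comp (graph_adj F) P1 = 1%N by apply: n_comp_connect; apply: connC.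
have n2 : n_comp (graph_adj F) P2 = 1%N by apply: n_comp_connect; apply: connC.
rewrite /n_comp_mem -[RHS]/(1 + 1)%N -{1}n1 -n2 /n_comp_mem -cardUI.
rewrite [X in _ = (_ + X)%N]eq_card0 ?addn0 => [|x]; last first.
  rewrite !inE; apply/negP=> /andP[/andP[_ h1] /andP[_ h2]]; exact: (d x).
by apply: eq_card => x; have := PE x; rewrite !inE => ->; rewrite andb_orr.
Qed.

Lemma components_le F : (components F <= #|V|)%N.
Proof. exact: max_card. Qed.

(** The number of edges of a spanning forest of [F]. It is used instead of the number of
    components because it is additive over vertex-disjoint parts. *)
Definition rk F : nat := (#|V| - components F)%N.

Lemma rk_setU1 F e : #|e| = 2 -> rk (e |: F) = (rk F + ~~ joined F e)%N.
Proof.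
move=> /eqP/cards2P[a [b [ab ->]]]; rewrite /rk.
case: (boolP (joined _ _)) => j; first by rewrite components_joined ?addn0.
rewrite joined2 in j; rewrite (components_cut ab j).
have := components_le F; rewrite (components_cut ab j) addn1 => h.
by rewrite subnSK.
Qed.

Lemma components_set0 : components (set0 : {set {set V}}) = #|V|.
Proof.
rewrite /components; apply: eq_card => x; rewrite !inE andbT.
rewrite /fingraph.roots /fingraph.root; case: pickP => [y|_] /=; last by rewrite eqxx.
move=> xy; suff : y \in [set x] by rewrite inE.
apply: conn_closed xy; rewrite ?set11 // => u v _; by rewrite in_set0.
Qed.

Lemma rk0 : rk set0 = 0%N.
Proof. by rewrite /rk components_set0 subnn. Qed.

Lemma rk_ge F v : (#|reach F [set v]| <= (rk F).+1)%N.
Proof.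
have -> : #|reach F [set v]| = #|[pred x | conn F v x]|.
  apply: eq_card => x; rewrite !inE.
  by apply/exists_inP/idP => [[z /set1P-> //]|h]; exists v; rewrite ?set11.
rewrite /rk /components (n_compC [pred x | conn F v x]).
have -> : n_comp (graph_adj F) [pred x | conn F v x] = 1%N.
  by apply: n_comp_connect; apply: connC.
have h : (n_comp (graph_adj F) [predC [pred x | conn F v x]] <=
          #|[predC [pred x | conn F v x]]|)%N.
  by apply: subset_leq_card; apply/subsetP=> x; rewrite !inE => /andP[].
move: h (cardC [pred x | conn F v x]).
set c := #|[pred x | conn F v x]|; set d := #|[predC _]|; set k := n_comp _ _.
by move=> kd <-; clear -kd; lia.
Qed.

Lemma conn_disjoint K F D a b : a \in D ->
  (forall e, e \in F -> e \subset D) -> (forall e, e \in K -> [disjoint e & D]) ->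
  conn (K :|: F) a b = conn F a b.
Proof.
move=> aD FD KD; apply/idP/idP => [ab|]; last by apply: conn_sub; apply: subsetUr.
suff : b \in D :&: [set y | conn F a y] by rewrite !inE => /andP[].
apply: conn_closed ab => [x y|]; last by rewrite !inE aD; apply: connect0.
rewrite !inE => /andP[xD ax] /orP[/KD|xy].
  by move=> /disjointFr/(_ (set21 x y)); rewrite xD.
apply/andP; split; last by apply: connect_trans ax _; apply: connect1.
by move/subsetP/(_ y (set22 _ _)): (FD _ xy).
Qed.

Lemma joined_disjoint K F D e : e \subset D ->
  (forall e, e \in F -> e \subset D) -> (forall e, e \in K -> [disjoint e & D]) ->
  joined (K :|: F) e = joined F e.
Proof.
move=> /subsetP eD FD KD; apply: eq_forallb_in => a ae.
apply: eq_forallb_in => b be; apply: conn_disjoint FD KD; exact: eD.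
Qed.

Lemma rk_disjoint K F D : simple_graph F ->
  (forall e, e \in F -> e \subset D) -> (forall e, e \in K -> [disjoint e & D]) ->
  rk (K :|: F) = (rk K + rk F)%N.
Proof.
move=> sF FD KD; move: {2}#|F| (erefl #|F|) => n.
elim: n F sF FD => [|n IH] F sF FD cF.
  by move/cards0_eq: cF => ->; rewrite setU0 rk0 addn0.
have [e eF] : exists e, e \in F by apply/set0Pn; rewrite -card_gt0 cF.
have sF' : F :\ e \subset F by apply: subsetDl.
have FD' f : f \in F :\ e -> f \subset D by move=> /(subsetP sF'); apply: FD.
rewrite -(setD1K eF) setUCA !rk_setU1 ?(simpleP sF eF) //.
rewrite (IH (F :\ e)) ?(simple_sub sF') //; last first.
  by have := cardsD1 e F; rewrite eF cF => -[].
by rewrite (joined_disjoint (FD _ eF) FD' KD) addnA.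
Qed.

Definition avoid A S : {set {set V}} := [set e in A | [disjoint e & S]].

Lemma avoid_sub A S : avoid A S \subset A.
Proof. by apply/subsetP=> e; rewrite inE => /andP[]. Qed.

Lemma avoid_mono A A' S S' : A \subset A' -> S' \subset S ->
  avoid A S \subset avoid A' S'.
Proof.
move=> /subsetP sA sS; apply/subsetP=> e; rewrite !inE => /andP[/sA-> d].
by rewrite /=; apply: disjointWr d.
Qed.

Lemma avoid_avoid A S S' : avoid (avoid A S) S' = avoid A (S :|: S').
Proof.
apply/setP=> e; rewrite !inE -andbA; congr (_ && _).
by rewrite -!setI_eq0 setIUr setU_eq0.
Qed.

Definition touch F S : {set {set V}} := F :\: avoid F S.

Lemma touchE F S e : (e \in touch F S) = (e \in F) && ~~ [disjoint e & S].
Proof. by rewrite in_setD inE; case: (e \in F); rewrite /= ?andbT ?andbF. Qed.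

Lemma touchU F S : touch F S :|: avoid F S = F.
Proof. by rewrite setUC; apply/setP=> e; rewrite in_setU touchE inE; case: (e \in F); case: (disjoint _ _). Qed.

Lemma touch_reach_sub F Z e : simple_graph F -> e \in touch F (reach F Z) -> e \subset reach F Z.
Proof.
move=> sF; rewrite touchE => /andP[eF]; apply: edge_closed eF => // x y.
exact: reach_closed.
Qed.

(** The configurations in which exploration from [Z] finds exactly what it finds in [F0]
    are those that agree with [F0] on the edges touching [C] and are arbitrary on the
    edges avoiding [C]. *)
Lemma reach_explored F0 G Z F : simple_graph G -> F0 \subset G ->
  let C := reach F0 Z in F \subset avoid G C ->
  let F1 := touch F0 C :|: F in
  [/\ reach F1 Z = C, touch F1 C = touch F0 C & avoid F1 C = F].
Proof.
move=> sG sF0 C sF F1.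
have s0 : simple_graph F0 by apply: simple_sub sG.
have FC e : e \in F -> [disjoint e & C] by move/(subsetP sF); rewrite inE => /andP[].
have aF : avoid F1 C = F.
  apply/setP=> e; rewrite inE in_setU touchE.
  case eF: (e \in F); first by rewrite orbT (FC _ eF).
  by rewrite orbF -andbA andNb andbF.
split=> //; last first.
  rewrite /touch aF; apply/setP=> e; rewrite in_setD in_setU -/(touch F0 C) touchE.
  case eF: (e \in F) => /=; first by rewrite (FC _ eF) andbF.
  by rewrite orbF.
apply/eqP; rewrite eqEsubset; apply/andP; split.
  apply: reach_min; first exact: sub_reach.
  move=> x y xC; rewrite in_setU touchE => /orP[/andP[xy _]|/FC].
    exact: reach_closed xy.
  by move=> /disjointFr/(_ (set21 x y)); rewrite xC.
have : reach F0 Z \subset C :&: reach F1 Z; last by rewrite subsetI => /andP[].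
apply: reach_min; first by rewrite subsetI !sub_reach.
move=> x y; rewrite !in_setI => /andP[xC x1] xy.
rewrite (reach_closed xC xy) /=; apply: reach_closed x1 _.
rewrite in_setU touchE xy /=; apply/orP; left.
by apply/pred0Pn; exists x; rewrite /= set21.
Qed.

End Connectivity.
Local Open Scope ring_scope.

(** * The FKG inequality *)

Section FKG.
Variables (R : realFieldType) (T : finType).
Implicit Types (E F : {set T}) (W f g : {set T} -> R).

Lemma big_subsetU1 E (x : T) (h : {set T} -> R) : x \notin E ->
  \sum_(F : {set T} | F \subset x |: E) h F =
  \sum_(F : {set T} | F \subset E) (h F + h (x |: F)).
Proof.
move=> xE; rewrite (bigID (fun F : {set T} => x \in F)) /= addrC big_split /=.
congr (_ + _).
  apply: eq_bigl => F; apply/andP/idP => [[sF xF]|sF]; last first.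
    split; first by apply: subset_trans sF (subsetUr _ _).
    by apply: contra xE; apply: subsetP.
  apply/subsetP=> y yF; move/subsetP/(_ y yF): sF; rewrite !inE => /orP[/eqP E1|//].
  by rewrite E1 in yF; rewrite yF in xF.
rewrite (reindex_onto (fun F : {set T} => x |: F) (fun F => F :\ x)) /=; last first.
  by move=> F /andP[_ xF]; rewrite setD1K.
apply: eq_bigl => F; rewrite setU11 andbT; apply/andP/idP => [[sF /eqP EF]|sF].
  apply/subsetP=> y yF; move/subsetP/(_ y): sF; rewrite !inE yF orbT => /(_ isT).
  case/orP=> // /eqP Ey; subst y; by rewrite -EF !inE eqxx in yF.
split; first by apply: setUS.
apply/eqP/setU1K; apply: contra xE; exact: subsetP.
Qed.

Definition increasing E f := forall F F' : {set T}, F \subset F' -> F' \subset E -> f F <= f F'.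

(** The inductive step of FKG after conditioning on one element: [A] and [B]
    are the masses of the two halves, and [a], [b], [c] the integrals of [f], [g], [f * g]. *)
Lemma fkg_arith (A B a0 a1 b0 b1 c0 c1 : R) : 0 < A -> 0 < B ->
  a0 * b0 <= A * c0 -> a1 * b1 <= B * c1 ->
  a0 * B <= A * a1 -> b0 * B <= A * b1 ->
  (a0 + a1) * (b0 + b1) <= (A + B) * (c0 + c1).
Proof.
move=> A0 B0 h0 h1 ha hb.
have hab : 0 <= (A * a1 - a0 * B) * (A * b1 - b0 * B).
  by apply: mulr_ge0; rewrite subr_ge0.
have AB : 0 < A * B by apply: mulr_gt0.
rewrite -subr_ge0 -(pmulr_rge0 _ AB).
have k0 : 0 <= B * (A + B) * (A * c0 - a0 * b0).
  by rewrite mulr_ge0 ?subr_ge0 // mulr_ge0 ?addr_ge0 ?ltW.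
have k1 : 0 <= A * (A + B) * (B * c1 - a1 * b1).
  by rewrite mulr_ge0 ?subr_ge0 // mulr_ge0 ?addr_ge0 ?ltW.
have -> : A * B * ((A + B) * (c0 + c1) - (a0 + a1) * (b0 + b1)) =
  B * (A + B) * (A * c0 - a0 * b0) + A * (A + B) * (B * c1 - a1 * b1) +
  (A * a1 - a0 * B) * (A * b1 - b0 * B) by ring.
by rewrite !addr_ge0.
Qed.

(** Induction on [E], splitting on an element [x]. Conditionally on [x] the inequality holds
    by induction; the conditional means of [f] are ordered because, by the second
    hypothesis, the ratio of the two conditional weights is itself increasing, and the
    induction hypothesis applies to it. *)
Lemma fkg E W f g :
  (forall F, F \subset E -> 0 < W F) ->
  (forall F F' x, F \subset F' -> F' \subset E -> x \in E -> x \notin F' ->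
     W (x |: F) * W F' <= W (x |: F') * W F) ->
  increasing E f -> increasing E g ->
  (\sum_(F : {set T} | F \subset E) W F * f F) *
    (\sum_(F : {set T} | F \subset E) W F * g F) <=
  (\sum_(F : {set T} | F \subset E) W F) *
    (\sum_(F : {set T} | F \subset E) W F * (f F * g F)).
Proof.
move: {2}#|E| (erefl #|E|) => n.
elim: n E W f g => [|n IH] E W f g cE W0 Wr fi gi.
  move/cards0_eq: cE => E0; subst E.
  have s1 (h : {set T} -> R) : \sum_(F : {set T} | F \subset set0) h F = h set0.
    by rewrite (eq_bigl (fun F => F == set0)) ?big_pred1_eq // => F; rewrite subset0.
  by rewrite !s1 le_eqVlt -subr_eq0; apply/orP; left; apply/eqP; ring.
have [x xE] : exists x, x \in E by apply/set0Pn; rewrite -card_gt0 cE.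
pose E' := E :\ x; have xE' : x \notin E' by rewrite setD11.
have cE' : #|E'| = n by have := cardsD1 x E; rewrite xE cE => -[].
have EE : x |: E' = E by rewrite setD1K.
have sE' : E' \subset E by apply: subD1set.
rewrite -EE !big_subsetU1 // !big_split /=.
have xs F : F \subset E' -> x |: F \subset E by move=> sF; rewrite -EE setUS.
have s F : F \subset E' -> F \subset E by move=> /subset_trans; apply.
have xn F : F \subset E' -> x \notin F by move=> sF; apply: contra xE'; apply: subsetP.
pose A := \sum_(F : {set T} | F \subset E') W F.
pose B := \sum_(F : {set T} | F \subset E') W (x |: F).
have posS (U : {set T} -> R) : (forall F, F \subset E' -> 0 < U F) ->
    0 < \sum_(F : {set T} | F \subset E') U F.
  move=> U0; rewrite (bigD1 set0) ?sub0set //=; apply: ltr_wpDr; last exact/U0/sub0set.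
  by apply: sumr_ge0 => F /andP[/U0/ltW].
have W1 F : F \subset E' -> 0 < W (x |: F) by move/xs/W0.
have W0' F : F \subset E' -> 0 < W F by move/s/W0.
have W0r F F' y : F \subset F' -> F' \subset E' -> y \in E' -> y \notin F' ->
    W (y |: F) * W F' <= W (y |: F') * W F.
  by move=> sF sF' yE; apply: Wr => //; [exact: s | apply: (subsetP sE')].
have W1r F F' y : F \subset F' -> F' \subset E' -> y \in E' -> y \notin F' ->
    W (x |: (y |: F)) * W (x |: F') <= W (x |: (y |: F')) * W (x |: F).
  move=> sF sF' yE yF; rewrite !(setUCA [set x]); apply: Wr => //.
  - exact: setUS.
  - exact: xs.
  - exact: (subsetP sE').
  - rewrite !inE negb_or yF andbT; apply: contraNneq xE' => <-; exact: yE.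
have i0 (h : {set T} -> R) : increasing E h -> increasing E' h.
  by move=> hi F F' sF sF'; apply: hi => //; apply: s.
have i1 (h : {set T} -> R) : increasing E h -> increasing E' (fun F => h (x |: F)).
  by move=> hi F F' sF sF'; apply: hi; [apply: setUS | apply: xs].
have H0 := IH E' W f g cE' W0' W0r (i0 _ fi) (i0 _ gi).
have H1 := IH E' _ _ _ cE' W1 W1r (i1 _ fi) (i1 _ gi).
have Hm (h : {set T} -> R) : increasing E h ->
    (\sum_(F : {set T} | F \subset E') W F * h F) * B <=
    A * (\sum_(F : {set T} | F \subset E') W (x |: F) * h (x |: F)).
  move=> hi.
  have ri : increasing E' (fun F => W (x |: F) / W F).
    move=> F F' sF sF'.
    rewrite ler_pdivrMr ?W0' ?(subset_trans sF) // mulrAC ler_pdivlMr ?W0' //.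
    by apply: Wr => //; [exact: s | exact: xn].
  have := IH E' W h _ cE' W0' W0r (i0 _ hi) ri.
  have -> : \sum_(F : {set T} | F \subset E') W F * (W (x |: F) / W F) = B.
    by apply: eq_bigr => F sF; rewrite mulrC divfK // gt_eqF ?W0'.
  move=> /le_trans; apply; apply: ler_wpM2l; first exact/ltW/posS.
  apply: ler_sum => F sF.
  rewrite mulrCA [W F * _]mulrC divfK ?gt_eqF ?W0' // mulrC.
  by apply: ler_wpM2l; [exact/ltW/W1 | apply: hi; [exact: subsetUr | exact: xs]].
by apply: fkg_arith => //; [exact: posS | exact: posS | exact: Hm | exact: Hm].
Qed.

End FKG.

(** * Random cluster weights *)

Section Weight.
Variables (R : realFieldType) (V : finType) (w q : R).
Hypotheses (w0 : 0 < w) (q1 : 1 <= q).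
Implicit Types (F K G A : {set {set V}}) (S Z C D e : {set V}).

Let q0 : 0 < q. Proof. exact: lt_le_trans ltr01 q1. Qed.

(** The random cluster weight divided by [q ^ #|V|], so that the empty configuration has
    weight [1]. It is locked because unification would otherwise see it as a product. *)
Definition W F : R := locked (w ^+ #|F| / q ^+ rk F).

Lemma WE F : W F = w ^+ #|F| / q ^+ rk F.
Proof. by rewrite /W -lock. Qed.

Lemma W_gt0 F : 0 < W F.
Proof. by rewrite WE divr_gt0 ?exprn_gt0. Qed.

Lemma W_ge0 F : 0 <= W F.
Proof. exact/ltW/W_gt0. Qed.

Lemma W_set0 : W set0 = 1.
Proof. by rewrite WE cards0 rk0 divr1. Qed.

Lemma W_setU1 F e : #|e| = 2 -> e \notin F ->
  W (e |: F) = W F * (if joined F e then w else w / q).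
Proof.
move=> ce eF; rewrite !WE cardsU1 eF rk_setU1 //=.
case: (joined _ _); rewrite /= ?addn0 ?addn1 !exprS.
  by rewrite -mulrA mulrC.
by rewrite invfM mulrACA mulrC.
Qed.

(** An added edge costs [w] or [w / q] according to whether its ends are already joined,
    and joining is an increasing event. *)
Lemma W_log_supermodular G F F' e : simple_graph G -> F \subset F' -> F' \subset G ->
  e \in G -> e \notin F' -> W (e |: F) * W F' <= W (e |: F') * W F.
Proof.
move=> sG sF sF' eG eF'.
have eF : e \notin F by apply: contra eF'; apply: subsetP.
have ce := simpleP sG eG.
rewrite !W_setU1 // mulrAC [X in _ <= X]mulrAC [W F' * W F]mulrC.
apply: ler_wpM2l; first by rewrite mulr_ge0 // ltW ?W_gt0.
have wq : w / q <= w by rewrite ler_pdivrMr // ler_peMr // ltW.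
case: (boolP (joined F e)) => [/(joinedS sF)->//|_].
by case: ifP.
Qed.

Lemma W_disjoint K F C : simple_graph F -> (forall e, e \in F -> [disjoint e & C]) ->
  (forall e, e \in K -> e \subset C) -> W (K :|: F) = W K * W F.
Proof.
move=> sF FC KC; rewrite !WE (@rk_disjoint _ K F (~: C)) //; last first.
- by move=> e /KC; rewrite disjoints_subset setCK.
- by move=> e /FC; rewrite disjoints_subset.
have -> : #|K :|: F| = (#|K| + #|F|)%N.
  apply/eqP; rewrite (leq_card_setU K F).2.
  apply/pred0P=> e /=; apply/negP=> /andP[eK eF].
  have [x xe] : exists x, x \in e by apply/set0Pn; rewrite -card_gt0 (simpleP sF eF).
  by move/disjointFr/(_ xe): (FC e eF); rewrite (subsetP (KC _ eK)).
by rewrite !exprD invfM mulrACA.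
Qed.

Lemma W_explored G F0 Z F : simple_graph G -> F0 \subset G ->
  F \subset avoid G (reach F0 Z) ->
  W (touch F0 (reach F0 Z) :|: F) = W (touch F0 (reach F0 Z)) * W F.
Proof.
move=> sG sF0 sF; apply: (@W_disjoint _ _ (reach F0 Z)).
- by apply: simple_sub sG; apply: subset_trans sF (avoid_sub _ _).
- by move=> e /(subsetP sF); rewrite inE => /andP[].
- by move=> e; apply: touch_reach_sub; apply: simple_sub sG.
Qed.

(** The measure on fewer edges is the measure on [A] conditioned on a decreasing event,
    hence it is dominated by it. *)
Lemma fkg_shrink A A' f : simple_graph A -> A' \subset A -> increasing A f ->
  (\sum_(F : {set {set V}} | F \subset A') W F * f F) *
    (\sum_(F : {set {set V}} | F \subset A) W F) <=
  (\sum_(F : {set {set V}} | F \subset A') W F) *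
    (\sum_(F : {set {set V}} | F \subset A) W F * f F).
Proof.
move=> sA sA' fi.
have gi : increasing A (fun F => - (F \subset A')%:R : R).
  move=> F F' sF _; rewrite lerN2 ler_nat; case: (boolP (F' \subset A')) => // /(subset_trans sF)->.
  by [].
have := @fkg R _ A W f _ (fun F _ => W_gt0 F) _ fi gi.
have sub (h : {set {set V}} -> R) : \sum_(F : {set {set V}} | F \subset A) h F * - (F \subset A')%:R
    = - \sum_(F : {set {set V}} | F \subset A') h F.
  rewrite -sumrN (bigID (fun F : {set {set V}} => F \subset A')) /= [X in _ + X]big1 ?addr0.
    apply: eq_big => F; first by apply: andb_idl => /subset_trans; apply.
    by case/andP=> _ ->; rewrite mulrN1.
  by move=> F /andP[_ /negbTE->]; rewrite oppr0 mulr0.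
have sub2 : \sum_(F : {set {set V}} | F \subset A) W F * (f F * - (F \subset A')%:R)
    = - \sum_(F : {set {set V}} | F \subset A') W F * f F.
  by rewrite -sub; apply: eq_bigr => F _; rewrite mulrA.
rewrite sub sub2 => H.
have {}H := H (fun F F' e sF sF' eA eF' => W_log_supermodular sA sF sF' eA eF').
by rewrite mulrN mulrN lerN2 mulrC [X in _ <= X]mulrC in H.
Qed.

End Weight.

Section Explore.
Variables (R : realFieldType) (V : finType).
Implicit Types (F K G A : {set {set V}}) (S Z C D e : {set V}) (a : {set {set V}} -> R).

(** Domain Markov property: to compare two sums over configurations it is enough
    to compare them given the components that meet [Z]. *)
Lemma explore_le G Z a a' : simple_graph G ->
  (forall F0, F0 \subset G -> let C := reach F0 Z in let K := touch F0 C in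
    \sum_(F : {set {set V}} | F \subset avoid G C) a (K :|: F) <=
    \sum_(F : {set {set V}} | F \subset avoid G C) a' (K :|: F)) ->
  \sum_(F : {set {set V}} | F \subset G) a F <= \sum_(F : {set {set V}} | F \subset G) a' F.
Proof.
move=> sG H.
pose key F := (reach F Z, touch F (reach F Z)).
rewrite !(partition_big key predT) //=; apply: ler_sum => p _.
case: (pickP (fun F : {set {set V}} => (F \subset G) && (key F == p))) => [F0 /andP[sF0 /eqP <-]|h];
  last by rewrite !big_pred0.
have fib (b : {set {set V}} -> R) :
    \sum_(F : {set {set V}} | (F \subset G) && (key F == key F0)) b F =
    \sum_(F : {set {set V}} | F \subset avoid G (reach F0 Z)) b (touch F0 (reach F0 Z) :|: F).
  rewrite (reindex_onto (fun F => touch F0 (reach F0 Z) :|: F) (fun F => avoid F (reach F0 Z))) /=.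
    apply: eq_bigl => F; apply/idP/idP => [/andP[/andP[sF _] /eqP <-]|sF].
      by apply: avoid_mono sF _.
    have [E1 E2 E3] := reach_explored sG sF0 sF.
    rewrite E3 /key E1 E2 !eqxx !andbT subUset (subset_trans (subsetDl _ _) sF0) /=.
    exact: subset_trans sF (avoid_sub _ _).
  move=> F /andP[sF /eqP[E1 E2]]; rewrite -E2 -E1; exact: touchU.
rewrite !fib; exact: H.
Qed.

End Explore.

(** * Peierls bounds *)

Section Sparse.
Variables (V : finType) (D : nat).
Implicit Types (F K G A : {set {set V}}) (S Z C e : {set V}).

Lemma reach_touch F Z : simple_graph F -> reach (touch F (reach F Z)) Z = reach F Z.
Proof.
move=> sF; have := @reach_explored V F F Z set0 sF (subxx _) (sub0set _).
by rewrite setU0 => -[].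
Qed.

Lemma rk_touch_avoid F Z : simple_graph F ->
  rk F = (rk (touch F (reach F Z)) + rk (avoid F (reach F Z)))%N.
Proof.
move=> sF; rewrite -{1}(touchU F (reach F Z)).
apply: (@rk_disjoint _ _ _ (~: reach F Z)).
- by apply: simple_sub sF; apply: avoid_sub.
- by move=> e; rewrite inE disjoints_subset => /andP[].
- by move=> e /(touch_reach_sub sF); rewrite disjoints_subset setCK.
Qed.

Lemma card_touch F S : #|F| = (#|touch F S| + #|avoid F S|)%N.
Proof.
rewrite -(cardsID (avoid F S) F) addnC; congr (_ + _)%N.
by rewrite (setIidPr _) // avoid_sub.
Qed.

Lemma card_touch_le G C : (forall v, degree G v <= D)%N ->
  (#|touch G C| <= D * #|C|)%N.
Proof.
move=> dG; rewrite mulnC -sum_nat_const.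
apply: (@leq_trans (\sum_(v in C) degree G v)); last exact: leq_sum.
have -> : touch G C = \bigcup_(v in C) [set e in G | v \in e].
  apply/setP=> e; rewrite touchE; apply/idP/bigcupP.
    by case/andP=> eG /pred0Pn[v /andP[/= ve vC]]; exists v; rewrite // inE eG.
  case=> v vC; rewrite inE => /andP[-> ve].
  by apply/pred0Pn; exists v; rewrite /= ve.
elim/big_rec2: _ => [|v s T _ IH]; first by rewrite cards0.
by apply: leq_trans (leq_card_setU _ _) _; rewrite leq_add2l.
Qed.

(** What expansion [5 / 9] says of the components of [F]: their boundary takes at least
    [5 / 9] of the degrees, hence [4 / 9] at most is left for the edges inside. *)
Definition sparse F := forall v,
  (9 * #|touch F (reach F [set v])| <= 2 * D * #|reach F [set v]|)%N.

(** A component with at least two vertices has [k <= 2 (k - 1)]; this converts the density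
    into a bound by the rank. *)
Lemma sparse_comp F v : simple_graph F -> sparse F ->
  (9 * #|touch F (reach F [set v])| <= 4 * D * #|reach F [set v]|.-1)%N.
Proof.
move=> sF /(_ v); set C := reach F [set v]; set K := touch F C => h.
have vC : v \in C by apply: (subsetP (sub_reach F [set v])); rewrite set11.
have [C1|C2] := leqP #|C| 1.
  suff -> : K = set0 by rewrite cards0 muln0.
  apply/eqP; rewrite -subset0; apply/subsetP=> e eK.
  have := subset_leq_card (touch_reach_sub sF eK).
  have eF : e \in F by move: eK; rewrite touchE => /andP[].
  by rewrite (simpleP sF eF) => /leq_trans/(_ C1).
apply: leq_trans h _.
have : (#|C| <= 2 * #|C|.-1)%N by case: #|C| C2 => [|[|k]] //= _; lia.
nia.
Qed.

Lemma sparse_rk F : simple_graph F ->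
  (forall F', F' \subset F -> sparse F') -> (9 * #|F| <= 4 * D * rk F)%N.
Proof.
have [n] := ubnP #|F|; elim: n F => [|n IH] F // cF sF spF.
have [->|/set0Pn[e eF]] := eqVneq F set0; first by rewrite cards0 muln0.
have [v ve] : exists v, v \in e by apply/set0Pn; rewrite -card_gt0 (simpleP sF eF).
have vC : v \in reach F [set v] by apply: (subsetP (sub_reach F [set v])); rewrite set11.
have tF : (0 < #|touch F (reach F [set v])|)%N.
  rewrite card_gt0; apply/set0Pn; exists e; rewrite touchE eF /=.
  by apply/pred0Pn; exists v; rewrite /= ve.
have h := sparse_comp v sF (spF F (subxx F)).
have rkK := rk_ge (touch F (reach F [set v])) v; rewrite reach_touch // in rkK.
rewrite (rk_touch_avoid [set v] sF).
have cT := card_touch F (reach F [set v]).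
have aF := avoid_sub F (reach F [set v]).
have := IH (avoid F (reach F [set v])); rewrite (simple_sub aF sF).
have c1 : (#|avoid F (reach F [set v])| < n)%N by lia.
move=> /(_ c1 isT (fun F' s => spF F' (subset_trans s aF))) IH'.
rewrite cT mulnDr mulnDr; apply: leq_add => //; apply: leq_trans h _.
by rewrite leq_mul2l; apply/orP; right; lia.
Qed.
End Sparse.

Section Peierls.
Variables (R : realFieldType) (V : finType) (w q : R) (D : nat).
Hypotheses (w0 : 0 < w) (q1 : 1 <= q).
Implicit Types (F K G A : {set {set V}}) (S Z C e : {set V}).
Notation W := (@W R V w q).
Let q0 : 0 < q. Proof. exact: lt_le_trans ltr01 q1. Qed.

Variables (E lam : R).
Hypotheses (E1 : 1 <= E) (wE : w <= E) (lam0 : 0 < lam).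
Hypothesis lamE : E ^+ (4 * D) <= lam ^+ 9 * q ^+ 9.

Let Wge0 F : 0 <= W F. Proof. exact: W_ge0. Qed.

(** With [E] of order [q ^ (2 / D)], each unit of rank costs [q] and pays for at most
    [4 D / 9] edges, which leaves a factor of order [q ^ (- 1 / 9)]; ninth powers avoid the
    fractional exponent. *)
Lemma W_le F : (9 * #|F| <= 4 * D * rk F)%N -> W F <= lam ^+ rk F.
Proof.
move=> h; have E0 : 0 < E by exact: lt_le_trans ltr01 E1.
have WF0 : 0 <= W F by rewrite ltW ?W_gt0.
have lr0 : 0 <= lam ^+ rk F by rewrite exprn_ge0 ?ltW.
rewrite -(@ler_pXn2r _ 9) ?nnegrE //.
rewrite WE expr_div_n ler_pdivrMr ?exprn_gt0 //.
have -> : (lam ^+ rk F) ^+ 9 * (q ^+ rk F) ^+ 9 = (lam ^+ 9 * q ^+ 9) ^+ rk F.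
  by rewrite exprMn -!exprM ![(9 * _)%N]mulnC.
rewrite -exprM.
apply: le_trans (_ : E ^+ (4 * D * rk F) <= _).
  apply: le_trans (_ : E ^+ (#|F| * 9) <= _).
    by apply: lerXn2r => //; rewrite nnegrE ltW.
  by apply: ler_weXn2l => //; rewrite mulnC.
by rewrite exprM; apply: lerXn2r => //; rewrite nnegrE ?mulr_ge0 ?exprn_ge0 // ltW.
Qed.

Lemma W_comp_le F v : lam <= 1 -> simple_graph F -> sparse D F ->
  W (touch F (reach F [set v])) <= lam ^+ #|reach F [set v]|.-1.
Proof.
move=> lam1 sF spF; have h := sparse_comp v sF spF.
have rkK := rk_ge (touch F (reach F [set v])) v; rewrite reach_touch // in rkK.
have l : (#|reach F [set v]|.-1 <= rk (touch F (reach F [set v])))%N.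
  by rewrite -subn1 leq_subLR add1n.
apply: le_trans (W_le _) _; last by apply: ler_wiXn2l => //; exact: ltW.
by apply: leq_trans h _; rewrite leq_mul2l l orbT.
Qed.

Lemma sum_subsets A : \sum_(F : {set {set V}} | F \subset A) (1 : R) = 2 ^+ #|A|.
Proof.
rewrite -natrX -card_powerset -sum1_card natr_sum.
by apply: eq_bigl => F; rewrite powersetE.
Qed.

(** The Peierls bound. A component [(C, K)] of [v] can be erased at the cost [W K],
    and uniform percolation shows that the numbers [2 ^ - (D * #|C|)], summed
    over all possible components, are at most [1]. *)
Lemma peierls G (Om : pred {set {set V}}) v (phi : nat -> R) (b : R) :
  simple_graph G -> (forall v, degree G v <= D)%N ->
  (forall F F', F \subset F' -> F' \subset G -> Om F' -> Om F) ->
  (forall k, 0 <= phi k) -> 0 <= b ->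
  (forall F, F \subset G -> Om F ->
     W (touch F (reach F [set v])) * phi #|reach F [set v]| <= b / 2 ^+ (D * #|reach F [set v]|)) ->
  \sum_(F : {set {set V}} | F \subset G) W F * (Om F)%:R * phi #|reach F [set v]| <=
  b * \sum_(F : {set {set V}} | F \subset G) W F * (Om F)%:R.
Proof.
move=> sG dG dOm phi0 b0 H.
set Zm := \sum_(F : {set {set V}} | _) W F * (Om F)%:R.
have Zm0 : 0 <= Zm by apply: sumr_ge0 => F _; rewrite !(Wge0, ler0n, mulr_ge0).
have -> : b * Zm = \sum_(F : {set {set V}} | F \subset G) b * Zm / 2 ^+ #|G|.
  rewrite -[b * Zm in RHS]mulr1 -mulr_suml -mulr_sumr sum_subsets.
  by rewrite mulfK // expf_neq0 // pnatr_eq0.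
apply: (@explore_le _ _ _ [set v] _ _ sG) => F0 sF0; cbv zeta.
set C := reach F0 [set v]; set K := touch F0 C.
rewrite sumr_const -[X in _ <= X]mulr_natl.
have -> : #|[pred F : {set {set V}} | F \subset avoid G C]| = (2 ^ #|avoid G C|)%N.
  by rewrite -card_powerset; apply: eq_card => F; rewrite powersetE.
have ex F : F \subset avoid G C ->
   W (K :|: F) * (Om (K :|: F))%:R * phi #|reach (K :|: F) [set v]|
   <= W K * (Om K)%:R * phi #|C| * (W F * (Om F)%:R).
  move=> sF; have [-> _ _] := reach_explored sG sF0 sF.
  rewrite (W_explored _ _ sG sF0 sF) -/C -/K.
  have sKF : K :|: F \subset G.
    rewrite subUset (subset_trans (subsetDl _ _) sF0) /=.
    exact: subset_trans sF (avoid_sub _ _).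
  case: (boolP (Om (K :|: F))) => [OmU|_].
    rewrite (dOm K _ _ sKF OmU) ?subsetUl // (dOm F _ _ sKF OmU) ?subsetUr //.
    by rewrite !mulr1 mulrAC.
  by rewrite mulr0 mul0r !(Wge0, phi0, ler0n, mulr_ge0).
apply: le_trans (ler_sum _ ex) _; rewrite -mulr_sumr.
have sub : \sum_(F : {set {set V}} | F \subset avoid G C) W F * (Om F)%:R <= Zm.
  rewrite /Zm [X in _ <= X](bigID (fun F : {set {set V}} => F \subset avoid G C)) /=.
  rewrite [X in _ <= X + _](eq_bigl (fun F => F \subset avoid G C)); last first.
    by move=> F; apply: andb_idl => /subset_trans; apply; apply: avoid_sub.
  by rewrite lerDl; apply: sumr_ge0 => F _; rewrite !(Wge0, ler0n, mulr_ge0).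
have cG : (#|G| <= D * #|C| + #|avoid G C|)%N.
  by rewrite (card_touch G C) leq_add2r card_touch_le.
have two k : (0 : R) < 2 ^+ k by rewrite exprn_gt0.
have WK : W K * (Om K)%:R * phi #|C| <= b / 2 ^+ (D * #|C|).
  case: (boolP (Om K)) => [OmK|_]; last by rewrite mulr0 mul0r divr_ge0 // ltW.
  rewrite mulr1; have := H K; rewrite /K /C reach_touch ?(simple_sub sF0) //.
  have [_ E2 _] := reach_explored sG sF0 (sub0set (avoid G (reach F0 [set v]))).
  rewrite setU0 in E2; rewrite E2; apply=> //.
  exact: subset_trans (subsetDl _ _) sF0.
apply: le_trans (_ : b / 2 ^+ (D * #|C|) * Zm <= _).
  apply: ler_pM => //; first by rewrite !(Wge0, phi0, ler0n, mulr_ge0).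
  by apply: sumr_ge0 => F _; rewrite !(Wge0, ler0n, mulr_ge0).
rewrite natrX mulrAC [X in _ <= X]mulrC -[X in _ <= X]mulrA.
apply: ler_wpM2l; first exact: mulr_ge0.
rewrite ler_pdivlMl // ler_pdivrMr // -exprD.
by apply: ler_weXn2l => //; [rewrite ler1n | rewrite addnC].
Qed.

Lemma natr_le_exp2 k : k%:R <= (2 ^+ k : R).
Proof. by rewrite -natrX ler_nat ltnW // ltn_expl. Qed.

(** Peierls with the excess size [k - 1], which vanishes for the isolated vertex; only
    improbable components contribute. *)
Lemma mean_cluster G v : lam <= 1 -> lam * 2 ^+ (2 * D + 1) <= 1 ->
  simple_graph G -> (forall v, degree G v <= D)%N ->
  (forall F, F \subset G -> sparse D F) ->
  \sum_(F : {set {set V}} | F \subset G) W F * #|reach F [set v]|%:R <=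
  2 * \sum_(F : {set {set V}} | F \subset G) W F.
Proof.
move=> lam1 lamD sG dG spG.
have two k : (0 : R) < 2 ^+ k by rewrite exprn_gt0.
have := @peierls G predT v (fun k => k.-1%:R) 1 sG dG (fun _ _ _ _ _ => isT)
  (fun k => ler0n _ _) ler01.
under eq_bigr => F _ do rewrite mulr1.
under [X in _ -> _ <= 1 * X]eq_bigr => F _ do rewrite mulr1.
rewrite mul1r => H.
have -> : \sum_(F : {set {set V}} | F \subset G) W F * #|reach F [set v]|%:R =
  \sum_(F : {set {set V}} | F \subset G) W F * #|reach F [set v]|.-1%:R +
  \sum_(F : {set {set V}} | F \subset G) W F.
  rewrite -big_split; apply: eq_bigr => F _ /=; rewrite -[X in _ = _ + X]mulr1 -mulrDr.
  rewrite natr1 prednK // card_gt0; apply/set0Pn; exists v.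
  by apply: (subsetP (sub_reach _ _)); rewrite set11.
rewrite [2 * _]mulr_natl mulr2n lerD2r; apply: H => F sF _.
set C := reach F [set v]; set k := #|C|.
case Ek: k.-1 => [|j]; first by rewrite mulr0 divr_ge0 // ltW.
have kE : k = j.+2 by move: Ek; case: (k) => [|i] //= ->.
rewrite ler_pdivlMr //.
apply: le_trans (_ : (lam * 2 ^+ (2 * D + 1)) ^+ j.+1 <= _); last first.
  by apply: exprn_ile1 => //; rewrite mulr_ge0 ?ltW.
have h := W_comp_le v lam1 (simple_sub sF sG) (spG F sF).
rewrite -/C -/k Ek in h.
have j0 : 0 <= j.+1%:R * 2 ^+ (D * k) :> R by rewrite mulr_ge0 ?ler0n // ltW.
rewrite exprMn -exprM -!mulrA; apply: (ler_pM (Wge0 _) j0 h).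
apply: le_trans (_ : 2 ^+ j.+1 * 2 ^+ (D * k) <= _).
  by apply: ler_wpM2r; [rewrite ltW | apply: natr_le_exp2].
rewrite -exprD; apply: ler_weXn2l; first by rewrite ler1n.
by rewrite kE; clear; nia.
Qed.

Lemma cluster_tail G (Om : pred {set {set V}}) v r : lam <= 1 -> lam * 2 ^+ D <= 1 ->
  simple_graph G -> (forall v, degree G v <= D)%N ->
  (forall F F', F \subset F' -> F' \subset G -> Om F' -> Om F) ->
  (forall F, F \subset G -> Om F -> sparse D F) ->
  \sum_(F : {set {set V}} | F \subset G) W F * (Om F)%:R * (r < #|reach F [set v]|)%N%:R <=
  2 ^+ D * (lam * 2 ^+ D) ^+ r *
    \sum_(F : {set {set V}} | F \subset G) W F * (Om F)%:R.
Proof.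
move=> lam1 lamD sG dG dOm spG.
have two k : (0 : R) < 2 ^+ k by rewrite exprn_gt0.
have b0 : 0 <= 2 ^+ D * (lam * 2 ^+ D) ^+ r.
  by rewrite mulr_ge0 ?exprn_ge0 ?mulr_ge0 ?exprn_ge0 // ltW.
apply: (@peierls G Om v (fun k => (r < k)%N%:R)) => // F sF OmF.
set C := reach F [set v]; set k := #|C|.
have h := W_comp_le v lam1 (simple_sub sF sG) (spG F sF OmF).
case: ltnP => [rk|_]; last by rewrite mulr0 divr_ge0 // ltW.
rewrite mulr1; apply: le_trans h _; rewrite -/C -/k ler_pdivlMr //.
have -> : (D * k = D + D * k.-1)%N by rewrite -mulnS prednK // (leq_ltn_trans (leq0n r) rk).
rewrite exprD [2 ^+ (D * _)]exprM mulrCA -exprMn; apply: ler_wpM2l; first exact: ltW.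
apply: ler_wiXn2l => //; first by rewrite mulr_ge0 // ltW.
by move: rk; case: (k).
Qed.

End Peierls.

(** * Updates and the single-edge dynamics *)

Section Updates.
Variables (V : finType).
Implicit Types (F K G A H X Y : {set {set V}}) (S Z C M e : {set V}) (t : option bool).

(** The three kinds of update: [Some true] inserts [e], [Some false] deletes it, and [None]
    inserts it exactly when its ends are joined without it. With this randomness, all
    starting configurations can be run together and every update is monotone. *)
Definition update t F e : {set {set V}} :=
  if (if t is Some b then b else joined (F :\ e) e) then e |: F else F :\ e.

Definition update_in A t F e := if e \in A then update t F e else F.

Lemma update_mono t F F' e : F \subset F' -> update t F e \subset update t F' e.
Proof.
move=> sF; have s1 : e |: F \subset e |: F' by apply: setUS.
have s2 : F :\ e \subset F' :\ e by apply: setSD.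
have s3 : F :\ e \subset e |: F' by apply: subset_trans s2 (subset_trans (subsetDl _ _) (subsetUr _ _)).
rewrite /update; case: t => [[]|] //.
by case: (boolP (joined _ _)) => [/(joinedS s2)->|_] //; case: ifP.
Qed.

Lemma update_in_mono A t F F' e : F \subset F' -> update_in A t F e \subset update_in A t F' e.
Proof. by rewrite /update_in; case: ifP => // _; apply: update_mono. Qed.

Lemma update_sub t F A e : e \in A -> F \subset A -> update t F e \subset A.
Proof.
move=> eA sF; have s1 : e |: F \subset A by rewrite subUset sub1set eA.
have s2 : F :\ e \subset A by apply: subset_trans sF; apply: subsetDl.
by rewrite /update; case: ifP.
Qed.

Lemma update_in_sub t F A e : F \subset A -> update_in A t F e \subset A.
Proof. by rewrite /update_in; case: ifP => // eA; apply: update_sub. Qed.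

Lemma updateD1 t F e : update t (F :\ e) e = update t F e.
Proof.
have E : (F :\ e) :\ e = F :\ e by rewrite setDDl setUid.
rewrite /update E; case: ifP => _ //.
by apply/setP=> f; rewrite !inE; case: eqP.
Qed.

Lemma updateU1 t F e : update t (e |: F) e = update t F e.
Proof. by rewrite -updateD1 -[in RHS]updateD1 setDUl setDv set0U. Qed.

Lemma update_other t F e f : f != e -> (f \in update t F e) = (f \in F).
Proof. by move=> fe; rewrite /update; case: ifP => _; rewrite !inE (negbTE fe). Qed.
End Updates.

Section Averages.
Variables (R : realFieldType) (V : finType) (p ph : R).
Hypotheses (ph0 : 0 <= ph) (php : ph <= p) (p1 : p <= 1).
Implicit Types (F K G A H X Y : {set {set V}}) (S Z C M e : {set V}) (t : option bool).

(** An update is unconditional with probability [ph] (insertion) and [1 - p]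
    (deletion); otherwise it depends on the configuration. The total probability of
    insertion is then [p] when the ends of [e] are joined, and [ph] when they are not. *)
Definition mean_mark (f : option bool -> R) : R :=
  ph * f (Some true) + (p - ph) * f None + (1 - p) * f (Some false).

Lemma le_mean_mark f f' : (forall t, f t <= f' t) -> mean_mark f <= mean_mark f'.
Proof.
by move=> h; rewrite /mean_mark !lerD // ler_wpM2l // subr_ge0.
Qed.

Lemma eq_mean_mark f f' : f =1 f' -> mean_mark f = mean_mark f'.
Proof. by move=> h; rewrite /mean_mark !h. Qed.

Lemma mean_mark_cst c : mean_mark (fun=> c) = c.
Proof. by rewrite /mean_mark; ring. Qed.

Lemma mean_mark_mull c f : mean_mark (fun t => c * f t) = c * mean_mark f.
Proof. by rewrite /mean_mark; ring. Qed.

Lemma mean_markB f f' : mean_mark (fun t => f t - f' t) = mean_mark f - mean_mark f'.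
Proof. by rewrite /mean_mark; ring. Qed.

Lemma mean_mark_sum (I : finType) (P : pred I) (f : I -> option bool -> R) :
  mean_mark (fun t => \sum_(i | P i) f i t) = \sum_(i | P i) mean_mark (f i).
Proof. by rewrite /mean_mark !mulr_sumr -!big_split. Qed.

Definition mean_edge G (h : {set V} -> R) : R := #|G|%:R^-1 * \sum_(e in G) h e.

Lemma le_mean_edge G h h' : (forall e, e \in G -> h e <= h' e) -> mean_edge G h <= mean_edge G h'.
Proof.
by move=> H; rewrite /mean_edge ler_wpM2l ?invr_ge0 ?ler0n //; apply: ler_sum.
Qed.

Lemma eq_mean_edge G h h' : (forall e, e \in G -> h e = h' e) -> mean_edge G h = mean_edge G h'.
Proof. by move=> H; rewrite /mean_edge; congr (_ * _); apply: eq_bigr. Qed.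

Lemma mean_edgeB G h h' : mean_edge G (fun e => h e - h' e) = mean_edge G h - mean_edge G h'.
Proof. by rewrite /mean_edge sumrB mulrBr. Qed.

Lemma mean_edge_mull G c h : mean_edge G (fun e => c * h e) = c * mean_edge G h.
Proof. by rewrite /mean_edge -mulr_sumr mulrCA. Qed.

Lemma mean_edge_cst G c : G != set0 -> mean_edge G (fun=> c) = c.
Proof.
move=> G0; rewrite /mean_edge sumr_const -[c *+ _]mulr_natl mulKf //.
by rewrite pnatr_eq0 -lt0n card_gt0.
Qed.

(** The backward operator of the dynamics. The updates of edges outside [A] are ignored, but
    the edge is still drawn from [G], so that time is the same for all [A]. *)
Definition transition G A (f : {set {set V}} -> R) F : R :=
  mean_edge G (fun e => mean_mark (fun t => f (update_in A t F e))).

(** Freezing the edges outside [A] out, and starting lower, gives a smaller process. *)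
Lemma transition_compare G A f T X Y : A \subset G -> X \subset A -> X \subset Y ->
  (forall F F' : {set {set V}}, F \subset F' -> f F <= f F') ->
  iter T (transition G A) f X <= iter T (transition G G) f Y.
Proof.
move=> sA XA XY fm; elim: T X Y XA XY => [|T IH] X Y XA XY /=; first exact: fm.
apply: le_mean_edge => e eG; apply: le_mean_mark => t.
apply: IH; first exact: update_in_sub.
rewrite /update_in eG; case: ifPn => [_|eA]; first exact: update_mono.
apply/subsetP=> k kX; rewrite update_other ?(subsetP XY) //.
by apply: contraNneq eA => <-; apply: (subsetP XA).
Qed.

End Averages.

Section Stationary.
Variables (R : realFieldType) (V : finType) (w q p ph : R).
Hypotheses (w0 : 0 < w) (q1 : 1 <= q).
Hypotheses (pE : p * (1 + w) = w) (phE : ph * (q + w) = w).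
Implicit Types (F K G A H X Y : {set {set V}}) (S Z C M e : {set V}) (t : option bool).
Notation W := (@W R V w q).

Let q0 : 0 < q. Proof. exact: lt_le_trans ltr01 q1. Qed.

Lemma W_balance F e c0 c1 : #|e| = 2 -> e \notin F ->
  let r := if joined F e then p else ph in
  (W F + W (e |: F)) * (r * c1 + (1 - r) * c0) = W F * c0 + W (e |: F) * c1.
Proof.
move=> ce eF r; rewrite W_setU1 //.
suff rE : (1 + (if joined F e then w else w / q)) * r = if joined F e then w else w / q.
  set k := if _ then _ else _ in rE *.
  have -> : (W F + W F * k) * (r * c1 + (1 - r) * c0) =
    W F * (((1 + k) * r) * c1 + ((1 + k) - (1 + k) * r) * c0) by ring.
  by rewrite rE; ring.
rewrite /r; case: ifP => _; first by rewrite mulrC.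
have qn0 : q != 0 by rewrite gt_eqF.
have -> : 1 + w / q = (q + w) / q by rewrite mulrDl divff.
by rewrite mulrAC [_ * ph]mulrC phE.
Qed.

(** Given the other edges, the update resamples [e] from its conditional law, which is what
    [W_balance] expresses. *)
Lemma W_stationary E e (f : {set {set V}} -> R) : simple_graph E -> e \in E ->
  \sum_(F : {set {set V}} | F \subset E) W F * mean_mark p ph (fun t => f (update t F e)) =
  \sum_(F : {set {set V}} | F \subset E) W F * f F.
Proof.
move=> sE eE; rewrite -(setD1K eE) !big_subsetU1 ?setD11 //.
apply: eq_bigr => F sF.
have eF : e \notin F by apply/negP=> /(subsetP sF); rewrite setD11.
have FD : F :\ e = F by apply/setDidPl; rewrite disjoint_sym disjoints1.
rewrite -(W_balance (f F) (f (e |: F)) (simpleP sE eE) eF).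
have -> : mean_mark p ph (fun t => f (update t (e |: F) e)) = mean_mark p ph (fun t => f (update t F e)).
  by apply: eq_mean_mark => t; rewrite updateU1.
rewrite -mulrDl; congr (_ * _); rewrite /mean_mark /update FD.
by case: (joined F e); ring.
Qed.

Lemma transition_stationary G A f : G != set0 -> simple_graph A -> 
  \sum_(F : {set {set V}} | F \subset A) W F * transition p ph G A f F =
  \sum_(F : {set {set V}} | F \subset A) W F * f F.
Proof.
move=> G0 sA; rewrite /transition /mean_edge.
under eq_bigr => F _ do rewrite mulrCA mulr_sumr.
rewrite -mulr_sumr exchange_big /=.
transitivity (mean_edge G (fun=> \sum_(F : {set {set V}} | F \subset A) W F * f F)).
  2: exact: mean_edge_cst.
rewrite /mean_edge; congr (_ * _).
apply: eq_bigr => e _; rewrite /update_in; case: (boolP (e \in A)) => eA.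
  exact: W_stationary.
by apply: eq_bigr => F _; rewrite mean_mark_cst.
Qed.

End Stationary.

(** * The contagion *)

Section Contagion.
Variables (R : realFieldType) (V : finType) (p ph : R).
Hypotheses (ph0 : 0 <= ph) (php : ph <= p) (p1 : p <= 1).
Implicit Types (F K G A H X Y : {set {set V}}) (S Z C M e : {set V}) (t : option bool).
Implicit Type Q : {set {set V}} -> {set V} -> R.

(** Marks spread over the components of [Y]; isolated vertices, the ones that no edge of [Y]
    covers, are healed. *)
Definition spread Y M : {set V} := reach Y M :&: cover Y.

Lemma coverS F F' : F \subset F' -> cover F \subset cover F'.
Proof.
move=> sF; apply/subsetP=> v /bigcupP[e eF ve].
by apply/bigcupP; exists e => //; apply: (subsetP sF).
Qed.

Lemma spread_mono Y Y' M M' : Y \subset Y' -> M \subset M' -> spread Y M \subset spread Y' M'.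
Proof. by move=> sY sM; apply: setISS; [apply: reach_mono | apply: coverS]. Qed.

Definition contagion G A Q Y M : R :=
  mean_edge G (fun e => mean_mark p ph (fun t => Q (update_in A t Y e) (spread (update_in A t Y e) M))).

Definition mono_pair Q := forall Y Y' M M', Y \subset Y' -> M \subset M' -> Q Y M <= Q Y' M'.

Lemma contagion_mono G A Q T : mono_pair Q -> mono_pair (iter T (contagion G A) Q).
Proof.
move=> Qm; elim: T => [//|T IH] Y Y' M M' sY sM /=.
apply: le_mean_edge => e _; apply: le_mean_mark => // t; apply: IH.
  exact: update_in_mono.
by apply: spread_mono => //; apply: update_in_mono.
Qed.

Definition inv_coupling A X Y M :=
  [/\ X \subset Y, Y \subset A & forall e, e \in Y :\: X -> e \subset M].

(** A new disagreement at [e] requires the ends of [e] to be joined in [Y] but not in [X].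
    Their component in [Y] then contains an older disagreement, hence a mark, and the mark
    reaches [e]. *)
Lemma coupling_step A t X Y M e : simple_graph A -> inv_coupling A X Y M ->
  inv_coupling A (update_in A t X e) (update_in A t Y e) (spread (update_in A t Y e) M).
Proof.
move=> sA [XY YA D]; split; [exact: update_in_mono | exact: update_in_sub |].
have keep f v : f \in Y :\: X -> f \in update_in A t Y e -> v \in f -> v \in spread (update_in A t Y e) M.
  move=> fD fY vf; rewrite in_setI (subsetP (sub_reach _ _)) ?(subsetP (D _ fD)) //.
  by apply/bigcupP; exists f.
move=> f; rewrite in_setD => /andP[fX fY].
have [fe|fe] := eqVneq f e; last first.
  apply/subsetP=> v; apply: keep => //; rewrite in_setD.
  by move: fX fY; rewrite /update_in; case: ifP => _; rewrite ?update_other // => -> ->.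
subst f; case: (boolP (e \in Y :\: X)) => [eD|eD].
  by apply/subsetP=> v; apply: keep.
move: fX fY; rewrite /update_in; case: ifPn => [eA|eA]; last first.
  by move=> fX fY; case/negP: eD; rewrite in_setD fX fY.
rewrite {1 2}/update; case: t keep => [[]|] keep; rewrite ?inE ?eqxx //.
case: (boolP (joined (Y :\ e) e)) => jY; last by rewrite !inE eqxx.
case: (boolP (joined (X :\ e) e)) => jX; first by rewrite !inE eqxx.
move=> _ _.
have E : update None Y e = e |: Y by rewrite /update jY.
rewrite E.
have ce := simpleP sA eA.
have [a [b [ab Ee]]] : exists a b, a != b /\ e = [set a; b].
  by have /eqP/cards2P[a [b [ab ->]]] := ce; exists a, b.
have jYab : conn (Y :\ e) a b by rewrite -joined2 -Ee.
have nX : ~~ conn (X :\ e) a b by rewrite -joined2 -Ee.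
have [z zM az] : exists2 z, z \in M & conn (Y :\ e) a z.
  apply/exists_inP; apply: contraNT nX => /exists_inPn h.
  pose B := [set x | conn (X :\ e) a x].
  suff : b \in B by rewrite inE.
  apply: conn_closed jYab; last by rewrite inE; apply: connect0.
  move=> x y; rewrite !inE => ax /andP[xye xyY].
  case: (boolP ([set x; y] \in X)) => xyX.
    by apply: connect_trans ax _; apply: connect1; rewrite /graph_adj !inE xye.
  have xM : x \in M by apply: (subsetP (D _ _)) (set21 x y); rewrite in_setD xyX.
  by case/negP: (h _ xM); apply: conn_sub ax; apply: setSD.
have az' : conn (e |: Y) z a.
  rewrite conn_sym; apply: conn_sub az.
  by apply: subset_trans (subsetDl _ _) (subsetUr _ _).
have ab' : conn (e |: Y) a b by apply: connect1; rewrite /graph_adj -Ee setU11.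
have cov v : v \in e -> v \in cover (e |: Y).
  by move=> ve; apply/bigcupP; exists e; rewrite ?setU11.
apply/subsetP=> v ve; rewrite in_setI cov // andbT.
have : v \in [set a; b] by rewrite -Ee.
move=> vab; apply/reachP; exists z => //; move: vab.
rewrite !inE =>  /orP[]/eqP-> //.
exact: connect_trans az' ab'.
Qed.

Lemma coupling_bound G A (f : {set {set V}} -> R) Q T X Y M : simple_graph A ->
  (forall X Y M, inv_coupling A X Y M -> f Y - f X <= Q Y M) ->
  inv_coupling A X Y M ->
  iter T (transition p ph G A) f Y - iter T (transition p ph G A) f X <= iter T (contagion G A) Q Y M.
Proof.
move=> sA fQ; elim: T X Y M => [|T IH] X Y M I /=; first exact: fQ.
rewrite -mean_edgeB; apply: le_mean_edge => e _; rewrite -mean_markB; apply: le_mean_mark => // t.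
by apply: IH; apply: coupling_step.
Qed.

End Contagion.

Section Contraction.
Variables (R : realFieldType) (V : finType) (w q p ph : R).
Hypotheses (w0 : 0 < w) (q1 : 1 <= q).
Hypotheses (pE : p * (1 + w) = w) (phE : ph * (q + w) = w).
Hypotheses (ph0 : 0 <= ph) (php : ph <= p) (p1 : p <= 1).
Implicit Types (F K H X Y : {set {set V}}) (S Z C M e : {set V}) (t : option bool).
Notation W := (@W R V w q).

Variables (G A : {set {set V}}).
Hypotheses (sG : simple_graph G) (AG : A \subset G).
Let sA : simple_graph A. Proof. exact: simple_sub AG sG. Qed.

Lemma sub_cover H e : e \in H -> e \subset cover H.
Proof. exact: bigcup_sup. Qed.

Lemma avoid_disjoint B S F e : F \subset avoid B S -> e \in F -> [disjoint e & S].
Proof. by move=> sF /(subsetP sF); rewrite inE => /andP[]. Qed.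

Lemma in_edge_other H F S e : (forall f, f \in H -> f \subset S) ->
  (forall f, f \in F -> [disjoint f & S]) ->
  forall x y, x \in S -> [set x; y] \in H :|: F -> y \in S.
Proof.
move=> HS FS x y xS; rewrite inE => /orP[/HS|/FS].
  by rewrite subUset !sub1set => /andP[].
by move=> /disjointFr/(_ (set21 x y)); rewrite xS.
Qed.

Lemma reach_inside H F S : (forall f, f \in H -> f \subset S) ->
  (forall f, f \in F -> [disjoint f & S]) -> reach (H :|: F) S = S.
Proof.
move=> HS FS; apply/eqP; rewrite eqEsubset sub_reach andbT; apply: reach_min => //.
exact: in_edge_other HS FS.
Qed.

Lemma spread_inside H F S : (forall f, f \in H -> f \subset S) ->
  (forall f, f \in F -> [disjoint f & S]) -> spread (H :|: F) S = cover H.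
Proof.
move=> HS FS; rewrite /spread reach_inside //; apply/setP=> v; rewrite inE.
apply/andP/idP => [[vS /bigcupP[e]]|vH]; last first.
  split; last by apply: (subsetP (coverS (subsetUl _ _))).
  by case/bigcupP: vH => e /HS/subsetP; apply.
rewrite inE => /orP[eH ve|/FS /disjointFr h ve]; first by apply/bigcupP; exists e.
by rewrite h in vS.
Qed.

(** Connectivity of two vertices of [S] does not depend on the edges that avoid [S]. *)
Lemma update_inside H F S t e : (forall f, f \in H -> f \subset S) ->
  (forall f, f \in F -> [disjoint f & S]) -> #|e| = 2 -> e \subset S ->
  update t (H :|: F) e = update t H e :|: F.
Proof.
move=> HS FS ce eS.
have eF : e \notin F.
  apply/negP=> /FS; rewrite disjoints_subset => h.
  have [x xe] : exists x, x \in e by apply/set0Pn; rewrite -card_gt0 ce.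
  by move: (subsetP h x xe); rewrite inE (subsetP eS).
have E : (H :|: F) :\ e = F :|: (H :\ e).
  apply/setP=> f; rewrite !inE andb_orr orbC; congr (_ || _).
  by apply: andb_idl => fF; apply: contraNneq eF => <-.
have J : joined ((H :|: F) :\ e) e = joined (H :\ e) e.
  by rewrite E; apply: (@joined_disjoint _ _ _ S) => // f; rewrite inE => /andP[_ /HS].
rewrite /update J; case: ifP => _; first by rewrite setUA.
by rewrite E setUC.
Qed.

Lemma update_outside H F S t e : (forall f, f \in H -> f \subset S) ->
  (forall f, f \in F -> [disjoint f & S]) -> #|e| = 2 -> [disjoint e & S] ->
  update t (H :|: F) e = H :|: update t F e.
Proof.
move=> HS FS ce eS; rewrite setUC [RHS]setUC; apply: (@update_inside _ _ (~: S)) => //.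
- by move=> f /FS; rewrite disjoints_subset.
- by move=> f /HS; rewrite disjoints_subset setCK.
- by rewrite -disjoints_subset.
Qed.

(** In the component of [c] the new edge covers [c], and the edges touching the component
    cover the other vertices. *)
Lemma cover_merge H F s c : simple_graph F ->
  s \in cover H -> c \notin cover H ->
  (forall f, f \in F -> [disjoint f & cover H]) ->
  cover (([set s; c] |: H) :|: touch F (reach F [set c])) = cover H :|: reach F [set c].
Proof.
move=> sF sS cS FS; set e := [set s; c]; set C := reach F [set c]; set H' := _ :|: _.
have cC : c \in C by apply: (subsetP (sub_reach _ _)); rewrite set11.
have HH' : H \subset H' by apply: subset_trans (subsetUr _ _) (subsetUl _ _).
have eH' : e \in H' by rewrite !inE eqxx.
apply/eqP; rewrite eqEsubset; apply/andP; split.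
  apply/bigcupsP=> f; rewrite in_setU in_setU1 => /orP[/orP[/eqP->|fH]|fK].
  - by rewrite subUset !sub1set !in_setU sS cC orbT.
  - by apply: subset_trans (sub_cover fH) (subsetUl _ _).
  - by apply: subset_trans (touch_reach_sub sF fK) (subsetUr _ _).
rewrite subUset coverS //=.
suff : C \subset C :&: cover H' by rewrite subsetI => /andP[].
apply: reach_min.
  by rewrite sub1set in_setI cC; apply/bigcupP; exists e; rewrite // set22.
move=> x y; rewrite !in_setI => /andP[xC _] xy; rewrite (reach_closed xC xy) /=.
apply/bigcupP; exists [set x; y]; rewrite ?set22 // in_setU touchE xy /=.
by apply/orP; right; apply/pred0Pn; exists x; rewrite /= set21.
Qed.

Lemma spread_merge H F s c : simple_graph F ->
  s \in cover H -> c \notin cover H ->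
  (forall f, f \in F -> [disjoint f & cover H]) ->
  spread ([set s; c] |: (H :|: F)) (cover H) = cover H :|: reach F [set c].
Proof.
move=> sF sS cS FS; set e := [set s; c]; set C := reach F [set c]; set Y := _ |: _.
have HS f : f \in H -> f \subset cover H by apply: sub_cover.
have cC : c \in C by apply: (subsetP (sub_reach _ _)); rewrite set11.
apply/eqP; rewrite eqEsubset; apply/andP; split.
  apply: subset_trans (subsetIl _ _) _; apply: reach_min; first exact: subsetUl.
  move=> x y; rewrite !in_setU in_set1 => xSC /orP[/eqP E|/orP[xyH|xyF]].
  - have : y \in e by rewrite -E set22.
    by rewrite in_set2 => /orP[]/eqP->; rewrite ?sS // cC orbT.
  - by rewrite (subsetP (HS _ xyH)) ?set22.
  - case/orP: xSC => [xS|xC]; last by rewrite (reach_closed xC xyF) orbT.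
    by move/disjointFr/(_ (set21 x y)): (FS _ xyF); rewrite xS.
rewrite subsetI; apply/andP; split.
  rewrite subUset sub_reach /=; apply: reach_min.
    rewrite sub1set; apply: reach_closed (subsetP (sub_reach Y (cover H)) s sS) _.
    by rewrite !inE eqxx.
  by move=> x y xY xy; apply: reach_closed xY _; rewrite !inE xy !orbT.
rewrite -(cover_merge sF sS cS FS); apply: coverS.
rewrite -setUA; apply: setUS; apply: setUS; exact: subsetDl.
Qed.

Variables (g : nat -> R) (gmax rho : R).
Hypotheses (g_mono : {homo g : i j / (i <= j)%N >-> i <= j}) (g0 : g 0%N = 0).
Hypotheses (g_max : forall i, g i <= gmax) (rho0 : 0 <= rho).

(** The potential of the configuration [H] explored by the contagion: its vertices are the
    marked ones, and every one of them has positive degree. *)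
Definition potential H : R := \sum_v g (degree H v).

(** The version of [potential] that is monotone in the pair (configuration, marks). *)
Definition marked_potential Y M : R := \sum_(v in M) g (degree Y v).

Let g_ge0 i : 0 <= g i. Proof. by rewrite -g0 g_mono. Qed.

Lemma degreeS F F' v : F \subset F' -> (degree F v <= degree F' v)%N.
Proof.
move=> sF; apply: subset_leq_card; apply/subsetP=> e; rewrite !inE => /andP[eF ->].
by rewrite (subsetP sF).
Qed.

Lemma marked_potential_mono : mono_pair marked_potential.
Proof.
move=> Y Y' M M' sY sM; rewrite /marked_potential [X in _ <= X](bigID (mem M)) /=.
rewrite [X in _ <= X + _](eq_bigl (mem M)); last first.
  by move=> v; apply: andb_idl; apply: (subsetP sM).
apply: ler_wpDr; first exact: sumr_ge0.
by apply: ler_sum => v _; rewrite g_mono // degreeS.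
Qed.

Lemma potential_merge H F s c : 
  s \in cover H -> simple_graph F -> (forall f, f \in F -> [disjoint f & cover H]) ->
  potential (([set s; c] |: H) :|: touch F (reach F [set c])) <=
  potential H + gmax * (1 + #|reach F [set c]|%:R).
Proof.
move=> sS sF FS; set C := reach F [set c]; set H' := _ :|: _.
pose U := s |: C.
have cC : c \in C by apply: (subsetP (sub_reach _ _)); rewrite set11.
have g1 : 0 <= gmax by apply: le_trans (g_max 0%N).
apply: le_trans (_ : potential H + \sum_(v in U) gmax <= _); last first.
  rewrite lerD2l sumr_const -[gmax *+ _]mulr_natr ler_wpM2l //.
  by rewrite nat1r ler_nat cardsU1; case: (s \notin C); rewrite ?add1n ?add0n.
rewrite /potential [X in _ <= _ + X]big_mkcond -big_split /=; apply: ler_sum => v _.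
case: ifPn => [_|vU].
  by apply: le_trans (g_max _) _; rewrite lerDr.
rewrite addr0 g_mono // /degree subset_leq_card //.
apply/subsetP=> f; rewrite inE => /andP[fH' vf]; rewrite inE vf andbT.
move: fH'; rewrite in_setU in_setU1 => /orP[/orP[/eqP fe|//]|fK].
  case/negP: vU; move: vf; rewrite fe in_set2 => /orP[]/eqP->.
    by rewrite in_setU1 eqxx.
  by rewrite in_setU1 cC orbT.
case/negP: vU; rewrite in_setU1.
by rewrite (subsetP (touch_reach_sub sF fK) v vf) orbT.
Qed.

(** What the potential becomes in expectation after an update of [e], when the environment
    outside [cover H] is stationary. The term [3 * gmax] accounts for one vertex of
    [cover H] and for a component of mean size at most [2]. *)
Definition potential_bound H e : R :=
  if e \in A then
    if e \subset cover H then mean_mark p ph (fun t => potential (update t H e))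
    else if [disjoint e & cover H] then potential H else potential H + ph * (3 * gmax)
  else potential H.

Hypothesis mean2 : forall (B : {set {set V}}) v, B \subset A ->
  \sum_(F : {set {set V}} | F \subset B) W F * #|reach F [set v]|%:R <=
  2 * \sum_(F : {set {set V}} | F \subset B) W F.
Hypothesis drift : forall H, H \subset A -> mean_edge G (potential_bound H) <= rho * potential H.

(** Induction on time; the state is a configuration [H] on the marked vertices [cover H] with
    a stationary environment on the edges avoiding them. An update away from [cover H]
    preserves the environment. After an update inside, the healed vertices are returned to
    the environment, which is then raised by FKG. When an edge leaving [cover H] opens, the
    component that it reaches is explored, and the unexplored environment is again
    stationary. In each case the induction hypothesis applies to the new state. *)
Lemma contagion_contracts T H : H \subset A ->
  \sum_(F : {set {set V}} | F \subset avoid A (cover H))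
     W F * iter T (contagion p ph G A) marked_potential (H :|: F) (cover H) <=
  rho ^+ T * potential H * \sum_(F : {set {set V}} | F \subset avoid A (cover H)) W F.
Proof.
have Wp F : 0 <= W F by apply: W_ge0.
have Zp (B : {set {set V}}) : 0 <= \sum_(F : {set {set V}} | F \subset B) W F by apply: sumr_ge0.
elim: T H => [|T IH] H HA.
  rewrite expr0 mul1r mulr_sumr; apply: ler_sum => F sF /=.
  rewrite mulrC; apply: ler_wpM2r => //; rewrite /marked_potential /potential.
  rewrite big_mkcond /=; apply: ler_sum => v _; case: ifP => // vS.
  apply: g_mono; apply: subset_leq_card; apply/subsetP=> f; rewrite !inE.
  case/andP=> /orP[->//|/(avoid_disjoint sF)] d vf.
  by rewrite (disjointFr d vf) in vS.
set S := cover H; set env := avoid A S; set z := \sum_(F : {set {set V}} | _) W F.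
set QT := iter T (contagion p ph G A) marked_potential.
have QTm : mono_pair QT by apply: contagion_mono => //; apply: marked_potential_mono.
have HS f : f \in H -> f \subset S by apply: sub_cover.
have FS F f : F \subset env -> f \in F -> [disjoint f & S] by apply: avoid_disjoint.
have rT : 0 <= rho ^+ T by rewrite exprn_ge0.
suff key e : e \in G -> \sum_(F : {set {set V}} | F \subset env)
    W F * mean_mark p ph (fun t => QT (update_in A t (H :|: F) e) (spread (update_in A t (H :|: F) e) S))
    <= rho ^+ T * z * potential_bound H e.
  have -> : \sum_(F : {set {set V}} | F \subset env) W F * iter T.+1 (contagion p ph G A) marked_potential (H :|: F) S
    = mean_edge G (fun e => \sum_(F : {set {set V}} | F \subset env)
    W F * mean_mark p ph (fun t => QT (update_in A t (H :|: F) e) (spread (update_in A t (H :|: F) e) S))).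
    rewrite /mean_edge exchange_big mulr_sumr; apply: eq_bigr => F _ /=.
    by rewrite -mulr_sumr mulrCA.
  apply: le_trans (le_mean_edge key) _; rewrite mean_edge_mull.
  have -> : rho ^+ T.+1 * potential H * z = rho ^+ T * z * (rho * potential H).
    by rewrite exprS; ring.
  by apply: ler_wpM2l; [by apply: mulr_ge0 => //; apply: Zp | apply: drift].
have stay : \sum_(F : {set {set V}} | F \subset env) W F * QT (H :|: F) S <= rho ^+ T * z * potential H.
  by rewrite mulrAC; apply: IH.
have sprS F : F \subset env -> spread (H :|: F) S = S.
  by move=> sF; apply: spread_inside => // f; apply: FS.
move=> eG; rewrite /potential_bound /update_in; case: ifPn => eA; last first.
  apply: le_trans stay; rewrite le_eqVlt; apply/orP; left; apply/eqP.
  by apply: eq_bigr => F sF; rewrite mean_mark_cst sprS.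
have ce := simpleP sA eA.
case: ifPn => eS.
  (* an edge inside [S]: the environment can only grow *)
  have -> : rho ^+ T * z * mean_mark p ph (fun t => potential (update t H e)) =
      mean_mark p ph (fun t => rho ^+ T * z * potential (update t H e)) by rewrite mean_mark_mull.
  have -> : \sum_(F : {set {set V}} | F \subset env) W F *
      mean_mark p ph (fun t => QT (update t (H :|: F) e) (spread (update t (H :|: F) e) S)) =
    mean_mark p ph (fun t => \sum_(F : {set {set V}} | F \subset env) W F *
      QT (update t H e :|: F) (cover (update t H e))).
    rewrite mean_mark_sum; apply: eq_bigr => F sF; rewrite mean_mark_mull; congr (_ * _).
    apply: eq_mean_mark => t; rewrite (@update_inside _ _ S) // => [|f]; last exact: FS.
    congr (QT _ _); apply: spread_inside => [f|f]; last exact: FS.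
    have [->//|fe] := eqVneq f e; rewrite update_other //; exact: HS.
  apply: le_mean_mark => // t; set H' := update t H e.
  have H'A : H' \subset A by apply: update_sub.
  have cH' : cover H' \subset S.
    apply/bigcupsP=> f; have [->//|fe] := eqVneq f e.
    by rewrite /H' update_other //; apply: HS.
  have se : env \subset avoid A (cover H') by apply: avoid_mono.
  have sA' : simple_graph (avoid A (cover H')) by apply: simple_sub sA; apply: avoid_sub.
  have Qi : increasing (avoid A (cover H')) (fun F => QT (H' :|: F) (cover H')).
    by move=> F F' sF _; apply: QTm => //; apply: setUS.
  have Z'0 : 0 < \sum_(F : {set {set V}} | F \subset avoid A (cover H')) W F.
    rewrite (bigD1 set0) ?sub0set //= W_set0; apply: ltr_wpDr => //.
    exact: sumr_ge0.
  rewrite -(ler_pM2r Z'0); apply: le_trans (fkg_shrink w0 q1 sA' se Qi) _.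
  rewrite -/z -!mulrA mulrCA; apply: ler_wpM2l; first exact: Zp.
  by rewrite mulrA; apply: IH.
case: ifPn => [dS|nS].
  (* an edge of the environment: stationarity *)
  have eE : e \in env by rewrite inE eA.
  have sE : simple_graph env by apply: simple_sub sA; apply: avoid_sub.
  apply: le_trans stay.
  rewrite -(W_stationary q1 pE phE (fun F => QT (H :|: F) S) sE eE).
  rewrite le_eqVlt; apply/orP; left; apply/eqP.
  apply: eq_bigr => F sF; congr (_ * _); apply: eq_mean_mark => t.
  rewrite (@update_outside _ _ S) // => [|f]; last exact: FS.
  by rewrite sprS // update_sub.
(* an edge leaving [S]: the component that it reaches is explored *)
have [s [c [sS cS Ee]]] : exists s c, [/\ s \in S, c \notin S & e = [set s; c]].
  have /eqP/cards2P[a [b [ab Ee]]] := ce.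
  have [x xe xS] := subsetPn eS; case/pred0Pn: nS => y /andP[/= ye yS].
  exists y, x; split=> //; apply/eqP; rewrite eq_sym eqEcard ce cards2.
  rewrite subUset !sub1set xe ye /=; case: eqVneq yS xS => // ->.
  by move=> ->.
have eF F : F \subset env -> e \notin H :|: F.
  move=> sF; rewrite inE; apply/norP; split; first by apply: contra eS; apply: HS.
  by apply: contra nS; apply: FS.
have nj F : F \subset env -> ~~ joined (H :|: F) e.
  move=> sF; rewrite Ee joined2; apply: contra cS.
  by apply: conn_closed sS; apply: in_edge_other => // f; apply: FS.
have -> : \sum_(F : {set {set V}} | F \subset env) W F *
      mean_mark p ph (fun t => QT (update t (H :|: F) e) (spread (update t (H :|: F) e) S)) =
    ph * (\sum_(F : {set {set V}} | F \subset env) W F *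
       QT (e |: (H :|: F)) (S :|: reach F [set c])) +
    (1 - ph) * (\sum_(F : {set {set V}} | F \subset env) W F * QT (H :|: F) S).
  rewrite !mulr_sumr -big_split /=; apply: eq_bigr => F sF.
  have D1 : (H :|: F) :\ e = H :|: F.
    by apply/setDidPl; rewrite disjoint_sym disjoints1 eF.
  rewrite /mean_mark /update D1 (negbTE (nj F sF)) sprS //.
  have sF' : simple_graph F.
    by apply: simple_sub sA; apply: subset_trans sF (avoid_sub _ _).
  rewrite Ee spread_merge // => [|f]; last exact: FS.
  by ring.
have sE : simple_graph env by apply: simple_sub sA; apply: avoid_sub.
have merge : \sum_(F : {set {set V}} | F \subset env) W F *
       QT (e |: (H :|: F)) (S :|: reach F [set c]) <= rho ^+ T * z * (potential H + 3 * gmax).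
  apply: le_trans (_ : \sum_(F : {set {set V}} | F \subset env)
     W F * (rho ^+ T * potential ((e |: H) :|: touch F (reach F [set c]))) <= _).
    apply: (@explore_le _ _ env [set c] _ _ sE) => F0 sF0; cbv zeta.
    set C := reach F0 _; set K := touch F0 C; set H' := (e |: H) :|: K.
    have s0 : simple_graph F0 by apply: simple_sub sE.
    have cH' : cover H' = S :|: C.
      by rewrite /H' Ee; apply: cover_merge => // f; apply: FS.
    have H'A : H' \subset A.
      rewrite !subUset sub1set eA HA /=; apply: subset_trans (subsetDl _ _) _.
      exact: subset_trans sF0 (avoid_sub _ _).
    have aE : avoid env C = avoid A (cover H') by rewrite avoid_avoid cH'.
    have ex F : F \subset avoid env C ->
        [/\ reach (K :|: F) [set c] = C, touch (K :|: F) C = K & W (K :|: F) = W K * W F].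
      move=> sF; have [E1 E2 _] := reach_explored sE sF0 sF; split=> //.
      exact: W_explored sE sF0 sF.
    have := IH H' H'A; rewrite -aE cH' => IH'.
    apply: le_trans (_ : W K * (\sum_(F : {set {set V}} | F \subset avoid env C)
        W F * QT (H' :|: F) (S :|: C)) <= _).
      rewrite mulr_sumr le_eqVlt; apply/orP; left; apply/eqP; apply: eq_bigr => F sF.
      have [-> _ ->] := ex F sF; rewrite -mulrA; congr (_ * (_ * QT _ _)).
      by rewrite /H' -!setUA.
    apply: le_trans (_ : W K * (rho ^+ T * potential H' *
       \sum_(F : {set {set V}} | F \subset avoid env C) W F) <= _).
      exact: ler_wpM2l.
    rewrite [rho ^+ T * potential H' * _]mulr_sumr mulr_sumr le_eqVlt.
    apply/orP; left; apply/eqP; apply: eq_bigr => F sF.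
    have [-> -> ->] := ex F sF; rewrite -/H'; ring.
  apply: le_trans (_ : \sum_(F : {set {set V}} | F \subset env)
     rho ^+ T * (W F * (potential H + gmax) + gmax * (W F * #|reach F [set c]|%:R)) <= _).
    apply: ler_sum => F sF; rewrite mulrCA; apply: ler_wpM2l => //.
    have := @potential_merge H F s c sS (simple_sub sF sE) (fun f => FS F f sF).
    rewrite -Ee => h; apply: le_trans (ler_wpM2l (Wp F) h) _.
    by rewrite le_eqVlt; apply/orP; left; apply/eqP; ring.
  rewrite -mulr_sumr -mulrA; apply: ler_wpM2l => //.
  rewrite big_split /= -mulr_suml -mulr_sumr -/z.
  have g1 : 0 <= gmax by apply: le_trans (g_max 0%N).
  have := mean2 c (avoid_sub A S : env \subset A); rewrite -/z => h.
  apply: le_trans (_ : z * (potential H + gmax) + gmax * (2 * z) <= _).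
    by rewrite lerD2l; apply: ler_wpM2l.
  by rewrite le_eqVlt; apply/orP; left; apply/eqP; ring.
have ph1 : 0 <= 1 - ph by rewrite subr_ge0; apply: le_trans php p1.
apply: le_trans (lerD (ler_wpM2l ph0 merge) (ler_wpM2l ph1 stay)) _.
by rewrite le_eqVlt; apply/orP; left; apply/eqP; ring.
Qed.

End Contraction.

(** * Drift of the potential *)

Section Drift.
Variables (R : realFieldType) (V : finType) (p ph : R).
Hypotheses (ph0 : 0 <= ph) (php : ph <= p) (p1 : p <= 1).
Implicit Types (F K H X Y : {set {set V}}) (S Z C M e : {set V}) (t : option bool).
Variables (G A : {set {set V}}) (D d : nat).
Hypotheses (G0 : G != set0) (sG : simple_graph G) (AG : A \subset G).
Hypothesis degA : forall v, (degree A v <= D)%N.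
Hypothesis dense : forall H, H \subset A -> (9 * #|H| <= 2 * D * #|cover H|)%N.
Hypothesis dD : (D <= 2 * d.+1)%N.

Variables (increment : nat -> R) (kap gmax : R).
Let g j : R := \sum_(i < j) increment i.
Hypotheses (al0 : forall i, 0 <= increment i) (g_max : forall j, g j <= gmax).
Hypothesis (gmax0 : 0 < gmax).
Hypothesis increment_low : forall j, (0 < j <= d)%N ->
  kap + D%:R * increment j <= (if j == 1%N then 1 - ph else j%:R * (1 - p)) * increment j.-1.
Hypothesis increment_high : forall j, (d < j)%N -> increment j = 0.
Hypotheses (kap0 : 0 <= kap) (small : D%:R * (ph * (3 * gmax)) <= kap / 18).

Let sA : simple_graph A. Proof. exact: simple_sub AG sG. Qed.

Lemma degreeD1 H e v : e \in H -> degree H v = ((v \in e) + degree (H :\ e) v)%N.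
Proof.
move=> eH; rewrite /degree (cardsD1 e [set f in H | v \in f]) !inE eH /=; congr (_ + _)%N.
by apply: eq_card => f; rewrite !inE andbA.
Qed.

Lemma potentialD1 H e : e \in H ->
  potential g H = potential g (H :\ e) + \sum_(v in e) increment (degree (H :\ e) v).
Proof.
move=> eH; rewrite /potential [X in _ + X]big_mkcond -big_split /=; apply: eq_bigr => v _.
rewrite (degreeD1 v eH); case: (v \in e); last by rewrite addr0.
by rewrite /g add1n big_ord_recr.
Qed.

Lemma degree_gt0 H v : (0 < degree H v)%N = (v \in cover H).
Proof.
rewrite card_gt0; apply/set0Pn/bigcupP => [[e]|[e eH ve]]; last by exists e; rewrite inE eH.
by rewrite inE => /andP[]; exists e.
Qed.

Let edge_effect H e v : R :=
  if e \in H then - ((if joined (H :\ e) e then 1 - p else 1 - ph) * increment (degree H v).-1)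
  else increment (degree H v) + ph * (3 * gmax).

Let cst0 : 0 <= ph * (3 * gmax). Proof. by rewrite !mulr_ge0 // ltW. Qed.

(** Distributes the effect of an update over the marked ends of the edge. An edge leaving the
    marked set is charged to its marked end. *)
Lemma potential_bound_le H e : H \subset A -> e \in A ->
  potential_bound p ph A g gmax H e - potential g H <= \sum_(v in cover H | v \in e) edge_effect H e v.
Proof.
move=> HA eA; rewrite /potential_bound eA.
have ce := simpleP sA eA.
case: ifPn => eS.
  have -> : \sum_(v in cover H | v \in e) edge_effect H e v = \sum_(v in e) edge_effect H e v.
    by apply: eq_bigl => v; apply: andb_idl; apply: (subsetP eS).
  have [eH|eH] := boolP (e \in H).
    rewrite /edge_effect eH (eq_bigr (fun v => (if joined (H :\ e) e then 1 - p else 1 - ph) *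
      - increment (degree (H :\ e) v))); last first.
      by move=> v ve; rewrite (degreeD1 v eH) ve /= mulrN.
    have eU : e |: H = H by apply/setUidPr; rewrite sub1set.
    rewrite -mulr_sumr sumrN /mean_mark /update eU le_eqVlt.
    apply/orP; left; apply/eqP.
    by case: (joined _ _); rewrite (potentialD1 eH); ring.
  have D1 : H :\ e = H by apply/setDidPl; rewrite disjoint_sym disjoints1.
  have PU : potential g (e |: H) = potential g H + \sum_(v in e) increment (degree H v).
    by rewrite (potentialD1 (setU11 e H)) setU1K.
  have s0 : 0 <= \sum_(v in e) increment (degree H v) by apply: sumr_ge0.
  apply: le_trans (_ : \sum_(v in e) increment (degree H v) <= _); last first.
    by apply: ler_sum => v _; rewrite /edge_effect (negbTE eH) lerDl.
  have -> : \sum_(v in e) increment (degree H v) = potential g (e |: H) - potential g H.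
    by rewrite PU; ring.
  rewrite lerD2r -[X in _ <= X](mean_mark_cst p ph); apply: le_mean_mark => // t.
  by rewrite /update D1; case: ifP => _ //; rewrite PU lerDl.
have eH : e \notin H by apply: contra eS; apply: sub_cover.
case: ifPn => [dS|nS].
  rewrite subrr big_pred0 // => v; apply/negP=> /andP[vS ve].
  by rewrite (disjointFr dS ve) in vS.
have [v /andP[/= ve vS]] := pred0Pn nS.
rewrite addrAC subrr add0r (bigD1 v) ?vS //= /edge_effect (negbTE eH).
apply: le_trans (_ : increment (degree H v) + ph * (3 * gmax) <= _); first by rewrite lerDr.
by rewrite lerDl; apply: sumr_ge0 => u _; rewrite addr_ge0.
Qed.

(** A vertex of degree [j] loses each edge at rate at least [1 - p]. For [j = 1] its only edge
    is a cut-edge, lost at rate [1 - ph]; this is why the last increment may be smaller. *)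
Lemma vertex_drift H v : H \subset A -> v \in cover H ->
  \sum_(e in A | v \in e) edge_effect H e v <=
  D%:R * (ph * (3 * gmax)) - kap * (degree H v <= d)%N%:R.
Proof.
move=> HA vS; set j := degree H v.
have j0 : (0 < j)%N by rewrite degree_gt0.
have one : 0 <= 1 - p by rewrite subr_ge0.
rewrite (bigID (mem H)) /=.
have hH : \sum_(e in A | (v \in e) && (e \in H)) edge_effect H e v <=
    - ((if j == 1%N then 1 - ph else j%:R * (1 - p)) * increment j.-1).
  have cj : #|[pred e | [&& e \in A, v \in e & e \in H]]| = j.
    apply: eq_card => e; rewrite !inE andbA andbC; case eH: (e \in H) => //=.
    by rewrite (subsetP HA _ eH).
  case: eqP => [j1|_].
    have /cards1P[f Ef] : #|[set e in H | v \in e]| == 1%N by rewrite -j1.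
    have fP : f \in [set e in H | v \in e] by rewrite Ef set11.
    move: fP; rewrite inE => /andP[fH vf].
    have sf := simpleP sA (subsetP HA _ fH).
    rewrite (big_pred1 f) => [|e]; last first.
      rewrite /=; have := in_set1 e f; rewrite -Ef inE => <-.
      rewrite andbC -andbA; case eH: (e \in H); rewrite ?andbF //=.
      by rewrite (subsetP HA _ eH) andbT.
    rewrite /edge_effect fH -/j lerN2; apply: ler_wpM2r => //.
    case: ifPn => // jf; exfalso.
    have /eqP/cards2P[a [b [ab Efab]]] := sf.
    have iso c : [set v; c] \notin H :\ f.
      rewrite !inE negb_and negbK; case: eqVneq => //= nf.
      apply: contra nf => h; have : [set v; c] \in [set e in H | v \in e].
        by rewrite inE h set21.
      by rewrite Ef inE.
    have [u vu Ef'] : exists2 u, v != u & f = [set v; u].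
      move: vf; rewrite Efab !inE => /orP[]/eqP->; first by exists b.
      by exists a; rewrite 1?eq_sym // setUC.
    move: jf; rewrite Ef' joined2 -Ef' => vu'.
    suff : u \in [set v] by rewrite inE eq_sym (negbTE vu).
    apply: conn_closed vu'; last exact: set11.
    by move=> y z /set1P->; rewrite (negbTE (iso z)).
  apply: le_trans (_ : \sum_(e in A | (v \in e) && (e \in H)) - ((1 - p) * increment j.-1) <= _).
    apply: ler_sum => e /and3P[_ _ eH]; rewrite /edge_effect eH lerN2; apply: ler_wpM2r => //.
    by case: ifP => // _; rewrite lerB.
  by rewrite sumr_const cj -[X in X <= _]mulr_natl mulrN mulrA.
have hA : \sum_(e in A | (v \in e) && (e \notin H)) edge_effect H e v <=
    D%:R * (increment j + ph * (3 * gmax)).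
  apply: le_trans (_ : \sum_(e in A | (v \in e) && (e \notin H)) (increment j + ph * (3 * gmax)) <= _).
    by apply: ler_sum => e /and3P[_ _ eH]; rewrite /edge_effect (negbTE eH).
  rewrite sumr_const -[X in X <= _]mulr_natl; apply: ler_wpM2r; first by rewrite addr_ge0.
  rewrite ler_nat; apply: leq_trans (degA v); apply: subset_leq_card.
  by apply/subsetP=> e; rewrite !inE => /and3P[-> ->].
rewrite (eq_bigl (fun e => [&& e \in A, v \in e & e \in H])); last first.
  by move=> e; rewrite -andbA.
rewrite [X in _ + X](eq_bigl (fun e => [&& e \in A, v \in e & e \notin H])); last first.
  by move=> e; rewrite -andbA.
apply: le_trans (lerD hH hA) _; rewrite [D%:R * (_ + _)]mulrDr.
set l := _ * increment j.-1; set c := D%:R * (ph * _).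
case: (leqP j d) => jd.
  have := @increment_low j; rewrite j0 jd -/l mulr1 => /(_ isT) h; lra.
rewrite increment_high // !mulr0 subr0 add0r gerDr oppr_le0 mulr_ge0 //.
case: ifP => _; last by rewrite mulr_ge0 ?ler0n.
by rewrite subr_ge0 (le_trans php).
Qed.

Lemma sum_degree H : simple_graph H -> (\sum_v degree H v = 2 * #|H|)%N.
Proof.
move=> sH; rewrite mulnC -sum_nat_const.
rewrite (eq_bigr (fun v => \sum_(e in H) (v \in e))%N); last first.
  move=> v _; rewrite /degree -sum1_card big_mkcond [RHS]big_mkcond /=.
  by apply: eq_bigr => e _; rewrite inE; case: (e \in H); case: (v \in e).
rewrite exchange_big; apply: eq_bigr => e eH /=.
by rewrite -(simpleP sH eH) -sum1_card [RHS]big_mkcond.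
Qed.

(** Since the average degree inside [cover H] is at most [4 D / 9], a positive
    fraction of its vertices have degree less than [D / 2]. *)
Lemma many_low H : H \subset A ->
  (#|cover H| <= 9 * #|[set v in cover H | (degree H v <= d)%N]|)%N.
Proof.
move=> HA; have h := dense HA.
set S := cover H; set L := [set v in S | _].
have sL : L \subset S by apply/subsetP=> v; rewrite inE => /andP[].
have hi : (d.+1 * #|S :\: L| <= 2 * #|H|)%N.
  rewrite -sum_degree ?(simple_sub HA) // mulnC -sum_nat_const.
  apply: leq_trans (_ : \sum_(v in S :\: L) degree H v <= _)%N.
    apply: leq_sum => v; rewrite in_setD => /andP[+ vS].
    by rewrite inE vS /= -ltnNge.
  by rewrite [X in (_ <= X)%N](bigID (mem (S :\: L))) leq_addr.
have cS : #|S| = (#|L| + #|S :\: L|)%N.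
  by rewrite -(cardsID L S) (setIidPr sL).
have : (9 * (D * #|S :\: L|) <= 8 * (D * #|S|))%N.
  apply: (@leq_trans (9 * (2 * (d.+1 * #|S :\: L|)))).
    by rewrite leq_mul2l /= mulnA leq_mul2r dD orbT.
  move: hi h; rewrite -/S; move: (d.+1 * _)%N #|H| #|S| => a b c; clear; nia.
case: (posnP D) => [D0 _|Dp]; last first.
  rewrite !(mulnCA _ D) leq_pmul2l // cS.
  by move: #|L| #|S :\: L| => a b; clear; lia.
have : #|H| = 0%N by move: h; rewrite D0 muln0 mul0n leqn0 muln_eq0 => /eqP.
by move/cards0_eq => H0; rewrite /S H0 /cover big_set0 cards0.
Qed.

Lemma potential_le H : potential g H <= gmax * #|cover H|%:R.
Proof.
rewrite /potential (bigID (mem (cover H))) /= [X in _ + X]big1 ?addr0; last first.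
  move=> v; rewrite -degree_gt0 lt0n negbK => /eqP->; by rewrite /g big_ord0.
apply: le_trans (ler_sum _ (fun v _ => g_max _)) _.
by rewrite sumr_const -[X in X <= _]mulr_natr.
Qed.

(** The low-degree vertices, at least one ninth of all, lose [kap] each; the growth takes
    back at most half of this, and the potential is at most [gmax] per vertex. *)
Lemma drift_bound H : H \subset A ->
  mean_edge G (potential_bound p ph A g gmax H) <= (1 - kap / (18 * gmax) / #|G|%:R) * potential g H.
Proof.
move=> HA; set S := cover H.
have m0 : (0 : R) < #|G|%:R by rewrite ltr0n card_gt0.
have step1 : \sum_(e in G) (potential_bound p ph A g gmax H e - potential g H) <=
    \sum_(v in S) (D%:R * (ph * (3 * gmax)) - kap * (degree H v <= d)%N%:R).
  rewrite (bigID (mem A)) /= [X in _ + X]big1 ?addr0; last first.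
    by move=> e /andP[_ eA]; rewrite /potential_bound (negbTE eA) subrr.
  rewrite (eq_bigl (mem A)); last by move=> e; apply: andb_idl; apply: (subsetP AG).
  apply: le_trans (ler_sum _ (fun e eA => potential_bound_le HA eA)) _.
  rewrite (exchange_big_dep (mem S)) /=; last by move=> e v _ /andP[].
  apply: ler_sum => v vS; apply: le_trans (vertex_drift HA vS).
  by rewrite le_eqVlt; apply/orP; left; apply/eqP; apply: eq_bigl => e; rewrite vS.
have step2 : \sum_(v in S) (D%:R * (ph * (3 * gmax)) - kap * (degree H v <= d)%N%:R) <=
    - (kap / 18) * #|S|%:R.
  rewrite sumrB sumr_const -mulr_sumr.
  have -> : \sum_(v in S) ((degree H v <= d)%N%:R : R) =
      #|[set v in S | (degree H v <= d)%N]|%:R.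
    rewrite -natr_sum -sum1_card big_mkcond [in RHS]big_mkcond /=; congr (_%:R).
    by apply: eq_bigr => v _; rewrite inE; case: (v \in S); case: (_ <= _)%N.
  have := many_low HA; rewrite -/S -(ler_nat R) natrM.
  set L := (#|[set v in S | _]|)%:R; set s := #|S|%:R => sL.
  rewrite -[_ *+ _]mulr_natr -/s.
  have s0 : 0 <= s by rewrite ler0n.
  have k1 : kap * (s / 9) <= kap * L by apply: ler_wpM2l => //; lra.
  have k2 := ler_wpM2r s0 small.
  by lra.
have step3 : - (kap / 18) * #|S|%:R <= - (kap / (18 * gmax)) * potential g H.
  rewrite !mulNr lerN2.
  apply: le_trans (ler_wpM2l _ (potential_le H)) _; first by rewrite divr_ge0 // mulr_ge0 // ltW.
  rewrite le_eqVlt; apply/orP; left; apply/eqP; rewrite -/S; field.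
  by rewrite gt_eqF.
have := le_trans step1 (le_trans step2 step3).
rewrite sumrB sumr_const -[potential g H *+ _]mulr_natl lerBlDr => h.
have mn : (#|G|%:R : R) != 0 by rewrite gt_eqF.
rewrite /mean_edge -[X in _ <= X](mulKf mn).
apply: ler_wpM2l; first by rewrite invr_ge0 ltW.
apply: le_trans h _; rewrite le_eqVlt; apply/orP; left; apply/eqP; field.
by rewrite mn gt_eqF.
Qed.

End Drift.

(** * From local contraction to total variation *)

Section Iterates.
Variables (R : realFieldType) (V : finType) (w q p ph : R).
Hypotheses (w0 : 0 < w) (q1 : 1 <= q).
Hypotheses (pE : p * (1 + w) = w) (phE : ph * (q + w) = w).
Hypotheses (ph0 : 0 <= ph) (php : ph <= p) (p1 : p <= 1).
Implicit Types (F K H X Y A : {set {set V}}) (S Z C M e : {set V}) (t : option bool).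
Implicit Types (f : {set {set V}} -> R).
Variables (G : {set {set V}}).
Hypotheses (G0 : G != set0) (sG : simple_graph G).
Notation W := (@W R V w q).
Notation P := (@transition R V p ph G).

Lemma iter_transition_le A f f' T F : (forall F, F \subset A -> f F <= f' F) ->
  F \subset A -> iter T (P A) f F <= iter T (P A) f' F.
Proof.
move=> h; elim: T F => [|T IH] F sF /=; first exact: h.
by apply: le_mean_edge => e _; apply: le_mean_mark => // t; apply: IH; apply: update_in_sub.
Qed.

Lemma eq_iter_transition A f f' T F : f =1 f' -> iter T (P A) f F = iter T (P A) f' F.
Proof.
move=> h; elim: T F => [//|T IH] F /=.
by apply: eq_mean_edge => e _; apply: eq_mean_mark => t.
Qed.

Lemma iter_transitionD A f f' T F :
  iter T (P A) (fun F => f F + f' F) F = iter T (P A) f F + iter T (P A) f' F.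
Proof.
elim: T F => [//|T IH] F /=; rewrite /transition /mean_edge -mulrDr -big_split /=; congr (_ * _).
by apply: eq_bigr => e _; rewrite /mean_mark !IH; ring.
Qed.

Lemma iter_transitionZ A c f T F : iter T (P A) (fun F => c * f F) F = c * iter T (P A) f F.
Proof.
elim: T F => [//|T IH] F /=; rewrite /transition /mean_edge mulrCA [c * _ in RHS]mulr_sumr; congr (_ * _).
by apply: eq_bigr => e _; rewrite /mean_mark !IH; ring.
Qed.

Lemma iter_transition_sum A (I : Type) (r : seq I) (Pr : pred I) (h : I -> {set {set V}} -> R) T F :
  iter T (P A) (fun F => \sum_(i <- r | Pr i) h i F) F = \sum_(i <- r | Pr i) iter T (P A) (h i) F.
Proof.
elim: T F => [//|T IH] F /=.
rewrite /transition /mean_edge -[RHS]mulr_sumr; congr (_ * _).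
rewrite [RHS]exchange_big /=; apply: eq_bigr => e _.
by rewrite /mean_mark !IH !mulr_sumr -!big_split.
Qed.

Lemma iter_transition_cst A c T F : iter T (P A) (fun=> c) F = c.
Proof.
elim: T F => [//|T IH] F /=; rewrite /transition -[RHS](@mean_edge_cst R V G c G0).
by apply: eq_mean_edge => e _; rewrite /mean_mark !IH; ring.
Qed.

Lemma iter_transition_stationary A f T : simple_graph A ->
  \sum_(F : {set {set V}} | F \subset A) W F * iter T (P A) f F =
  \sum_(F : {set {set V}} | F \subset A) W F * f F.
Proof.
move=> sA; elim: T => [//|T IH]; rewrite -IH iterS.
exact: (transition_stationary q1 pE phE).
Qed.

Lemma sumW_gt0 A : 0 < \sum_(F : {set {set V}} | F \subset A) W F.
Proof.
rewrite (bigD1 set0) ?sub0set //= W_set0; apply: ltr_wpDr => //.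
by apply: sumr_ge0 => F _; apply: W_ge0.
Qed.

(** Averages, over a stationary start [Y], the comparison of [Y] with the empty start through
    the contagion that initially marks every vertex covered by [Y]. *)
Lemma local_mixing A (g : nat -> R) gmax rho T e0 : A \subset G ->
  {homo g : i j / (i <= j)%N >-> i <= j} -> g 0%N = 0 -> 1 <= g 1%N ->
  (forall i, g i <= gmax) -> 0 <= rho ->
  (forall (B : {set {set V}}) v, B \subset A ->
    \sum_(F : {set {set V}} | F \subset B) W F * #|reach F [set v]|%:R <=
    2 * \sum_(F : {set {set V}} | F \subset B) W F) ->
  (forall H, H \subset A -> mean_edge G (potential_bound p ph A g gmax H) <= rho * potential g H) ->
  \sum_(F : {set {set V}} | F \subset A) W F * (e0 \in F)%:R <=
  (iter T (P A) (fun F => (e0 \in F)%:R) set0 + rho ^+ T * (gmax * #|V|%:R)) *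
  \sum_(F : {set {set V}} | F \subset A) W F.
Proof.
move=> AG gm g0 g1 gM rho0 mean2 dr.
have sA : simple_graph A by apply: simple_sub AG sG.
set f := fun F => (e0 \in F)%:R.
have gge0 i : 0 <= g i by rewrite -g0 gm.
have base X Y M : inv_coupling A X Y M -> f Y - f X <= marked_potential g Y M.
  case=> XY YA D; have Qge : 0 <= marked_potential g Y M by apply: sumr_ge0.
  rewrite /f; case: (boolP (e0 \in Y)) => eY; last first.
    by rewrite sub0r (le_trans _ Qge) // oppr_le0 ler0n.
  case: (boolP (e0 \in X)) => eX; first by rewrite subrr.
  have eD : e0 \in Y :\: X by rewrite in_setD eX.
  have [v ve] : exists v, v \in e0.
    by apply/set0Pn; rewrite -card_gt0 (simpleP sA (subsetP YA _ eY)).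
  have vM : v \in M by apply: (subsetP (D _ eD)).
  rewrite subr0 /marked_potential (bigD1 v) //=; apply: ler_wpDr; first exact: sumr_ge0.
  apply: le_trans g1 _; apply: gm; rewrite degree_gt0.
  by apply/bigcupP; exists e0.
rewrite -(iter_transition_stationary f T sA) mulr_sumr; apply: ler_sum => Y YA.
rewrite mulrC; apply: ler_wpM2r; first exact: W_ge0.
have I : inv_coupling A set0 Y (cover Y).
  by split; rewrite ?sub0set // => e; rewrite setD0; apply: sub_cover.
have := coupling_bound ph0 php p1 G T sA base I; rewrite lerBlDl => /le_trans; apply.
rewrite lerD2l.
have := contagion_contracts w0 q1 pE phE ph0 php p1 sG AG gm g0 gM rho0 mean2 dr T YA.
set Z := \sum_(F : {set {set V}} | _) W F => h.
have Z0 : 0 < Z by apply: sumW_gt0.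
rewrite -(ler_pM2r Z0); apply: le_trans (_ : _ <= rho ^+ T * potential g Y * Z) _; last first.
  apply: ler_wpM2r; first exact: ltW.
  apply: ler_wpM2l; first exact: exprn_ge0.
  by rewrite mulr_natr -sumr_const; apply: ler_sum => v _.
apply: le_trans h; rewrite mulrC mulr_suml; apply: ler_sum => F sF.
apply: ler_wpM2l; first exact: W_ge0.
have Qm : mono_pair (iter T (contagion p ph G A) (marked_potential g)).
  by apply: contagion_mono => //; apply: marked_potential_mono.
by apply: Qm => //; apply: subsetUl.
Qed.

Section Phase.
Variable Om : pred {set {set V}}.
Hypothesis Om_sub : forall F F', F \subset F' -> F' \subset G -> Om F' -> Om F.
Hypothesis Om0 : Om set0.
Notation o F := ((Om F)%:R : R).

Definition phase_mass : R := \sum_(F : {set {set V}} | F \subset G) W F * o F.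

Lemma phase_mass_ge1 : 1 <= phase_mass.
Proof.
rewrite /phase_mass (bigD1 set0) ?sub0set //= W_set0 Om0 mul1r lerDl.
by apply: sumr_ge0 => F _; rewrite mulr_ge0 ?W_ge0.
Qed.

(** Given the explored edges [K], the phase constraint is a decreasing event for the others,
    so by FKG it can only lower the probability of [e0]; so does the restriction to [A']. *)
Lemma phase_lowers_edge A' A K e0 : simple_graph A -> A' \subset A -> K :|: A' \subset G ->
  (\sum_(F : {set {set V}} | F \subset A') W F * ((e0 \in F)%:R * o (K :|: F))) *
    (\sum_(F : {set {set V}} | F \subset A) W F) <=
  (\sum_(F : {set {set V}} | F \subset A') W F * o (K :|: F)) *
    (\sum_(F : {set {set V}} | F \subset A) W F * (e0 \in F)%:R).
Proof.
move=> sA sA' sKG; have sA1 : simple_graph A' by apply: simple_sub sA' sA.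
have fi (B : {set {set V}}) : increasing B (fun F => (e0 \in F)%:R : R).
  move=> F F' sF _; rewrite ler_nat; case: (boolP (e0 \in F)) => // eF.
  by rewrite (subsetP sF).
have gi : increasing A' (fun F => - o (K :|: F)).
  move=> F F' sF sF'; rewrite lerN2 ler_nat.
  case: (boolP (Om (K :|: F'))) => // h; rewrite (Om_sub _ _ h) ?setUS //.
  by apply: subset_trans sKG; apply: setUS.
have h1 := @fkg R _ A' W _ _ (fun F _ => W_gt0 w0 q1 F)
  (fun F F' e sF sF' eA eF' => W_log_supermodular w0 q1 sA1 sF sF' eA eF') (fi A') gi.
have h2 := fkg_shrink w0 q1 sA sA' (fi A).
have eN : \sum_(F : {set {set V}} | F \subset A') W F * ((e0 \in F)%:R * - o (K :|: F)) =
   - \sum_(F : {set {set V}} | F \subset A') W F * ((e0 \in F)%:R * o (K :|: F)).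
  by rewrite -sumrN; apply: eq_bigr => F _; rewrite !mulrN.
have eO : \sum_(F : {set {set V}} | F \subset A') W F * (- o (K :|: F)) =
   - \sum_(F : {set {set V}} | F \subset A') W F * o (K :|: F).
  by rewrite -sumrN; apply: eq_bigr => F _; rewrite !mulrN.
rewrite eN eO !mulrN lerN2 in h1.
have Z1 := sumW_gt0 A'; rewrite -(ler_pM2l Z1) mulrA.
apply: le_trans (ler_wpM2r (ltW (sumW_gt0 A)) h1) _.
rewrite mulrAC; apply: le_trans (ler_wpM2r _ h2) _.
  by apply: sumr_ge0 => F _; rewrite mulr_ge0 ?W_ge0.
by rewrite -mulrA [X in _ * X <= _]mulrC.
Qed.

(** Explore the components that leave [B]. Either the component of [v] is one of them, hence
    it is large, or [e0] belongs to the unexplored part, where [phase_lowers_edge]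
    applies. *)
Lemma weak_spatial_mixing (B : {set V}) v r e0 : e0 \in G -> v \in e0 ->
  (forall F, F \subset G -> (#|reach F [set v]| <= r)%N -> reach F [set v] \subset B) ->
  let A := avoid G (~: B) in
  \sum_(F : {set {set V}} | F \subset G) W F * (o F * (e0 \in F)%:R) <=
  \sum_(F : {set {set V}} | F \subset G) W F * o F * (r < #|reach F [set v]|)%N%:R +
  (\sum_(F : {set {set V}} | F \subset A) W F * (e0 \in F)%:R) /
  (\sum_(F : {set {set V}} | F \subset A) W F) * phase_mass.
Proof.
move=> eG ve ball; cbv zeta; set A := avoid G (~: B).
have sA : simple_graph A by apply: simple_sub sG; apply: avoid_sub.
set pi := _ / _.
apply: le_trans (_ : \sum_(F : {set {set V}} | F \subset G)
   (W F * o F * (r < #|reach F [set v]|)%N%:R +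
    W F * (o F * (e0 \in avoid F (reach F (~: B)))%:R)) <= _).
  apply: ler_sum => F sF; rewrite -mulrA -mulrDr; apply: ler_wpM2l; first exact: W_ge0.
  rewrite -mulrDr; apply: ler_wpM2l => //; rewrite inE.
  case: (boolP (e0 \in F)) => eF; last by rewrite addr_ge0.
  case: ltnP => hC /=; first by rewrite lerDl.
  suff -> : [disjoint e0 & reach F (~: B)] by rewrite add0r.
  have sF' : simple_graph F by apply: simple_sub sG.
  have vC : v \in reach F [set v] by apply: (subsetP (sub_reach _ _)); rewrite set11.
  have eC : e0 \subset reach F [set v].
    apply: edge_closed eF _ => // [x y|]; first exact: reach_closed.
    by apply/pred0Pn; exists v; rewrite /= ve.
  apply/pred0P=> u /=; apply/negP=> /andP[/(subsetP eC)/reachP[v' /set1P-> vu] /reachP[z zB zu]].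
  have : z \in reach F [set v].
    apply/reachP; exists v; rewrite ?set11 //; apply: connect_trans vu _.
    by rewrite -/(conn F u z) conn_sym.
  by move/(subsetP (ball F sF hC)); move: zB; rewrite inE => /negbTE->.
rewrite big_split /= lerD2l /phase_mass mulr_sumr.
apply: (@explore_le _ _ G (~: B) _ _ sG) => F0 sF0; cbv zeta.
set C := reach F0 _; set K := touch F0 C.
have sA' : avoid G C \subset A by apply: avoid_mono => //; apply: sub_reach.
have KG : K \subset G by apply: subset_trans (subsetDl _ _) sF0.
have sKG : K :|: avoid G C \subset G by rewrite subUset KG avoid_sub.
have ex F : F \subset avoid G C ->
    [/\ avoid (K :|: F) (reach (K :|: F) (~: B)) = F & W (K :|: F) = W K * W F].
  move=> sF; have [E1 _ E3] := reach_explored sG sF0 sF; split; first by rewrite E1.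
  exact: W_explored sG sF0 sF.
have ZA := sumW_gt0 A.
apply: le_trans (_ : W K * \sum_(F : {set {set V}} | F \subset avoid G C)
    W F * ((e0 \in F)%:R * o (K :|: F)) <= _).
  rewrite mulr_sumr; apply: ler_sum => F sF; have [-> ->] := ex F sF.
  by rewrite -mulrA [(Om _)%:R * _]mulrC.
apply: le_trans (_ : W K * (pi * \sum_(F : {set {set V}} | F \subset avoid G C)
    W F * o (K :|: F)) <= _); last first.
  rewrite [pi * _]mulr_sumr mulr_sumr; apply: ler_sum => F sF; have [_ ->] := ex F sF.
  by rewrite le_eqVlt; apply/orP; left; apply/eqP; ring.
apply: ler_wpM2l; first exact: W_ge0.
rewrite /pi mulrAC ler_pdivlMr // [X in _ <= X]mulrC; exact: phase_lowers_edge.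
Qed.

Definition exit_state F := Om F && [exists e in G, ~~ Om (e |: F)].

(** The law at any time of the chain started from the phase is at most the Gibbs measure
    divided by the mass of the phase, so the exit states never become more likely than they
    are in the phase. *)
Lemma exit_bound T :
  \sum_(F : {set {set V}} | F \subset G) W F * (o F * iter T (P G) (fun F => 1 - o F) F)
  <= T%:R * \sum_(F : {set {set V}} | F \subset G) W F * (exit_state F)%:R.
Proof.
elim: T => [|T IH].
  rewrite mul0r big1 // => F _ /=; case: (Om F); rewrite ?subrr ?mulr0 ?mul0r //.
  by rewrite mulr0.
have step F : F \subset G -> P G (fun F => 1 - o F) F <= (1 - o F) + (exit_state F)%:R.
  move=> sF; rewrite -[X in _ <= X](@mean_edge_cst R V G _ G0); apply: le_mean_edge => e eG.
  rewrite -[X in _ <= X](mean_mark_cst p ph); apply: le_mean_mark => // t.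
  case OF: (Om F); last first.
    by rewrite subr0; apply: (@le_trans _ _ 1); [rewrite gerBl | rewrite lerDl].
  rewrite subrr add0r /exit_state OF /=.
  case: (boolP (Om (update_in G t F e))) => h; first by rewrite subrr.
  have : Om (e |: F) = false.
    apply/negbTE; apply: contra h; apply: Om_sub.
      rewrite /update_in eG /update; case: ifP => _ //.
      by apply: subset_trans (subsetDl _ _) (subsetUr _ _).
    by rewrite subUset sub1set eG.
  move=> he; have -> : [exists e in G, ~~ Om (e |: F)] by apply/exists_inP; exists e; rewrite ?he.
  by rewrite subr0.
apply: le_trans (_ : \sum_(F : {set {set V}} | F \subset G) (
    W F * (o F * iter T (P G) (fun F => 1 - o F) F) +
    W F * iter T (P G) (fun F => (exit_state F)%:R) F) <= _).
  apply: ler_sum => F sF; rewrite -mulrDr; apply: ler_wpM2l; first exact: W_ge0.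
  have h := iter_transition_le T step sF; rewrite iter_transitionD -iterSr in h.
  have pos : 0 <= iter T (P G) (fun F => (exit_state F)%:R) F.
    rewrite -(iter_transition_cst G 0 T F); apply: iter_transition_le => // F' _; exact: ler0n.
  case: (Om F); last by rewrite !mul0r add0r.
  by rewrite !mul1r.
rewrite big_split /= iter_transition_stationary // -natr1 mulrDl mul1r.
by rewrite lerD2r.
Qed.

(** The chain started from the phase loses mass [eps] at most. The chain started from the
    empty configuration stays below it, so that the two differ with probability at most the
    expected difference of their numbers of edges. *)
Lemma tv_bound T eps :
  \sum_(F : {set {set V}} | F \subset G) W F * (o F * iter T (P G) (fun F => 1 - o F) F)
    <= eps * phase_mass ->
  2^-1 * \sum_(F : {set {set V}} | F \subset G)
    `|iter T (P G) (fun X => (X == F)%:R) set0 - W F * o F / phase_mass| <=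
  eps + \sum_(e in G)
    ((\sum_(F : {set {set V}} | F \subset G) W F * (o F * (e \in F)%:R)) / phase_mass + eps -
     iter T (P G) (fun F => (e \in F)%:R) set0).
Proof.
move=> heps; have Z0 : 0 < phase_mass by apply: lt_le_trans phase_mass_ge1.
pose nu f := iter T (P G) f set0.
pose mu f := (\sum_(F : {set {set V}} | F \subset G) W F * (o F * iter T (P G) f F)) / phase_mass.
pose pd F := W F * o F / phase_mass.
pose d F : {set {set V}} -> R := fun X => (X == F)%:R.
have muD f f' : mu (fun F => f F + f' F) = mu f + mu f'.
  rewrite /mu -mulrDl -big_split /=; congr (_ / _).
  by apply: eq_bigr => F _; rewrite iter_transitionD; ring.
have muZ c f : mu (fun F => c * f F) = c * mu f.
  rewrite /mu mulrA mulr_sumr; congr (_ / _).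
  by apply: eq_bigr => F _; rewrite iter_transitionZ; ring.
have mu_le f f' : (forall F, F \subset G -> f F <= f' F) -> mu f <= mu f'.
  move=> h; rewrite /mu ler_pM2r ?invr_gt0 //; apply: ler_sum => F sF.
  apply: ler_wpM2l; first exact: W_ge0.
  by apply: ler_wpM2l => //; apply: iter_transition_le.
have mu_stat f : (forall F, 0 <= f F) -> mu f <= (\sum_(F : {set {set V}} | F \subset G) W F * f F) / phase_mass.
  move=> f0; rewrite /mu ler_pM2r ?invr_gt0 // -(iter_transition_stationary f T sG).
  apply: ler_sum => F sF; apply: ler_wpM2l; first exact: W_ge0.
  have pos : 0 <= iter T (P G) f F.
    by rewrite -(iter_transition_cst G 0 T F); apply: iter_transition_le.
  by case: (Om F); rewrite ?mul1r // mul0r.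
have mu_cst c : mu (fun=> c) = c.
  rewrite /mu; under eq_bigr => F _ do rewrite iter_transition_cst mulrA.
  by rewrite -mulr_suml -/phase_mass mulrAC divff ?mul1r // gt_eqF.
have mu_eps : mu (fun F => 1 - o F) <= eps by rewrite /mu ler_pdivrMr.
have ext (L : ({set {set V}} -> R) -> R) f :
    (L = nu \/ L = mu) -> L f = \sum_(F : {set {set V}} | F \subset G) f F * L (d F).
  have dec F : F \subset G -> \sum_(F' : {set {set V}} | F' \subset G) f F' * d F' F = f F.
    move=> sF; rewrite (bigD1 F) //= /d eqxx mulr1 big1 ?addr0 // => F' /andP[_ n].
    by rewrite eq_sym (negbTE n) mulr0.
  have it F : F \subset G -> iter T (P G) f F =
      \sum_(F' : {set {set V}} | F' \subset G) f F' * iter T (P G) (d F') F.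
    move=> sF; under [RHS]eq_bigr => F' _ do rewrite -iter_transitionZ.
    rewrite -iter_transition_sum; apply/eqP; rewrite eq_le; apply/andP; split;
      by apply: iter_transition_le => // F1 s1; rewrite dec.
  case=> ->; first by rewrite /nu it ?sub0set.
  rewrite /mu; under [RHS]eq_bigr => F' _ do rewrite mulrA mulr_sumr.
  rewrite -mulr_suml exchange_big /=; congr (_ / _); apply: eq_bigr => F sF.
  by rewrite it // !mulr_sumr; apply: eq_bigr => F' _; ring.
have tri : 2^-1 * \sum_(F : {set {set V}} | F \subset G) `|nu (d F) - pd F| <=
   2^-1 * \sum_(F : {set {set V}} | F \subset G) `|nu (d F) - mu (d F)| +
   2^-1 * \sum_(F : {set {set V}} | F \subset G) `|mu (d F) - pd F|.
  rewrite -mulrDr -big_split /=; apply: ler_wpM2l; first by rewrite invr_ge0.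
  by apply: ler_sum => F _; apply: ler_distD.
apply: le_trans tri _; rewrite addrC; apply: lerD.
  (* on the phase the law is at most the conditioned measure, so mass is lost only by exits *)
  have pd1 : \sum_(F : {set {set V}} | F \subset G) pd F = 1.
    by rewrite -mulr_suml divff // gt_eqF.
  have mu1 : \sum_(F : {set {set V}} | F \subset G) mu (d F) = 1.
    rewrite -[RHS](mu_cst 1) (ext mu (fun=> 1)); last by right.
    by apply: eq_bigr => F _; rewrite mul1r.
  have muo : \sum_(F : {set {set V}} | F \subset G) (1 - o F) * mu (d F) <= eps.
    by rewrite -(ext mu (fun F => 1 - o F)) //; right.
  have mu0 F : 0 <= mu (d F) by rewrite -(mu_cst 0); apply: mu_le => F' _; apply: ler0n.
  have pw F : F \subset G -> `|mu (d F) - pd F| <= pd F - mu (d F) + 2 * ((1 - o F) * mu (d F)).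
    move=> sF; case OF: (Om F).
      rewrite subrr mul0r mulr0 addr0 distrC ger0_norm // subr_ge0.
      apply: le_trans (mu_stat (d F) (fun F' => ler0n _ _)) _; rewrite /pd OF.
      rewrite ler_pM2r ?invr_gt0 // (bigD1 F) //= /d eqxx big1 ?addr0 // => F' /andP[_ n].
      by rewrite (negbTE n) mulr0.
    rewrite /pd OF mulr0 mul0r subr0 sub0r ger0_norm // subr0 mul1r; lra.
  apply: le_trans (ler_wpM2l _ (ler_sum _ pw)) _; first by rewrite invr_ge0.
  rewrite big_split sumrB /= pd1 mu1 -mulr_sumr; lra.
(* [k] is monotone because adding an edge changes the sign [s] by at most [2]; comparing its
   means under the two ordered chains replaces a coupling *)
pose s F : R := if mu (d F) <= nu (d F) then 1 else -1.
pose c F : R := #|F :&: G|%:R.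
pose k F := s F + 2 * c F.
have kS F : F \subset G -> `|nu (d F) - mu (d F)| = s F * nu (d F) - s F * mu (d F).
  move=> sF; rewrite -mulrBr /s; case: ifP => [h|/negbT].
    by rewrite mul1r ger0_norm // subr_ge0.
  by rewrite -ltNge => h; rewrite mulN1r ltr0_norm // subr_lt0.
have km X Y : X \subset Y -> Y \subset G -> k X <= k Y.
  move=> XY YG; have [->//|nXY] := eqVneq X Y.
  have : (#|X :&: G| < #|Y :&: G|)%N.
    rewrite !(setIidPl _) //; last exact: subset_trans YG.
    by apply: proper_card; rewrite properEneq nXY.
  rewrite /k /c -(ler_nat R) -natr1 => h.
  by rewrite /s; case: ifP => _; case: ifP => _; lra.
have kiter Y : Y \subset G -> iter T (P G) k set0 <= iter T (P G) k Y.
  move=> YG; have I : inv_coupling G set0 Y setT by split; rewrite ?sub0set // => e _; apply: subsetT.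
  have zero T' Y' M : iter T' (contagion p ph G G) (fun _ _ => 0) Y' M = 0.
    elim: T' Y' M => [//|T' IH] Y' M /=; rewrite /contagion -[RHS](@mean_edge_cst R V G 0 G0).
    by apply: eq_mean_edge => e _; rewrite /mean_mark !IH; ring.
  have := @coupling_bound _ _ _ _ ph0 php p1 G G (fun F => - k F) (fun _ _ => 0) T _ _ _ sG _ I.
  rewrite zero => h; have {}h : _ <= 0 := h _.
  have N F : iter T (P G) (fun F => - k F) F = - iter T (P G) k F.
    by rewrite -mulN1r -iter_transitionZ; apply: eq_iter_transition => F'; rewrite mulN1r.
  rewrite !N opprK addrC subr_le0 in h; apply: h => X' Y' M' [XY' YG' _].
  by rewrite opprK addrC subr_le0 km.
have nuk : nu k <= mu k.
  rewrite -[nu k](mu_cst) /mu ler_pM2r ?invr_gt0 //; apply: ler_sum => F sF.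
  rewrite iter_transition_cst; apply: ler_wpM2l; first exact: W_ge0.
  by apply: ler_wpM2l => //; apply: kiter.
have nuD f f' : nu (fun F => f F + f' F) = nu f + nu f' by apply: iter_transitionD.
have nuZ a f : nu (fun F => a * f F) = a * nu f by apply: iter_transitionZ.
have sdiff : nu s - mu s <= 2 * (mu c - nu c).
  by move: nuk; rewrite /k nuD muD nuZ muZ; lra.
have -> : \sum_(F : {set {set V}} | F \subset G) `|nu (d F) - mu (d F)| = nu s - mu s.
  rewrite (ext nu s) ?(ext mu s); [|by right|by left].
  by rewrite -sumrB; apply: eq_bigr.
apply: le_trans (_ : mu c - nu c <= _); first by lra.
have cE F : c F = \sum_(e in G) (e \in F)%:R.
  rewrite /c -sum1_card natr_sum big_mkcond [RHS]big_mkcond /=.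
  by apply: eq_bigr => e _; rewrite inE; case: (e \in F); case: (e \in G).
have itc F : iter T (P G) c F = \sum_(e in G) iter T (P G) (fun F => (e \in F)%:R) F.
  by rewrite -iter_transition_sum; apply: eq_iter_transition => F'; rewrite cE.
have -> : mu c = \sum_(e in G) mu (fun F => (e \in F)%:R).
  rewrite /mu -mulr_suml exchange_big /=; congr (_ / _); apply: eq_bigr => F _.
  by rewrite itc !mulr_sumr.
rewrite /nu itc -sumrB; apply: ler_sum => e eG; rewrite lerD2r.
apply: le_trans (_ : mu (fun F => o F * (e \in F)%:R) + mu (fun F => 1 - o F) <= _).
  rewrite -muD; apply: mu_le => F _.
  by case: (Om F); rewrite ?subrr ?addr0 ?mul1r // mul0r add0r subr0 lern1; case: (_ \in _).
apply: lerD => //; apply: mu_stat => F; exact: mulr_ge0.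
Qed.

End Phase.
End Iterates.

(** * The choice of constants *)

Section Increments.
Variables (R : realFieldType) (D d' : nat) (E ph : R).
Hypotheses (D1 : (0 < D)%N) (E1 : 1 <= E) (ph2 : 2 * ph <= 1).
Hypothesis dD : (d'.+2 <= D)%N.

Let L : R := 2 * D%:R * E.

(** Marginal cost of the [i + 1]-st edge at a vertex. Its geometric decay makes the
    deletion of an edge (at rate [1 / E]) outweigh the insertion of another one (at
    rate at most [1]); the last edge, which is deleted at rate of order [1], can be
    charged less. *)
Definition increment (i : nat) : R :=
  if i == 0%N then 4 * D%:R * L ^+ d' else if (i < d'.+2)%N then L ^+ (d'.+1 - i) else 0.

Definition gmax : R := 5 * D%:R * L ^+ d'.

Let Dge1 : 1 <= D%:R :> R. Proof. by rewrite ler1n. Qed.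

Let L1 : 1 <= L.
Proof.
rewrite /L; have h : 1 <= D%:R * E by apply: mulr_ege1.
by rewrite -mulrA; lra.
Qed.

Let Lp k : 1 <= L ^+ k. Proof. exact: exprn_ege1. Qed.

Lemma increment_ge0 i : 0 <= increment i.
Proof.
rewrite /increment; case: ifP => _; first by rewrite !mulr_ge0 ?ler0n // (le_trans ler01 (Lp _)).
by case: ifP => // _; apply: le_trans ler01 (Lp _).
Qed.

Lemma increment0_ge1 : 1 <= increment 0.
Proof.
have h : 1 <= D%:R * L ^+ d' by apply: mulr_ege1.
by rewrite /increment eqxx -mulrA; lra.
Qed.

Lemma gmax_ge1 : 1 <= gmax.
Proof.
have h : 1 <= D%:R * L ^+ d' by apply: mulr_ege1.
by rewrite /gmax -mulrA; lra.
Qed.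

Lemma increment_sum_le j : \sum_(i < j) increment i <= gmax.
Proof.
have M0 := le_trans ler01 (Lp d').
suff h : \sum_(i < j) increment i <= 4 * D%:R * L ^+ d' + (minn j d'.+2)%:R * L ^+ d'.
  apply: le_trans h _; rewrite /gmax.
  have : (minn j d'.+2)%:R * L ^+ d' <= D%:R * L ^+ d'.
    by apply: ler_wpM2r => //; rewrite ler_nat; apply: leq_trans (geq_minr _ _) dD.
  by rewrite -!mulrA; lra.
elim: j => [|j IH].
  by rewrite big_ord0 min0n mul0r addr0 !mulr_ge0 ?ler0n.
rewrite big_ord_recr /=.
case: j IH => [_|j IH].
  rewrite big_ord0 add0r /increment eqxx lerDl mulr_ge0 ?ler0n //.
have [jd|jd] := ltnP j.+1 d'.+2; last first.
  have -> : increment j.+1 = 0 by rewrite /increment /= ltnNge jd.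
  have -> : minn j.+2 d'.+2 = minn j.+1 d'.+2 by move: jd; clear; lia.
  by rewrite addr0.
have -> : minn j.+2 d'.+2 = (minn j.+1 d'.+2).+1 by move: jd; clear; lia.
rewrite -[(minn _ _).+1%:R]natr1 [(_ + 1) * _]mulrDl mul1r addrA; apply: lerD => //.
by rewrite /increment /= jd; apply: ler_weXn2l => //; clear; lia.
Qed.

(** The hypothesis of [vertex_drift] with [kap = E^-1]: the loss at degree [j] dominates both
    [kap] and the gain from [D] possible insertions. *)
Lemma increment_lowP j : (0 < j <= d'.+2)%N ->
  E^-1 + D%:R * increment j <= (if j == 1%N then 1 - ph else j%:R * (1 - (1 - E^-1))) * increment j.-1.
Proof.
have E0 : 0 < E by apply: lt_le_trans ltr01 E1.
have Ei1 : E^-1 <= 1 by rewrite invf_le1.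
have Ei0 : 0 < E^-1 by rewrite invr_gt0.
have DL k : 1 <= D%:R * L ^+ k by apply: mulr_ege1.
case: j => [//|[_|j /andP[_ jd]]] /=.
  rewrite /increment /= subn1 /=; have h := DL d'.
  have : D%:R * L ^+ d' * (2 * ph) <= D%:R * L ^+ d' * 1.
    by apply: ler_wpM2l => //; apply: le_trans ler01 h.
  lra.
rewrite opprB addrCA subrr addr0.
have jE : j.+2%:R * E^-1 >= 2 * E^-1 by rewrite ler_pM2r // ler_nat.
rewrite {2}/increment /= jd.
have [jlt|jge] := ltnP j.+2 d'.+2; last first.
  have -> : increment j.+2 = 0 by rewrite /increment /= ltnNge jge.
  have -> : (d'.+1 - j.+1 = 0)%N by move: jge; clear; lia.
  by rewrite mulr0 addr0 expr0 mulr1; lra.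
have -> : increment j.+2 = L ^+ (d'.+1 - j.+2) by rewrite /increment /= jlt.
have -> : (d'.+1 - j.+1 = (d'.+1 - j.+2).+1)%N by move: jlt; clear; lia.
set k := (_ - _)%N; have h := DL k.
rewrite exprS mulrA.
apply: le_trans (_ : (2 * E^-1 * L) * L ^+ k <= _); last first.
  apply: ler_wpM2r; first exact: le_trans ler01 (Lp _).
  by apply: ler_wpM2r => //; apply: le_trans ler01 L1.
have -> : 2 * E^-1 * L = 4 * D%:R by rewrite /L; field; rewrite gt_eqF.
by rewrite -mulrA; lra.
Qed.

Lemma increment_highP j : (d'.+2 < j)%N -> increment j = 0.
Proof. by rewrite /increment; case: j => // j h; rewrite /= ltnNge (ltnW h). Qed.

End Increments.

Section Balls.
Variables (V : finType) (G : {set {set V}}) (D : nat).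
Hypothesis dG : forall v, (degree G v <= D)%N.

Definition nbhd (S : {set V}) : {set V} := S :|: \bigcup_(x in S) [set y | [set x; y] \in G].

Lemma card_nbhd S : (#|nbhd S| <= D.+1 * #|S|)%N.
Proof.
rewrite mulSn; apply: leq_trans (leq_card_setU _ _) _; rewrite leq_add2l.
rewrite mulnC -sum_nat_const.
elim/big_rec2: _ => [|x s T _ IH]; first by rewrite cards0.
apply: leq_trans (leq_card_setU _ _) _; apply: leq_add => //.
apply: leq_trans (dG x).
have inj : injective (fun y => [set x; y]).
  move=> y z E; have : y \in [set x; z] by rewrite -E set22.
  rewrite !inE => /orP[/eqP yx|/eqP//].
  have : z \in [set x; y] by rewrite E set22.
  by rewrite !inE yx orbb => /eqP.
rewrite -(card_imset _ inj); apply: subset_leq_card; apply/subsetP=> e /imsetP[y yG ->].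
by rewrite inE set21 andbT; rewrite inE in yG.
Qed.

Definition ball v r := iter r nbhd [set v].

Lemma card_ball v r : (#|ball v r| <= D.+1 ^ r)%N.
Proof.
elim: r => [|r IH]; first by rewrite cards1.
by apply: leq_trans (card_nbhd _) _; rewrite expnS leq_mul2l IH.
Qed.

(** A component that has not been exhausted gains at least one vertex in each further layer
    of the ball. *)
Lemma reach_ball (F : {set {set V}}) v r : F \subset G -> (#|reach F [set v]| <= r)%N -> reach F [set v] \subset ball v r.
Proof.
move=> sF; set C := reach F [set v].
have grow (S : {set V}) : S \subset nbhd S by apply: subsetUl.
have key k : (C \subset ball v k) || (k < #|C :&: ball v k|)%N.
  elim: k => [|k IH].
    apply/orP; right; rewrite card_gt0; apply/set0Pn; exists v.
    by rewrite inE set11 andbT (subsetP (sub_reach _ _)) ?set11.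
  have [CB|nCB] := boolP (C \subset ball v k).
    by rewrite (subset_trans CB) // grow.
  rewrite (negbTE nCB) /= in IH; apply/orP; right.
  have /existsP[x /existsP[y /and4P[xC xB xy yB]]] : [exists x, exists y,
      [&& x \in C, x \in ball v k, [set x; y] \in F & y \notin ball v k]].
    have vB : v \in ball v k.
      by elim: (k) => [|j IHj]; [exact: set11 | apply: (subsetP (grow _))].
    apply: contraNT nCB => /existsPn no.
    apply: (@subset_trans _ _ (C :&: ball v k)); last exact: subsetIr.
    apply: reach_min.
      by rewrite sub1set inE vB andbT (subsetP (sub_reach _ _)) ?set11.
    move=> x y; rewrite !in_setI => /andP[xC xB] xy; rewrite (reach_closed xC xy) /=.
    by have /existsPn/(_ y) := no x; rewrite xC xB xy /= negbK.
  apply: leq_ltn_trans IH _; apply: proper_card; apply/properP; split.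
    by apply: setIS; apply: grow.
  exists y; last by rewrite inE negb_and yB orbT.
  rewrite in_setI (reach_closed xC xy) /=; apply/setUP; right; apply/bigcupP.
  by exists x; rewrite // inE (subsetP sF).
move=> cC; have /orP[//|h] := key r.
by have := leq_trans h (leq_trans (subset_leq_card (subsetIl _ _)) cC); rewrite ltnn.
Qed.

End Balls.

(** * Expanders *)

Section Expander.
Variables (R : realFieldType) (V : finType) (G : {set {set V}}) (D : nat).
Variables (delta eta : R).
Hypotheses (sG : simple_graph G) (regG : forall v, degree G v = D).
Hypothesis expG : forall S : {set V}, (0 < #|S|)%N -> #|S|%:R <= delta * #|V|%:R ->
  5 / 9 * (D%:R * #|S|%:R) <= #|edge_boundary G S|%:R :> R.
Implicit Types (F K H : {set {set V}}) (S C e : {set V}).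

Lemma card_edges : (2 * #|G| = D * #|V|)%N.
Proof.
rewrite -sum_degree // (eq_bigr (fun=> D)) => [|v _]; last exact: regG.
by rewrite sum_nat_const mulnC.
Qed.

Lemma degree_split S K : K \subset G -> (forall e, e \in K -> e \subset S) ->
  (2 * #|K| + #|edge_boundary G S| <= D * #|S|)%N.
Proof.
move=> KG KS.
have -> : (D * #|S| = \sum_(e in G) #|e :&: S|)%N.
  rewrite mulnC -sum_nat_const (eq_bigr (fun v => degree G v)); last first.
    by move=> v _; rewrite regG.
  rewrite (eq_bigr (fun v => \sum_(e in G) (v \in e))%N); last first.
    move=> v _; rewrite /degree -sum1_card big_mkcond [RHS]big_mkcond /=.
    by apply: eq_bigr => e _; rewrite inE; case: (e \in G); case: (v \in e).
  rewrite exchange_big; apply: eq_bigr => e _ /=.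
  rewrite -sum1_card big_mkcond [RHS]big_mkcond /=.
  by apply: eq_bigr => v _; rewrite in_setI; case: (v \in S); case: (v \in e).
have dis e : e \in K -> e \notin edge_boundary G S.
  move=> eK; rewrite inE negb_and; apply/orP; right; rewrite negb_and !negbK.
  by apply/orP; right; rewrite setI_eq0 disjoints_subset setCK KS.
rewrite mulnC -sum_nat_const -sum1_card big_mkcond [X in (_ + X)%N]big_mkcond.
rewrite [X in (_ <= X)%N]big_mkcond -big_split /=; apply: leq_sum => e _.
case: (boolP (e \in K)) => eK.
  rewrite (negbTE (dis e eK)) (subsetP KG _ eK) (setIidPl (KS _ eK)).
  by rewrite (simpleP sG (subsetP KG _ eK)).
rewrite add0n inE; case: (e \in G) => //=; case: ifP => // /andP[h _].
by rewrite card_gt0.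
Qed.

Lemma small_dense S K : (0 < #|S|)%N -> #|S|%:R <= delta * #|V|%:R ->
  K \subset G -> (forall e, e \in K -> e \subset S) -> (9 * #|K| <= 2 * D * #|S|)%N.
Proof.
move=> S0 Sd KG KS; have h1 := degree_split KG KS; have h2 := expG S0 Sd.
rewrite -(ler_nat R) !natrM; rewrite -(ler_nat R) natrD !natrM in h1; lra.
Qed.

Definition phase F := #|F|%:R <= eta * #|G|%:R.

Lemma phase_sub F F' : F \subset F' -> F' \subset G -> phase F' -> phase F.
Proof.
by move=> sF _; apply: le_trans; rewrite ler_nat subset_leq_card.
Qed.

(** Components with at most [delta * #|V|] vertices are sparse by expansion, and larger ones
    because the phase has too few edges: at most [eta * #|G|], which is at most [D / 10]
    times their number of vertices. *)
Lemma phase_sparse F : 5 * eta <= delta -> F \subset G -> phase F -> sparse D F.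
Proof.
move=> he sF pF v; set C := reach F [set v]; set K := touch F C.
have C0 : (0 < #|C|)%N.
  by rewrite card_gt0; apply/set0Pn; exists v; apply: (subsetP (sub_reach _ _)); rewrite set11.
have KF : K \subset F by apply: subsetDl.
have [Cd|Cd] := lerP #|C|%:R (delta * #|V|%:R).
  apply: small_dense => //; first exact: subset_trans sF.
  by move=> e; apply: touch_reach_sub; apply: simple_sub sG.
rewrite -(ler_nat R) !natrM.
have h1 : #|K|%:R <= eta * #|G|%:R.
  by apply: le_trans pF; rewrite ler_nat subset_leq_card.
have h2 : 2 * #|G|%:R = D%:R * #|V|%:R :> R by rewrite -!natrM card_edges.
have h3 : D%:R * (delta * #|V|%:R) <= D%:R * #|C|%:R by rewrite ler_wpM2l // ltW.
have h4 : 5 * eta * #|G|%:R <= delta * #|G|%:R by rewrite ler_wpM2r.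
have h5 : delta * (2 * #|G|%:R) = D%:R * (delta * #|V|%:R) by rewrite h2; ring.
have h6 : 0 <= D%:R * #|C|%:R :> R by rewrite mulr_ge0.
nra.
Qed.

End Expander.

Lemma half_bound (R : realFieldType) (x y : R) : 2 <= x -> x < y + 1 -> x <= 2 * y.
Proof. by move=> hx hy; lra. Qed.

Lemma shift_bound (R : realFieldType) (x a b c e : R) :
  x <= a + b + c -> x + e - b <= e + a + c.
Proof. by move=> h; lra. Qed.

Section SetLevel.
Variables (R : realFieldType) (V : finType) (G : {set {set V}}) (D d' N r T : nat).
Variables (delta eta E q : R).
Hypotheses (sG : simple_graph G) (regG : forall v, degree G v = D).
Hypothesis eta_delta : 5 * eta <= delta.
Hypothesis expG : forall S : {set V}, (0 < #|S|)%N -> #|S|%:R <= delta * #|V|%:R ->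
  5 / 9 * (D%:R * #|S|%:R) <= #|edge_boundary G S|%:R :> R.
Hypotheses (d'D : (2 * d'.+2 <= D.-1)%N) (Dd' : (D <= 2 * d'.+3)%N).
Hypotheses (E1 : 1 < E) (q1 : 1 <= q) (ED : E ^+ D <= 2 ^+ D * q ^+ 2).
Hypotheses (N4 : (4 * D <= N)%N) (Neta : 16 * D%:R <= 9 * eta * N%:R).
Hypothesis qN : (2 : R) ^+ (9 * N + 4 * D) <= q.
Hypothesis qK : (2 : R) ^+ (D ^ 2) * (270 * D%:R ^+ 2 * (2 * D%:R) ^+ D) ^+ (2 * D) <= q.
Hypothesis G0 : G != set0.
Hypotheses (rdelta : (D.+1 ^ r)%N%:R <= delta * #|V|%:R) (mbig : 2 <= eta * #|G|%:R).
Implicit Types (F K H : {set {set V}}) (S C e : {set V}).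

Let w := E - 1.
Let p := 1 - E^-1.
Let ph := w / (q + w).
Let lam : R := 2 ^- N.
Notation W := (@W R V w q).
Let D5 : (5 <= D)%N. Proof. move: d'D; clear; lia. Qed.
Let D0 : (0 < D)%N. Proof. exact: leq_trans D5. Qed.
Let dD' : (d'.+2 <= D)%N. Proof. move: d'D; clear; lia. Qed.
Let E0 : 0 < E. Proof. exact: lt_trans ltr01 E1. Qed.
Let E1' : 1 <= E. Proof. exact: ltW. Qed.
Let w0 : 0 < w. Proof. by rewrite subr_gt0. Qed.
Let q0 : 0 < q. Proof. exact: lt_le_trans ltr01 q1. Qed.
Let wE : w <= E. Proof. by rewrite /w; lra. Qed.
Let qw0 : 0 < q + w. Proof. exact: addr_gt0. Qed.

Let pE : p * (1 + w) = w.
Proof. by rewrite /p /w; field; rewrite gt_eqF. Qed.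

Let phE : ph * (q + w) = w.
Proof. by rewrite /ph divfK // gt_eqF. Qed.

Let ph0 : 0 <= ph. Proof. by rewrite divr_ge0 // ltW. Qed.

Let ph_le : ph <= E / q.
Proof.
rewrite /ph ler_pdivrMr // mulrAC ler_pdivlMr //.
by apply: ler_pM => //; [exact: ltW | exact: ltW | rewrite lerDl ltW].
Qed.

Let php : ph <= p.
Proof.
rewrite -(ler_pM2r qw0) phE /p.
apply: le_trans (_ : p * (1 + w) <= _); first by rewrite pE.
apply: ler_wpM2l; first by rewrite /p subr_ge0 invf_le1.
by rewrite lerD2r.
Qed.

Let p1 : p <= 1. Proof. by rewrite /p gerBl invr_ge0 ltW. Qed.

Let lam0 : 0 < lam. Proof. by rewrite invr_gt0 exprn_gt0. Qed.
Let lam1 : lam <= 1. Proof. by rewrite invf_le1 ?exprn_gt0 // exprn_ege1 // ler1n. Qed.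

Let lamE : E ^+ (4 * D) <= lam ^+ 9 * q ^+ 9.
Proof.
apply: le_trans (_ : (2 ^+ D * q ^+ 2) ^+ 4 <= _).
  by rewrite mulnC exprM; apply: lerXn2r ED; rewrite nnegrE ?exprn_ge0 ?mulr_ge0 ?exprn_ge0 // ltW.
have -> : (2 ^+ D * q ^+ 2) ^+ 4 = 2 ^+ (4 * D) * q ^+ 8.
  by rewrite exprMn -!exprM [(D * 4)%N]mulnC.
have -> : lam ^+ 9 * q ^+ 9 = (lam ^+ 9 * q) * q ^+ 8 by rewrite -mulrA -exprS.
apply: ler_wpM2r; first by rewrite exprn_ge0 ?ltW.
have -> : lam ^+ 9 = (2 ^+ (9 * N))^-1 by rewrite /lam exprVn -exprM mulnC.
by rewrite ler_pdivlMl ?exprn_gt0 // -exprD.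
Qed.

Let gm : R := gmax D d' E.

(** The growth rate of the contagion is small. Its exponent of [q] is [2 d / D - 1], with
    [d = d' + 2] and [2 d <= D - 1]; the power [2 D] clears the denominators. *)
Let small_ph : 2 * ph <= 1 /\ D%:R * (ph * (3 * gm)) <= E^-1 / 18.
Proof.
have Dge1 : 1 <= D%:R :> R by rewrite ler1n.
set K : R := 270 * D%:R ^+ 2 * (2 * D%:R) ^+ D.
have K1 : 1 <= K.
  have h1 : 1 <= D%:R ^+ 2 :> R by apply: exprn_ege1.
  have h2 : 1 <= (2 * D%:R) ^+ D :> R by apply: exprn_ege1; lra.
  have h3 : 1 <= D%:R ^+ 2 * (2 * D%:R) ^+ D :> R by apply: mulr_ege1.
  by rewrite /K -mulrA; lra.
have KE : K * E ^+ d'.+2 <= q.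
  have n0 : (0 < 2 * D)%N by rewrite muln_gt0.
  rewrite -(ler_pXn2r n0) ?nnegrE; last 2 first.
  - by rewrite mulr_ge0 ?exprn_ge0 ?ltW // (lt_le_trans ltr01).
  - exact: ltW.
  rewrite exprMn -exprM.
  apply: le_trans (_ : K ^+ (2 * D) * (2 ^+ D * q ^+ 2) ^+ D.-1 <= _).
    apply: ler_wpM2l; first by rewrite exprn_ge0 // (le_trans ler01).
    apply: le_trans (_ : (E ^+ D) ^+ D.-1 <= _).
      rewrite -exprM; apply: ler_weXn2l => //.
      have -> : (d'.+2 * (2 * D) = D * (2 * d'.+2))%N by clear; lia.
      by rewrite leq_mul2l d'D orbT.
    by apply: lerXn2r ED; rewrite nnegrE ?mulr_ge0 ?exprn_ge0 // ltW.
  have -> : (2 ^+ D * q ^+ 2) ^+ D.-1 = 2 ^+ (D * D.-1) * q ^+ (2 * D.-1).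
    by rewrite exprMn -!exprM.
  rewrite mulrA.
  have qs : q ^+ (2 * D) = q ^+ 2 * q ^+ (2 * D.-1).
    by rewrite -exprD; congr (_ ^+ _); move: D0; clear; lia.
  rewrite qs; apply: ler_wpM2r; first by rewrite exprn_ge0 ?ltW.
  apply: le_trans (_ : q <= _); last by rewrite expr2 ler_peMr // ltW.
  apply: le_trans qK; rewrite mulrC; apply: ler_wpM2r.
    by rewrite exprn_ge0 // (le_trans ler01).
  apply: ler_weXn2l; first by rewrite ler1n.
  by rewrite -mulnn leq_mul2l leq_pred orbT.
have Ed k : 1 <= E ^+ k by apply: exprn_ege1.
have qE : E * E * K <= q * E ^+ 0 by rewrite expr0 mulr1; apply: le_trans KE; rewrite mulrC;
  apply: ler_wpM2l; [apply: le_trans ler01 K1 | rewrite -expr2; apply: ler_weXn2l].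
split.
  rewrite -(ler_pM2r q0); apply: le_trans (_ : 2 * (E / q) * q <= _).
    by apply: ler_wpM2r; [exact: ltW | rewrite ler_pM2l].
  rewrite -mulrA divfK ?gt_eqF // mul1r; apply: le_trans KE.
  rewrite -[2 * E]/(2 * E ^+ 1); apply: ler_pM => //.
  - by rewrite expr1 ltW.
  - have h1 : 1 <= D%:R ^+ 2 :> R by apply: exprn_ege1.
    have h2 : 1 <= (2 * D%:R) ^+ D :> R by apply: exprn_ege1; lra.
    have h3 : 1 <= D%:R ^+ 2 * (2 * D%:R) ^+ D :> R by apply: mulr_ege1.
    by rewrite /K -mulrA; lra.
  - by apply: ler_weXn2l.
have gm0 : 0 <= gm by rewrite (le_trans ler01) // gmax_ge1.
apply: le_trans (_ : D%:R * (E / q * (3 * gm)) <= _).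
  by apply: ler_wpM2l => //; apply: ler_wpM2r => //; rewrite mulr_ge0.
rewrite ler_pdivlMr // -[E^-1]mul1r ler_pdivlMr //.
have -> : D%:R * (E / q * (3 * gm)) * 18 * E = D%:R * (E * (3 * gm)) * 18 * E / q.
  by rewrite !mulrA; ring.
rewrite ler_pdivrMr // mul1r; apply: le_trans KE.
have -> : D%:R * (E * (3 * gm)) * 18 * E = 270 * D%:R ^+ 2 * (2 * D%:R) ^+ d' * E ^+ d'.+2.
  by rewrite /gm /gmax exprMn !exprS; ring.
apply: ler_wpM2r; first by rewrite exprn_ge0 ?ltW.
apply: ler_wpM2l; first by rewrite mulr_ge0 ?exprn_ge0.
by apply: ler_weXn2l; [lra | apply: leq_trans dD'; rewrite leqW].
Qed.

Definition rho : R := 1 - E^-1 / (18 * gmax D d' E) / #|G|%:R.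

Let gm1 : 1 <= gm. Proof. exact: gmax_ge1. Qed.

Lemma rho_ge0 : 0 <= rho.
Proof.
have m1 : 1 <= #|G|%:R :> R by rewrite ler1n card_gt0.
rewrite /rho subr_ge0 -/gm -!mulrA -!invfM invf_le1; last first.
  have gmp : 0 < gm by apply: lt_le_trans ltr01 gm1.
  have mp : 0 < #|G|%:R :> R by apply: lt_le_trans ltr01 m1.
  by apply: mulr_gt0 => //; apply: mulr_gt0 => //; apply: mulr_gt0.
have h18 : 1 <= 18 :> R by rewrite ler1n.
by apply: mulr_ege1 => //; apply: mulr_ege1 => //; apply: mulr_ege1.
Qed.

Let degG v : (degree G v <= D)%N. Proof. by rewrite regG. Qed.

(** The three error terms are a large cluster, the comparison with a ball, and the mixing
    of the dynamics inside the ball. *)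
Lemma edge_marginal_bound e0 v : e0 \in G -> v \in e0 ->
  \sum_(F : {set {set V}} | F \subset G) W F * ((phase G eta F)%:R * (e0 \in F)%:R) <=
  (2 ^+ D * (lam * 2 ^+ D) ^+ r +
   iter T (transition p ph G G) (fun F => (e0 \in F)%:R) set0 + rho ^+ T * (gm * #|V|%:R)) *
  phase_mass w q G (phase G eta).
Proof.
move=> eG ve; set B := ball G v r.
have [ph2 ph_small] := small_ph.
set A := avoid G (~: B).
have AG : A \subset G by apply: avoid_sub.
have sA : simple_graph A by apply: simple_sub sG.
have denseA H : H \subset A -> (9 * #|H| <= 2 * D * #|cover H|)%N.
  move=> HA; have [c0|c0] := posnP #|cover H|.
    suff -> : H = set0 by rewrite cards0 muln0.
    apply/eqP/negPn/negP=> /set0Pn[e eH].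
    have [u ue] : exists u, u \in e.
      by apply/set0Pn; rewrite -card_gt0 (simpleP sA (subsetP HA _ eH)).
    have : u \in cover H by apply/bigcupP; exists e.
    by rewrite (cards0_eq c0) inE.
  apply: (small_dense sG regG expG) => //.
  - apply: le_trans rdelta; rewrite ler_nat; apply: leq_trans (card_ball degG v r).
    apply: subset_leq_card; apply/bigcupsP=> e /(subsetP HA); rewrite inE => /andP[_].
    by rewrite disjoints_subset setCK.
  - exact: subset_trans HA AG.
  - by move=> e; apply: sub_cover.
have spA F : F \subset A -> sparse D F.
  move=> FA u; apply: leq_trans (denseA _ _) _.
    exact: subset_trans (subsetDl _ _) FA.
  rewrite leq_mul2l subset_leq_card ?orbT //; apply/bigcupsP=> e.
  by apply: touch_reach_sub; apply: simple_sub sA.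
have lamD : lam * 2 ^+ (2 * D + 1) <= 1.
  by rewrite mulrC ler_pdivrMr ?exprn_gt0 // mul1r; apply: ler_weXn2l; [rewrite ler1n | move: N4 D0; clear; lia].
have lamD' : lam * 2 ^+ D <= 1.
  by rewrite mulrC ler_pdivrMr ?exprn_gt0 // mul1r; apply: ler_weXn2l; [rewrite ler1n | move: N4 D0; clear; lia].
have degA u : (degree A u <= D)%N by apply: leq_trans (degreeS u AG) (degG u).
have mean2 (B' : {set {set V}}) u : B' \subset A ->
    \sum_(F : {set {set V}} | F \subset B') W F * #|reach F [set u]|%:R <=
    2 * \sum_(F : {set {set V}} | F \subset B') W F.
  move=> sB; apply: (mean_cluster w0 q1 E1' wE lam0 lamE) lam1 lamD _ _ _.
  - exact: simple_sub sA.
  - by move=> x; apply: leq_trans (degreeS x sB) (degA x).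
  - by move=> F FB; apply: spA; apply: subset_trans sB.
set g := fun j => \sum_(i < j) increment D d' E i.
have al0 i : 0 <= increment D d' E i by apply: increment_ge0.
have gmono : {homo g : i j / (i <= j)%N >-> i <= j}.
  apply: homo_leq => [x|x y z|i]; [exact: lexx | exact: le_trans |].
  by rewrite /g big_ord_recr lerDl.
have g00 : g 0%N = 0 by rewrite /g big_ord0.
have gM i : g i <= gm by apply: increment_sum_le.
have drift H : H \subset A -> mean_edge G (potential_bound p ph A g gm H) <= rho * potential g H.
  apply: (drift_bound ph0 php p1 G0 sG AG degA denseA (d := d'.+2)) => //.
  - exact: lt_le_trans ltr01 gm1.
  - by move=> j hj; apply: increment_lowP.
  - exact: increment_highP.
  - by rewrite invr_ge0 ltW.
have mix := @local_mixing _ _ _ _ _ _ w0 q1 pE phE ph0 php p1 G G0 sG A g gm rho T e0 AG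
  gmono g00 _ gM rho_ge0 mean2 drift.
have {}mix := mix _; rewrite {1}/g big_ord1 in mix.
have {}mix := mix (increment0_ge1 _ D0 E1').
have cmp : iter T (transition p ph G A) (fun F => (e0 \in F)%:R) set0 <=
    iter T (transition p ph G G) (fun F => (e0 \in F)%:R) set0.
  apply: transition_compare => //; rewrite ?sub0set // => F F' sF; rewrite ler_nat.
  by case: (boolP (e0 \in F)) => // /(subsetP sF)->.
have psub F F' : F \subset F' -> F' \subset G -> phase G eta F' -> phase G eta F.
  exact: phase_sub.
have := @weak_spatial_mixing _ _ _ _ w0 q1 G sG (phase G eta) psub B v r e0 eG ve
   (fun F sF => reach_ball sF).
cbv zeta; rewrite -/A => /le_trans; apply.
rewrite -addrA mulrDl; apply: lerD.
  apply: (cluster_tail w0 q1 E1' wE lam0 lamE) => //.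
  by move=> F sF pF; apply: (phase_sparse sG regG expG eta_delta sF pF).
apply: ler_wpM2r.
  by apply: sumr_ge0 => F _; rewrite mulr_ge0 // W_ge0.
rewrite ler_pdivrMr ?sumW_gt0 //; apply: le_trans mix _.
by apply: ler_wpM2r; [rewrite ltW // sumW_gt0 | rewrite lerD2r].
Qed.

(** An exit state has almost [eta * #|G|] edges, hence rank of this order, and [N] is chosen
    so that its weight is at most [4 ^ (- #|G|)], which beats the number of configurations. *)
Lemma boundary_weight :
  \sum_(F : {set {set V}} | F \subset G) W F * (exit_state G (phase G eta) F)%:R <= 2 ^- #|G|.
Proof.
have ptw F : F \subset G -> W F * (exit_state G (phase G eta) F)%:R <= 2 ^- (2 * #|G|).
  move=> sF; have two k : (0 : R) < 2 ^+ k by rewrite exprn_gt0.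
  case: (boolP (exit_state G (phase G eta) F)) => [/andP[pF /exists_inP[e eG nF]]|_]; last first.
    by rewrite mulr0 invr_ge0 ltW.
  rewrite mulr1.
  have sp : (9 * #|F| <= 4 * D * rk F)%N.
    apply: sparse_rk; first exact: simple_sub sG.
    move=> F' sF'; have sF'G := subset_trans sF' sF.
    by apply: (phase_sparse sG regG expG eta_delta) => //; apply: phase_sub pF.
  apply: le_trans (W_le w0 q1 E1' wE lam0 lamE sp) _.
  rewrite /lam -exprVn -exprM exprVn lef_pV2 ?posrE ?two //.
  apply: ler_weXn2l; first by rewrite ler1n.
  have cF : eta * #|G|%:R < #|F|%:R + 1.
    rewrite ltNge; apply: contra nF; rewrite /phase => /(le_trans _); apply.
    by rewrite natr1 ler_nat cardsU1; case: (_ \notin _); rewrite ?add1n ?add0n.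
  have hs : 9 * #|F|%:R <= 4 * D%:R * (rk F)%:R :> R by rewrite -!natrM ler_nat.
  have Dp : 0 < D%:R :> R by rewrite ltr0n.
  rewrite -(ler_nat R) !natrM -(ler_pM2l (_ : 0 < 8 * D%:R :> R)); last by rewrite mulr_gt0.
  have N0 : 0 <= N%:R :> R by [].
  have m0 : 0 <= #|G|%:R :> R by [].
  have h1 := ler_wpM2l N0 hs.
  have h2 : 9 * eta * N%:R * #|G|%:R >= 16 * D%:R * #|G|%:R by apply: ler_wpM2r.
  have hF : eta * #|G|%:R <= 2 * #|F|%:R by exact: half_bound mbig cF.
  have h3 := ler_wpM2l N0 hF.
  lra.
apply: le_trans (ler_sum _ ptw) _.
rewrite sumr_const -[X in X <= _]mulr_natl.
have -> : #|[pred F : {set {set V}} | F \subset G]| = (2 ^ #|G|)%N.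
  by rewrite -card_powerset; apply: eq_card => F; rewrite powersetE.
have n2 : (2 : R) ^+ #|G| != 0 by rewrite expf_neq0 // pnatr_eq0.
by rewrite natrX mul2n -addnn exprD invfM mulrA divff // mul1r.
Qed.

Lemma expander_tv_bound :
  2^-1 * \sum_(F : {set {set V}} | F \subset G)
    `|iter T (transition p ph G G) (fun X => (X == F)%:R) set0 -
      W F * (phase G eta F)%:R / phase_mass w q G (phase G eta)| <=
  T%:R * 2 ^- #|G| + #|G|%:R * (T%:R * 2 ^- #|G| + 2 ^+ D * (lam * 2 ^+ D) ^+ r +
     rho ^+ T * (gm * #|V|%:R)).
Proof.
have psub F F' : F \subset F' -> F' \subset G -> phase G eta F' -> phase G eta F.
  exact: phase_sub.
have p0 : phase G eta set0 by rewrite /phase cards0 (le_trans _ mbig).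
have Z1 := phase_mass_ge1 w0 q1 G p0.
have Z0 : 0 < phase_mass w q G (phase G eta) by apply: lt_le_trans Z1.
have eps0 : 0 <= T%:R * 2 ^- #|G| :> R by rewrite mulr_ge0 // invr_ge0 exprn_ge0.
have ex : \sum_(F : {set {set V}} | F \subset G)
    W F * ((phase G eta F)%:R * iter T (transition p ph G G) (fun F => 1 - (phase G eta F)%:R) F)
    <= T%:R * 2 ^- #|G| * phase_mass w q G (phase G eta).
  apply: le_trans (exit_bound w0 q1 pE phE ph0 php p1 G0 sG psub T) _.
  apply: le_trans (ler_wpM2l _ boundary_weight) _; first by [].
  by rewrite ler_peMr.
apply: le_trans (tv_bound w0 q1 pE phE ph0 php p1 G0 sG p0 ex) _.
rewrite lerD2l [X in _ <= X]mulr_natl -[X in _ <= X]sumr_const; apply: ler_sum => e eG.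
have [v ve] : exists v, v \in e.
  by apply/set0Pn; rewrite -card_gt0 (simpleP sG eG).
have := edge_marginal_bound eG ve; rewrite -ler_pdivrMr //; exact: shift_bound.
Qed.

End SetLevel.
Import numFieldNormedType.Exports.

(** * Configurations as edge sets *)

Section Transfer.
Variables (V : finType) (G : {set {set V}}).
Hypothesis sG : simple_graph G.
Implicit Types (F : config G) (e : {e : {set V} | e \in G}).

Lemma mem_In F e : (val e \in In_edges F) = F e.
Proof.
apply/imsetP/idP => [[e' Fe' /val_inj ->]|Fe]; first by rewrite inE in Fe'.
by exists e; rewrite ?inE.
Qed.

Lemma In_sub F : In_edges F \subset G.
Proof. by apply/subsetP=> x /imsetP[e _ ->]; apply: valP. Qed.

Lemma In_inj : injective (@In_edges V G).
Proof. by move=> F F' E; apply/ffunP=> e; rewrite -!mem_In E. Qed.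

Lemma In_surj (S : {set {set V}}) : S \subset G ->
  In_edges ([ffun e => val e \in S] : config G) = S.
Proof.
move=> /subsetP sS; apply/setP=> x; case xG: (x \in G).
  by have := mem_In [ffun e => val e \in S] (exist _ x xG); rewrite ffunE.
by rewrite (contraFF (sS x) xG) (contraFF (subsetP (In_sub _) x) xG).
Qed.

Lemma sum_config (R : nmodType) (h : {set {set V}} -> R) :
  \sum_(F : config G) h (In_edges F) = \sum_(S : {set {set V}} | S \subset G) h S.
Proof.
rewrite [RHS](reindex_onto (@In_edges V G) (fun S => [ffun e => val e \in S])) /=.
  apply: eq_bigl => F; rewrite In_sub; apply/esym/eqP/ffunP=> e.
  by rewrite ffunE mem_In.
by move=> S sS; apply: In_surj.
Qed.

Lemma sum_edges (R : nmodType) (h : {set V} -> R) :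
  \sum_(e : {e : {set V} | e \in G}) h (val e) = \sum_(x in G) h x.
Proof.
by rewrite (big_sub (fun x => x \in G)).
Qed.

Lemma In_set_edge F e b :
  In_edges (set_edge F e b) = if b then val e |: In_edges F else In_edges F :\ val e.
Proof.
apply/setP=> x; case: (boolP (x \in G)) => xG.
  have E := mem_In _ (exist _ x xG); rewrite /= in E.
  rewrite E ffunE; case: b; rewrite !inE ?E -(inj_eq val_inj) /=;
    by case: (x == val e).
rewrite (contraNF (subsetP (In_sub _) x) xG).
have nx : x != val e by apply: contraNneq xG => ->; apply: valP.
by case: b; rewrite !inE (negbTE nx) (contraNF (subsetP (In_sub F) x) xG).
Qed.

Lemma In_all_out : In_edges (all_out G) = finset.set0.
Proof. by apply/setP=> x; rewrite inE; apply/imsetP=> -[e]; rewrite !inE ffunE. Qed.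

Lemma cut_edgeE (F : {set {set V}}) (e : {set V}) : #|e| = 2%N ->
  cut_edge (e |: F) e = ~~ joined (F :\ e) e.
Proof.
move=> ce; rewrite /cut_edge setU11 /=.
have -> : (e |: F) :\ e = F :\ e by rewrite setDUl setDv set0U.
have -> : e |: F = e |: (F :\ e).
  by apply/setP=> x; rewrite !inE; case: eqP.
case: (boolP (joined _ _)) => [/components_joined->|]; first by rewrite ltnn.
have /eqP/cards2P[a [b [ab ->]]] := ce.
by rewrite joined2 => h; rewrite [X in (_ < X)%N](components_cut ab h) ltnS leqnn.
Qed.

Variables (R : realType) (q beta : R).
Let p := p_edge beta.
Let ph := p_hat q beta.

Lemma rc_step_sum (f : {set {set V}} -> R) (F0 : config G) :
  \sum_(F : config G) rc_step q beta F0 F * f (In_edges F) = transition p ph G G f (In_edges F0).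
Proof.
rewrite /rc_step /transition /mean_edge.
under eq_bigr => F _ do rewrite -mulrA mulr_suml.
rewrite -mulr_sumr exchange_big /= -sum_edges; congr (_ * _); apply: eq_bigr => e _.
have pt b : \sum_(F : config G) (F == set_edge F0 e b)%:R * f (In_edges F) =
    f (In_edges (set_edge F0 e b)).
  rewrite (bigD1 (set_edge F0 e b)) //= eqxx mul1r big1 ?addr0 // => F /negbTE->.
  by rewrite mul0r.
under eq_bigr => F _ do rewrite mulrDl -!mulrA.
rewrite big_split /= -!mulr_sumr !pt !In_set_edge /mean_mark /update_in (valP e).
have ce := simpleP sG (valP e).
rewrite /p_update cut_edgeE // /update -/p -/ph.
by case: (joined _ _) => /=; ring.
Qed.

Lemma rc_law_sum (f : {set {set V}} -> R) (F0 : config G) t :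
  \sum_(F : config G) rc_law q beta F0 t F * f (In_edges F) =
  iter t (transition p ph G G) f (In_edges F0).
Proof.
elim: t f => [|t IH] f /=.
  rewrite (bigD1 F0) //= eqxx mul1r big1 ?addr0 // => F /negbTE->.
  by rewrite mul0r.
under eq_bigr => F _ do rewrite mulr_suml.
rewrite exchange_big /= -iterS iterSr -IH; apply: eq_bigr => F _.
by rewrite -rc_step_sum mulr_sumr; apply: eq_bigr => F' _; rewrite mulrA.
Qed.

Lemma rc_lawE (F0 F : config G) t :
  rc_law q beta F0 t F = iter t (transition p ph G G) (fun X => (X == In_edges F)%:R) (In_edges F0).
Proof.
rewrite -rc_law_sum (bigD1 F) //= eqxx mulr1 big1 ?addr0 // => F' nF.
by rewrite (inj_eq In_inj) (negbTE nF) mulr0.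
Qed.

Hypotheses (q1 : 1 <= q) (beta0 : 0 < beta).
Let w := expR beta - 1.

Lemma weightE (F : config G) : weight q beta F = q ^+ #|V| * W w q (In_edges F).
Proof.
have q0 : q != 0 by rewrite gt_eqF // (lt_le_trans ltr01).
rewrite /weight WE /rk -/w [RHS]mulrCA mulrC; congr (_ * _).
have -> : q ^+ #|V| = q ^+ (#|V| - components (In_edges F)) * q ^+ components (In_edges F).
  by rewrite -exprD subnK // components_le.
by rewrite mulrAC divff ?mul1r // expf_neq0.
Qed.

Lemma w_gt0 : 0 < w.
Proof. by rewrite subr_gt0 expR_gt1. Qed.

Lemma gibbs_disE (delta : R) (F : config G) : 
  gibbs_dis q beta delta F =
  W w q (In_edges F) * (phase G (eta delta) (In_edges F))%:R / phase_mass w q G (phase G (eta delta)).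
Proof.
have q0 : 0 < q by rewrite (lt_le_trans ltr01).
have Wp S : 0 < W w q S by apply: W_gt0 => //; apply: w_gt0.
rewrite /gibbs_dis inE -/(phase G (eta delta) (In_edges F)).
case: ifP => _; last by rewrite mulr0 mul0r.
rewrite mulr1 /gibbs -mulr_suml.
set S := \sum_F' weight _ _ _; set S' := \sum_(F' in _) weight _ _ _.
have S0 : S != 0.
  rewrite gt_eqF // /S (bigD1 F) //= weightE; apply: ltr_wpDr.
    by apply: sumr_ge0 => F' _; rewrite weightE mulr_ge0 // ?exprn_ge0 ?ltW.
  by rewrite mulr_gt0 // exprn_gt0.
have -> : S' = q ^+ #|V| * phase_mass w q G (phase G (eta delta)).
  rewrite /phase_mass -(sum_config (fun S => W w q S * (phase G (eta delta) S)%:R)) mulr_sumr.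
  rewrite /S' big_mkcond; apply: eq_bigr => F' _; rewrite inE weightE.
  rewrite -/(phase G (eta delta) (In_edges F')).
  by case: (phase _ _ _); rewrite ?mulr1 // !mulr0.
rewrite weightE invf_div mulrA divfK //.
by rewrite -mulf_div divff ?mul1r // expf_neq0 // gt_eqF.
Qed.

Lemma dist_TV_sets (delta : R) T :
  dist_TV (rc_law q beta (all_out G) T) (gibbs_dis q beta delta) =
  2^-1 * \sum_(S : {set {set V}} | S \subset G)
    `|iter T (transition p ph G G) (fun X => (X == S)%:R) finset.set0 -
      W w q S * (phase G (eta delta) S)%:R / phase_mass w q G (phase G (eta delta))|.
Proof.
rewrite /dist_TV -sum_config; congr (_ * _); apply: eq_bigr => F _.
by rewrite rc_lawE gibbs_disE In_all_out.
Qed.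

Lemma p_edgeE : p = 1 - (expR beta)^-1.
Proof. by rewrite /p /p_edge expRN. Qed.

Lemma p_hatE : ph = w / (q + w).
Proof.
have E0 : expR beta != 0 by rewrite gt_eqF // expR_gt0.
have wp := w_gt0.
have qw : q + w != 0 by rewrite gt_eqF // addr_gt0 // (lt_le_trans ltr01).
rewrite /ph /p_hat -/p p_edgeE.
have -> : 1 - (1 - (expR beta)^-1) = (expR beta)^-1 by ring.
have -> : 1 - (expR beta)^-1 = w / expR beta by rewrite /w mulrBl divff // mul1r.
have -> : (expR beta)^-1 * q + w / expR beta = (q + w) / expR beta.
  by rewrite [_^-1 * q]mulrC -mulrDl.
by rewrite invf_div mulrA divfK.
Qed.

End Transfer.

(** * Asymptotics *)

Section Asymptotics.
Variable R : realType.
Implicit Types (q beta delta : R).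

(** With [x = q - 1] and [y = x ^ (1 - 2 / D)], the critical value of [expR beta] is
    [(x - 1) / (y - 1)], at most [2 x / y], and [y ^ D = x ^ (D - 2)]. *)
Lemma expR_beta_c q beta D : (5 <= D)%N -> 2 ^+ D + 1 <= q ->
  beta <= beta_c q D -> expR beta ^+ D <= 2 ^+ D * q ^+ 2.
Proof.
move=> D5 hq hb.
have D0 : (D%:R : R) != 0 by rewrite pnatr_eq0 -lt0n; apply: leq_trans D5.
pose x := q - 1; pose y := x `^ (1 - 2 / D%:R).
have two1 : 1 <= 2 :> R by rewrite ler1n.
have x2 : 2 ^+ D <= x by rewrite /x lerBrDr.
have x1 : 1 <= x by apply: le_trans x2; apply: exprn_ege1.
have x0 : 0 < x by apply: lt_le_trans x1.
have y0 : 0 <= y by apply: powR_ge0.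
have yD : y ^+ D = x ^+ (D - 2).
  rewrite -powR_mulrn // -powRrM -powR_mulrn ?(ltW x0) //; congr (_ `^ _).
  by rewrite mulrBl mul1r divfK // natrB // (leq_trans _ D5).
have y2 : 2 <= y.
  rewrite leNgt; apply/negP=> y2.
  have : y ^+ D < 2 ^+ D by rewrite ltrXn2r ?nnegrE // gtn_eqF // (leq_trans _ D5).
  apply/negP; rewrite -leNgt yD; apply: le_trans x2 _.
  rewrite -[X in X <= _]expr1; apply: ler_weXn2l => //.
  by rewrite subn_gt0 (leq_trans _ D5).
have q2 : q - 2 = x - 1 by rewrite /x; ring.
have x4 : 4 <= x.
  apply: le_trans x2; apply: le_trans (_ : 2 ^+ 2 <= _); first by rewrite -natrX ler_nat.
  by apply: ler_weXn2l => //; apply: leq_trans D5.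
have z0 : 0 < (x - 1) / (y - 1) by rewrite divr_gt0 //; lra.
have Ez : expR beta <= (x - 1) / (y - 1).
  rewrite -[X in _ <= X]lnK ?posrE // ler_expR.
  by move: hb; rewrite /beta_c q2.
have yp : 0 < y by lra.
have Ey : expR beta <= 2 * x / y.
  apply: le_trans Ez _; rewrite ler_pdivrMr; last by lra.
  rewrite mulrAC ler_pdivlMr //.
  have : 2 * x <= x * y by rewrite mulrC; apply: ler_wpM2l => //; apply: ltW.
  by move=> h; nra.
apply: le_trans (_ : (2 * x / y) ^+ D <= _).
  by apply: lerXn2r => //; rewrite nnegrE ?expR_ge0 // !mulr_ge0 // ?invr_ge0 ltW.
rewrite expr_div_n exprMn yD -mulrA; apply: ler_wpM2l; first by rewrite exprn_ge0.
have -> : x ^+ D = x ^+ 2 * x ^+ (D - 2).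
  by rewrite -exprD subnKC // (leq_trans _ D5).
rewrite mulfK ?expf_neq0 ?gt_eqF //; apply: lerXn2r; rewrite ?nnegrE ?(ltW x0) //.
  by move: x0; rewrite /x; lra.
by rewrite /x gerBl.
Qed.

Lemma phi_expansion (V : finType) (G : {set {set V}}) D delta (S : {set V}) :
  (0 < D)%N -> ((5 / 9)%:E <= phi D G delta)%E -> (0 < #|S|)%N ->
  #|S|%:R <= delta * #|V|%:R -> 5 / 9 * (D%:R * #|S|%:R) <= #|edge_boundary G S|%:R :> R.
Proof.
move=> D0 h S0 Sd.
have h1 : (phi D G delta <= (#|edge_boundary G S|%:R / (D%:R * #|S|%:R))%:E)%E.
  rewrite /phi.
  exact: (@bigmin_le_cond _ _ _ _ S (fun S : {set V} => (0 < #|S|)%N && (#|S|%:R <= delta * #|V|%:R)) (fun S : {set V} => (#|edge_boundary G S|%:R / (D%:R * #|S|%:R))%:E) (introT andP (conj S0 Sd))).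
have := le_trans h h1; rewrite lee_fin ler_pdivlMr //.
by rewrite mulr_gt0 ?ltr0n.
Qed.

Lemma pow4_le_exp2 : exists2 a : R, 0 <= a & forall n : nat, n%:R ^+ 4 <= a * 2 ^+ n.
Proof.
exists (4 ^ 4)%N%:R => // n; rewrite -!natrX -natrM ler_nat.
have h1 : (n <= 4 * 2 ^ (n %/ 4))%N.
  have : (n %/ 4 < 2 ^ (n %/ 4))%N by apply: ltn_expl.
  by move: (2 ^ _)%N => k; move: (divn_eq n 4) (ltn_pmod n (isT : (0 < 4)%N)); lia.
apply: leq_trans (_ : (4 * 2 ^ (n %/ 4)) ^ 4 <= _)%N; first by rewrite leq_exp2r.
by rewrite expnMn -expnM; apply: leq_mul => //; rewrite leq_exp2l // leq_divM.
Qed.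

(** The error terms of [expander_tv_bound] for [T] of order [n ^ 2] at most; [two] stands for
    [2 ^ (- #|G|)], which is at most [a * n ^ (- 4)], [rh] for the decay of the contagion and [K * u ^ 3] for the cluster tail. *)
Lemma error_small (n D : nat) (a T m C K g two rh u : R) :
  0 <= a ->
  (0 < n)%N -> u = n%:R^-1 ->
  0 <= T -> T <= C * n%:R ^+ 2 -> 0 <= m -> m <= D%:R * n%:R ->
  0 <= two -> two <= a * u ^+ 4 -> 0 <= K -> 0 <= rh -> rh <= u ^+ 3 -> 0 <= g -> 0 <= C ->
  5 * (a * C + a * D%:R * C + D%:R * K + D%:R * g) <= n%:R ->
  T * two + m * (T * two + K * u ^+ 3 + rh * (g * n%:R)) <= 1 / 5.
Proof.
move=> aa n0 uE T0 TC m0 mD two0 two4 K0 rh0 rh3 g0 C0 hn.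
have np : 0 < n%:R :> R by rewrite ltr0n.
have nu : n%:R * u = 1 by rewrite uE divff // gt_eqF.
have u0 : 0 <= u by rewrite uE invr_ge0 ltW.
have u1 : u <= 1 by rewrite uE invf_le1 // ler1n.
have uu : u ^+ 2 <= u by rewrite expr2 ler_piMl.
have a1 : T * two <= a * C * u ^+ 2.
  apply: le_trans (ler_pM T0 two0 TC two4) _.
  have -> : C * n%:R ^+ 2 * (a * u ^+ 4) = a * C * u ^+ 2 * (n%:R * u) ^+ 2 by ring.
  by rewrite nu expr1n mulr1.
have a2 : rh * (g * n%:R) <= g * u ^+ 2.
  apply: le_trans (ler_wpM2r _ rh3) _; first by rewrite mulr_ge0 // ltW.
  have -> : u ^+ 3 * (g * n%:R) = g * u ^+ 2 * (n%:R * u) by ring.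
  by rewrite nu mulr1.
have a3 : K * u ^+ 3 <= K * u ^+ 2.
  by apply: ler_wpM2l => //; rewrite exprS ler_piMl // exprn_ge0.
have s0 : 0 <= a * C * u ^+ 2 + K * u ^+ 2 + g * u ^+ 2.
  have u2 : 0 <= u ^+ 2 by apply: exprn_ge0.
  apply: addr_ge0; [apply: addr_ge0 |]; apply: mulr_ge0 => //; exact: mulr_ge0.
have a4 : m * (T * two + K * u ^+ 3 + rh * (g * n%:R)) <=
    D%:R * n%:R * (a * C * u ^+ 2 + K * u ^+ 2 + g * u ^+ 2).
  apply: le_trans (ler_wpM2r s0 mD); apply: ler_wpM2l => //.
  by rewrite !lerD.
have a5 : D%:R * n%:R * (a * C * u ^+ 2 + K * u ^+ 2 + g * u ^+ 2) =
   (a * D%:R * C + D%:R * K + D%:R * g) * u.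
  have -> : D%:R * n%:R * (a * C * u ^+ 2 + K * u ^+ 2 + g * u ^+ 2) =
   (a * D%:R * C + D%:R * K + D%:R * g) * u * (n%:R * u) by ring.
  by rewrite nu mulr1.
have a6 : a * C * u ^+ 2 <= a * C * u by apply: ler_wpM2l => //; rewrite mulr_ge0.
have := ler_wpM2r u0 hn; rewrite nu => a7.
lra.
Qed.

(** The radius [r] is logarithmic in [n], and [N] makes each layer cost [(D + 1) ^ 3]. *)
Lemma tail_small (n D N r : nat) delta : 0 < delta -> (4 * D <= N)%N -> (0 < n)%N ->
  delta * n%:R < (D.+1 ^ r.+1)%N%:R ->
  2 ^+ D * (2 ^- N * 2 ^+ D) ^+ r <= 2 ^+ D * (D.+1%:R / delta) ^+ 3 * n%:R^-1 ^+ 3 :> R.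
Proof.
move=> d0 N4 n0 hr.
have two k : (0 : R) < 2 ^+ k by rewrite exprn_gt0.
have Dp : (0 : R) < D.+1%:R by rewrite ltr0n.
have np : 0 < n%:R :> R by rewrite ltr0n.
rewrite -[X in _ <= X]mulrA; apply: ler_wpM2l; first exact: ltW.
have h1 : 2 ^- N * 2 ^+ D <= D.+1%:R ^- 3 :> R.
  rewrite ler_pdivrMl // ler_pdivlMr ?exprn_gt0 //.
  apply: le_trans (_ : 2 ^+ D * (2 ^+ D) ^+ 3 <= _).
    apply: ler_wpM2l; first exact: ltW.
    apply: lerXn2r; [by rewrite nnegrE ltW | by rewrite nnegrE ltW |].
    by rewrite -natrX ler_nat ltn_expl.
  by rewrite -exprM -exprD; apply: ler_weXn2l; rewrite ?ler1n //; move: N4; clear; lia.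
have h0 : 0 <= 2 ^- N * 2 ^+ D :> R by apply: mulr_ge0; rewrite ?invr_ge0 exprn_ge0.
apply: le_trans (_ : (D.+1%:R ^- 3) ^+ r <= _).
  by apply: lerXn2r => //; rewrite nnegrE invr_ge0 exprn_ge0.
rewrite -exprMn -exprVn -exprM mulnC exprM; apply: lerXn2r.
- by rewrite nnegrE exprn_ge0 // invr_ge0 ltW.
- by rewrite nnegrE !mulr_ge0 ?invr_ge0 ?(ltW d0) // ltW.
rewrite exprVn -mulrA -invfM ler_pdivlMr ?mulr_gt0 // mulrC ler_pdivrMr ?exprn_gt0 //.
by move: hr; rewrite natrX exprS => /ltW.
Qed.

Lemma decay (n T : nat) (rh c m : R) : 0 <= rh -> rh = 1 - c / m -> 0 < c -> 0 < m ->
  (0 < n)%N -> 3 * m / c * ln n%:R <= T%:R -> rh ^+ T <= n%:R^-1 ^+ 3.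
Proof.
move=> rh0 rhE c0 m0 n0 hT.
have np : 0 < n%:R :> R by rewrite ltr0n.
apply: le_trans (_ : expR (- (c / m)) ^+ T <= _).
  by apply: lerXn2r; rewrite ?nnegrE ?expR_ge0 // rhE; apply: expR_ge1Dx.
have -> : n%:R^-1 ^+ 3 = expR (- (3 * ln n%:R)) :> R.
  by rewrite expRN expRM_natl lnK ?posrE // exprVn.
rewrite -expRM_natr ler_expR mulNr lerN2.
have cm : 0 <= c / m by rewrite divr_ge0 // ltW.
have := ler_wpM2l cm hT; congr (_ <= _); field.
by rewrite !gt_eqF.
Qed.

(** The time [T] is chosen so that the contagion has decayed to [n ^ (- 3)], and the radius [r]
    is the largest for which balls are sure to have at most [delta * n] vertices. *)
Theorem expander_mixing D delta q beta (N d' : nat) :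
  let eta := eta delta in
  0 < delta -> (2 * d'.+2 <= D.-1)%N -> (D <= 2 * d'.+3)%N ->
  0 < beta -> 1 <= q -> expR beta ^+ D <= 2 ^+ D * q ^+ 2 ->
  (4 * D <= N)%N -> 16 * D%:R <= 9 * eta * N%:R ->
  2 ^+ (9 * N + 4 * D) <= q ->
  2 ^+ (D ^ 2) * (270 * D%:R ^+ 2 * (2 * D%:R) ^+ D) ^+ (2 * D) <= q ->
  exists (C : R) (n0 : nat), forall n, (n0 <= n)%N -> forall G : {set {set 'I_n}},
    G \in regular_graphs n D -> ((5 / 9)%:E <= phi D G delta)%E ->
    exists T : nat, T%:R <= C * (n%:R * ln n%:R) /\
      dist_TV (rc_law q beta (all_out G) T) (gibbs_dis q beta delta) <= 1 / 5.
Proof.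
move=> eta d0 d'D Dd' b0 q1 ED N4 Neta qN qK.
have D5 : (5 <= D)%N by move: d'D; clear; lia.
have D0 : (0 < D)%N by apply: leq_trans D5.
have Dp : 0 < D%:R :> R by rewrite ltr0n.
pose E := expR beta; have E1 : 1 < E by rewrite expR_gt1.
have E0 : 0 < E by apply: expR_gt0.
have eta0 : 0 < eta by rewrite /eta /Defs.eta lt_min !divr_gt0.
have eta_delta : 5 * eta <= delta.
  have : eta <= delta / 5 by rewrite /eta /Defs.eta ge_min lexx.
  lra.
pose gm := gmax D d' E.
have gm1 : 1 <= gm by apply: gmax_ge1 => //; apply: ltW.
have gm0 : 0 < gm by apply: lt_le_trans gm1.
pose c := E^-1 / (18 * gm); have c0 : 0 < c.
  by apply: divr_gt0; [rewrite invr_gt0 | apply: mulr_gt0].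
pose C := 3 * D%:R / c + 1.
have C0 : 0 <= C by apply: addr_ge0 => //; apply: divr_ge0; [apply: mulr_ge0 | apply: ltW].
have [a a0 pow4] := pow4_le_exp2.
pose K := 2 ^+ D * (D.+1%:R / delta) ^+ 3.
have K0 : 0 <= K by apply: mulr_ge0; rewrite exprn_ge0 // divr_ge0 // ltW.
pose big := 5 * (a * C + a * D%:R * C + D%:R * K + D%:R * gm) + expR 1 + delta^-1 + 2 / eta.
exists C, (Num.truncn big).+1 => n hn G; rewrite inE => /andP[sG /forallP regG'] hphi.
have nbig : big <= n%:R.
  by apply: ltW; apply: lt_le_trans (truncnS_gt big) _; rewrite ler_nat.
have main0 : 0 <= a * C + a * D%:R * C + D%:R * K + D%:R * gm.
  have h1 : 0 <= a * C by apply: mulr_ge0.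
  have h2 : 0 <= a * D%:R * C by apply: mulr_ge0 => //; apply: mulr_ge0; rewrite ?ler0n.
  have h3 : 0 <= D%:R * K by apply: mulr_ge0.
  have h4 : 0 <= D%:R * gm by apply: mulr_ge0 => //; exact: ltW.
  exact: addr_ge0 (addr_ge0 (addr_ge0 h1 h2) h3) h4.
have e1 : 0 < expR 1 :> R by apply: expR_gt0.
have di : 0 < delta^-1 by rewrite invr_gt0.
have ei : 0 < 2 / eta by rewrite divr_gt0.
have [nm [ne [nd neta]]] : 5 * (a * C + a * D%:R * C + D%:R * K + D%:R * gm) <= n%:R /\
   expR 1 <= n%:R :> R /\ delta^-1 <= n%:R /\ 2 / eta <= n%:R.
  by move: nbig; rewrite /big; split; [|split; [|split]]; lra.
have np : 0 < n%:R :> R by apply: lt_le_trans ne.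
have n0 : (0 < n)%N by rewrite -(ltr0n R).
have n1 : 1 <= n%:R :> R by rewrite ler1n.
have ln1 : 1 <= ln n%:R :> R by rewrite -[X in X <= _](expRK 1) ler_ln ?posrE.
have lnn : ln n%:R <= n%:R :> R by apply/ltW/ln_sublinear.
have regG v : degree G v = D by apply/eqP.
have cardV : #|'I_n| = n by rewrite card_ord.
have m2 : 2 * #|G|%:R = D%:R * n%:R :> R.
  by rewrite -!natrM (card_edges sG regG) cardV.
have mn : n%:R <= #|G|%:R :> R.
  have : 5 * n%:R <= D%:R * n%:R :> R by apply: ler_wpM2r; [exact: ltW | rewrite ler_nat].
  by move=> h; lra.
have mD : #|G|%:R <= D%:R * n%:R :> R.
  by have : 0 <= #|G|%:R :> R by []; lra.
have m0 : 0 < #|G|%:R :> R by apply: lt_le_trans mn.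
have G0 : G != finset.set0 by rewrite -card_gt0 -(ltr0n R).
have expG (S : {set 'I_n}) : (0 < #|S|)%N -> #|S|%:R <= delta * #|'I_n|%:R ->
    5 / 9 * (D%:R * #|S|%:R) <= #|edge_boundary G S|%:R :> R.
  exact: phi_expansion.
pose x := Num.truncn (delta * n%:R); pose r := trunc_log D.+1 x.
have dn1 : 1 <= delta * n%:R by rewrite -ler_pdivrMl // mulr1.
have x0 : (0 < x)%N by rewrite truncn_gt0.
have rdelta : (D.+1 ^ r)%N%:R <= delta * #|'I_n|%:R.
  apply: le_trans (_ : x%:R <= _); first by rewrite ler_nat trunc_logP.
  by rewrite cardV /x truncn_le; apply: le_trans dn1.
have rbig : delta * n%:R < (D.+1 ^ r.+1)%N%:R.
  apply: lt_le_trans (truncnS_gt _) _; rewrite ler_nat; exact: trunc_log_ltn.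
have mbig : 2 <= eta * #|G|%:R.
  rewrite -ler_pdivrMl // mulrC; exact: le_trans mn.
pose T := (Num.truncn (3 * #|G|%:R / c * ln n%:R)).+1.
have T1 : 3 * #|G|%:R / c * ln n%:R <= T%:R by apply/ltW/truncnS_gt.
have T2 : T%:R <= C * (n%:R * ln n%:R).
  have nl : 1 <= n%:R * ln n%:R :> R by apply: mulr_ege1.
  rewrite /T -[(Num.truncn _).+1%:R]natr1 /C [(_ + 1) * _]mulrDl mul1r; apply: lerD => //.
  apply: le_trans (_ : 3 * #|G|%:R / c * ln n%:R <= _).
    by rewrite truncn_le !mulr_ge0 ?invr_ge0 // ?(ltW c0) // (le_trans ler01).
  rewrite [X in _ <= X]mulrA; apply: ler_wpM2r; first exact: le_trans ln1.
  by rewrite [X in _ <= X]mulrAC; apply: ler_wpM2r; [rewrite invr_ge0 ltW | rewrite -mulrA; apply: ler_wpM2l].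
exists T; split=> //.
rewrite dist_TV_sets //.
have := expander_tv_bound T sG regG eta_delta expG d'D Dd' E1 q1 ED N4 Neta qN qK G0 rdelta mbig.
rewrite -p_edgeE -p_hatE // => /le_trans; apply.
rewrite -/gm cardV.
have two4 : 2 ^- #|G| <= a * n%:R^-1 ^+ 4 :> R.
  rewrite exprVn ler_pdivlMr ?exprn_gt0 // [X in X <= _]mulrC ler_pdivrMr ?exprn_gt0 //.
  apply: le_trans (pow4 n) _.
  apply: ler_wpM2l => //; apply: ler_weXn2l; first by rewrite ler1n.
  by rewrite -(ler_nat R).
have tl := tail_small d0 N4 n0 rbig.
have rh0 : 0 <= rho G D d' E by apply: rho_ge0.
have rhE : rho G D d' E = 1 - c / #|G|%:R by [].
have rh3 := decay rh0 rhE c0 m0 n0 T1.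
apply: le_trans (_ : T%:R * 2 ^- #|G| + #|G|%:R * (T%:R * 2 ^- #|G| + K * n%:R^-1 ^+ 3 +
   rho G D d' E ^+ T * (gm * n%:R)) <= _).
  by rewrite lerD2l; apply: ler_wpM2l => //; rewrite lerD2r lerD2l.
apply: (@error_small n D a _ _ C) => //.
- apply: le_trans T2 _; apply: ler_wpM2l => //; rewrite expr2.
  by apply: ler_wpM2l => //; apply: ltW.
- by rewrite exprn_ge0.
- exact: ltW.
Qed.

Lemma whp_impl D (A B : forall n : nat, {set {set 'I_n}} -> Prop) n0 :
  (forall n, (n0 <= n)%N -> forall G : {set {set 'I_n}}, G \in regular_graphs n D ->
     A n G -> B n G) ->
  whp R D A -> whp R D B.
Proof.
move=> AB hA; rewrite /whp.
apply: (squeeze_cvgr (f := fun n => prob_regular R D (@A n)) (h := fun=> 1)) => //.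
  apply: (@filterS _ _ _ (fun n => (n0 <= n)%N)); last by exists n0 => // n /= h _.
  move=> n hn; rewrite /prob_regular; apply/andP; split.
    apply: ler_wpM2r; first by rewrite invr_ge0.
    rewrite ler_nat; apply: subset_leq_card; apply/fintype.subsetP=> G.
    rewrite !inE => /andP[GR /asboolP AG]; rewrite GR /=; apply/asboolP.
    by apply: AB AG => //; rewrite inE.
  have [->|c0] := eqVneq (#|regular_graphs n D|%:R : R) 0; first by rewrite invr0 mulr0.
  rewrite ler_pdivrMr ?mul1r; last by rewrite lt_neqAle eq_sym c0 /=.
  by rewrite ler_nat; apply: subset_leq_card; apply/fintype.subsetP=> G; rewrite inE => /andP[].
exact: cvg_cst.
Qed.

End Asymptotics.

Theorem theorem12 (R : realType) (Delta : nat) (hDelta : (5 <= Delta)%N)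
    (delta : R) (hdelta : expansion_constant Delta delta) :
  exists q0 : R, forall q : R, q0 <= q ->
  forall beta : R, 0 < beta <= beta_c q Delta ->
  exists C : R,
    whp R Delta (fun (n : nat) (G : {set {set 'I_n}}) =>
      exists T : nat,
        T%:R <= C * (n%:R * ln n%:R) /\
        dist_TV (rc_law q beta (all_out G) T) (gibbs_dis q beta delta)
          <= 1 / 5).
Proof.
have [/andP[d0 _] hw] := hdelta.
(* the degree threshold [d' + 2] is the largest integer below [Delta / 2] *)
pose d' := ((Delta.-1)./2 - 2)%N.
have eta0 : 0 < eta delta by rewrite /eta lt_min !divr_gt0.
pose N := (4 * Delta + (Num.truncn (16 * Delta%:R / (9 * eta delta))).+1)%N.
pose K : R := 2 ^+ (Delta ^ 2) * (270 * Delta%:R ^+ 2 * (2 * Delta%:R) ^+ Delta) ^+ (2 * Delta).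
have K0 : 0 <= K.
  apply: mulr_ge0; first exact: exprn_ge0.
  by apply: exprn_ge0; rewrite -natrM -!natrX -!natrM ler0n.
have two k : 0 < (2 : R) ^+ k by rewrite exprn_gt0.
exists (2 ^+ (9 * N + 4 * Delta) + K + 2 ^+ Delta + 1) => q hq beta /andP[b0 bc].
have p1 := two (9 * N + 4 * Delta)%N; have p2 := two Delta.
have [||||||||C [n0 H]] := @expander_mixing R Delta delta q beta N d' d0 _ _ b0.
- by rewrite /d'; move: hDelta; clear; lia.
- by rewrite /d'; move: hDelta; clear; lia.
- lra.
- by apply: expR_beta_c => //; lra.
- by rewrite /N leq_addr.
- rewrite -ler_pdivrMl; last by rewrite mulr_gt0.
  rewrite mulrC; apply: ltW; apply: lt_le_trans (truncnS_gt _) _.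
  by rewrite ler_nat /N leq_addl.
- by lra.
- by rewrite -/K; lra.
exists C; apply: (whp_impl (n0 := n0) _ hw) => n hn G GR [_ hphi].
exact: (H n hn G GR hphi).
Qed.
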